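(* Let $d\geq 2$ be an integer, let $F=F_{2,d}$ be the free nilpotent group of class $2$ on $d$ generators, and let $d'=\binom{d}{2}$. For all primes $p$, $$\zeta^\triangleleft_{F,p}(s)=\zeta_{\mathbb{Z}_p^d}(s)\,\zeta_p\big((d'+d)s-dd'\big)\,A(p,p^{-s}),$$ where $$A(p,p^{-s}):=\sum_{\substack{I\subseteq[d-2],\ J\subseteq[d'-1]\\ |I|=|J|,\ \phi(I)\leq J}}A_{I,J}(p,p^{-s})$$ and, if $I=\{i_1,\dots,i_h\}_<$ and $J=\{j_1,\dots,j_h\}_<$ (with $i_0:=j_0:=0$ and $j_{h+1}:=d'$), $$A_{I,J}(p,p^{-s}):=F_{d'-j_h}(p,\mathbf{X}_{j_h}^{d'})\,\zeta_{\mathbb{Z}_p^{i_h}}^{-1}(s)\cdot\prod_{r=1}^{h}\binom{j_{r+1}-\phi(i_r)}{j_r-\phi(i_r)}_{p^{-1}}\binom{d-i_{r-1}}{d-i_r}_{p^{-1}}\frac{Y_{i_r}}{(1-Y_{i_r})(1-Y'_{i_r})}\,F_{j_r-j_{r-1}}(p,\mathbf{X}_{j_{r-1}}^{j_r})\,F_{i_r-i_{r-1}}(p,\mathbf{Y}_{i_{r-1}}^{i_r})$$ with numerical data $(X_j)$, $(Y_i)$, $(Y'_{i_r})$ (depending on $I,J$) defined by $$X_j:=p^{\,i(j)(d-i(j))+(d'-j)(d+j-\phi(i(j)))-(d-i(j)+d'-j)s},\qquad j\in[d'-1],$$ $$Y_i:=p^{\,i(d-i)+(d'-j(i))(d+j(i)-\phi(i))-(d-i+d'-j(i))s},\qquad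 i\in[d-2],$$ $$Y'_{i_r}:=p^{\,i_{r-1}(d-i_{r-1})+(d'-j(i_r))(d+j(i_r)-\phi(i_{r-1}))-(d-i_{r-1}+d'-j(i_r))s},\qquad r\in[h],$$ where $$j(i):=\min\{j\in J\cup\{d'\}\mid \phi(i)\prec_{\phi(I),J}j\},\qquad i(j):=\max\{i\in I\cup\{0\}\mid \phi(i)\prec_{\phi(I),J}j\}.$$
   Context: Zeta functions. For a prime $p$ let $a^\triangleleft_{F,p^n}$ be the number of normal subgroups of $F$ of index $p^n$, and $\zeta^\triangleleft_{F,p}(s)=\sum_{n\geq 0}a^\triangleleft_{F,p^n}p^{-ns}$, with $s$ a complex variable. $\zeta_p(s)=\sum_{n\geq0}p^{-ns}=1/(1-p^{-s})$ is the local Riemann zeta function, and $\zeta_{\mathbb{Z}_p^n}(s)=\prod_{i=0}^{n-1}\zeta_p(s-i)$ for $n\geq 0$ (so it equals $1$ for $n=0$). Sets. $\mathbb{N}=\{1,2,\dots\}$; $[n]=\{1,\dots,n\}$ (empty for $n=0$); $[n]_0=[n]\cup\{0\}$; $n'=\binom n2=n(n-1)/2$. Writing $I=\{i_1,\dots,i_h\}_<$ means $i_1<\dots<i_h$. When $I=J=\emptyset$ we have $h=0$, $i_h=j_h=0$, and the product over $r$ is empty. Binomials. $\binom{a}{b}_p=\prod_{i=0}^{b-1}(p^a-p^i)/(p^b-p^i)$ for integers $a\geq b\geq 0$ (equal to $1$ for $b=0$); this is the number of $b$-dimensional subspaces of $\mathbb{F}_p^a$. $\binom{a}{b}_{p^{-1}}$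 is obtained by replacing $p$ by $p^{-1}$ in this expression. For $I=\{i_1,\dots,i_m\}_<\subseteq[n-1]$ put $b_{n,I}(p)=\binom{n}{i_m}_p\binom{i_m}{i_{m-1}}_p\cdots\binom{i_2}{i_1}_p$, the number of flags of dimension type $I$ in $\mathbb{F}_p^n$ ($b_{n,\emptyset}=1$). $b_{n,I}(p^{-1})$ is obtained by replacing $p$ by $p^{-1}$. The functions $F_n$ (not to be confused with the group $F$). For $n\in\mathbb{N}$ and variables $\mathbf{Z}=(Z_1,\dots,Z_{n-1})$ set $$F_n(p,\mathbf{Z})=\sum_{I\subseteq[n-1]}b_{n,I}(p^{-1})\prod_{i\in I}\frac{Z_i}{1-Z_i}.$$ For integers $0\leq a<b$ write $F_{b-a}(p,\mathbf{Z}_a^b)$ for $F_{b-a}(p,(Z_{a+1},\dots,Z_{b-1}))$. The map $\phi$. $\phi:[d-1]_0\to[d']_0$ is $\phi(i)=id-(i+1)'=id-\tfrac{i(i+1)}{2}$ (a strictly increasing map). For $I=\{i_1,\dots,i_h\}_<\subseteq[d-1]_0$ and $J=\{j_1,\dots,j_h\}_<\subseteq[d']$ of equal cardinality, $\phi(I)\leq J$ means $\phi(i_r)\leq j_r$ for all $r\in[h]$. The order $\prec$. Given sets $A,B\subseteq\mathbb{N}$ and subsets $I=\{i_1,\dots,i_h\}_<\subseteq A$, $J=\{j_1,\dots,j_h\}_<\subseteq B$, define a total order $\prec=\prec_{I,J}$ on the disjoint union $A\uplus B$ as follows. For distinct elements $x,y\in A\uplus B$, put $x\prec y$ if: - ($x,y$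 both in $A$ or both in $B$) $x<y$; - ($x\in A$, $y\in B$) there exists $r\in[h]$ with $x\leq i_r$ and $y\geq j_r$; - ($x\in B$, $y\in A$) for all $r\in[h]$, $j_r\leq x$ implies $i_r<y$. Here $<$ is the natural order on $\mathbb{N}$. In the theorem this is applied with $A=\phi([d-2])$, $B=[d'-1]$ and the subsets $\phi(I)\subseteq A$, $J\subseteq B$, giving $\prec_{\phi(I),J}$ on $\phi([d-2])\uplus[d'-1]$. Values $\phi(i)$ are regarded as elements of the first set and indices $j$ as elements of the second. The order is extended by $j_0=i_0=0$ (note $\phi(0)=0$) being smaller than every element of $\phi([d-2])\uplus[d'-1]$, and $j_{h+1}=d'$ being larger than every element of it. *)

(* Defs.v *)
(* MathComp / MathComp-Analysis; complex numbers are R[i] for R : realType *)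
From HB Require Import structures.
From mathcomp Require Export all_boot all_order all_algebra.
From mathcomp Require Export all_classical all_reals all_analysis.
From mathcomp Require Export finmap complex.

Set Implicit Arguments.
Unset Strict Implicit.
Unset Printing Implicit Defensive.

Export Order.TTheory GRing.Theory Num.Theory.
Export numFieldNormedType.Exports.

Local Open Scope classical_set_scope.
Local Open Scope ring_scope.

(* Nilpotent of class at most 2. *)
Definition nilpotent2 (G : groupType) : Prop :=
  forall x y z : G, ([~ [~ x, y], z] = 1)%g.

(* Universal property of the free object on d generators among the nilpotent
   groups of class at most 2; it determines F up to isomorphism. *)
Definition free_nilpotent2 (d : nat) (F : groupType) : Prop :=
  nilpotent2 F /\
  exists x : 'I_d -> F, forall H : groupType, nilpotent2 H ->
    (forall y : 'I_d -> H,
       exists f : {multiplicative F -> H}, forall i, f (x i) = y i) /\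
    (forall f g : {multiplicative F -> H},
       (forall i, f (x i) = g (x i)) -> f =1 g).

Definition normal_subgroup (G : groupType) (N : set G) : Prop :=
  [/\ N 1%g,
      forall x y, N x -> N y -> N (x * y^-1)%g
    & forall x y, N x -> N (x ^ y)%g].

Definition left_cosets (G : groupType) (N : set G) : set (set G) :=
  range (fun x : G => [set (x * y)%g | y in N]).

Definition has_index (G : groupType) (N : set G) (m : nat) : Prop :=
  (left_cosets N #= `I_m)%card.

(* [fset_set] is the empty set on infinite sets; a finitely generated group has
   finitely many subgroups of each finite index, so that case does not arise for
   the groups considered here. *)
Definition num_normal (G : groupType) (m : nat) : nat :=
  #|` fset_set [set N : set G | normal_subgroup N /\ has_index N m]|%fset.

Definition cexp (R : realType) (z : R[i]) : R[i] :=
  (expR (complex.Re z))%:C%C *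
  (cos (complex.Im z) +i* sin (complex.Im z))%C.

Definition npow (R : realType) (p : nat) (z : R[i]) : R[i] :=
  cexp ((ln (p%:R : R))%:C%C * z).

(* The series in n of a_{p^n} p ^ (- n s). [R[i]^o] is R[i] as a normed module
   over itself, which gives it the usual topology. *)
Definition zeta_series (R : realType) (G : groupType) (p : nat) (s : R[i]) :
    nat -> R[i]^o :=
  series (fun n : nat => (num_normal G (p ^ n))%:R * npow p (- (n%:R * s))).

Definition normal_zeta (R : realType) (G : groupType) (p : nat) (s : R[i]) :
    R[i] :=
  limn (zeta_series G p s).

Definition zeta_p (R : realType) (p : nat) (s : R[i]) : R[i] :=
  (1 - npow p (- s))^-1.

Definition zeta_Zp (R : realType) (p n : nat) (s : R[i]) : R[i] :=
  \prod_(i < n) zeta_p p (s - i%:R).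

(* A subset of {1,...,n} is coded as a set of ordinals below n+1 that does not
   contain 0. *)
Definition sub_pos (n : nat) (I : {set 'I_n.+1}) : bool := ord0 \notin I.

(* The elements of I in increasing order. *)
Definition elts (n : nat) (I : {set 'I_n}) : seq nat :=
  [seq val i | i <- enum I].

Definition qbinom (K : fieldType) (q : K) (a b : nat) : K :=
  \prod_(i < b) ((q ^+ a - q ^+ i) / (q ^+ b - q ^+ i)).

(* For s = [:: i_1; ...; i_m], the default value n plays the role of i_{m+1}. *)
Definition flag_num (K : fieldType) (q : K) (n : nat) (s : seq nat) : K :=
  \prod_(r < size s) qbinom q (nth n s r.+1) (nth 0%N s r).

(* Only the values of Z on {1,...,n-1} matter. *)
Definition Fn (K : fieldType) (p n : nat) (Z : nat -> K) : K :=
  \sum_(I : {set 'I_n.-1.+1} | sub_pos I)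
    flag_num (p%:R^-1) n (elts I) * \prod_(i in I) (Z i / (1 - Z i)).

(* F_{b-a}(p, (Z_{a+1}, ..., Z_{b-1})) *)
Definition Fab (K : fieldType) (p a b : nat) (Z : nat -> K) : K :=
  Fn p (b - a) (fun i => Z (a + i)%N).

Definition phi (d i : nat) : nat := (i * d - 'C(i.+1, 2))%N.

Definition phi_le (d : nat) (I J : seq nat) : bool :=
  all2 (fun i j => (phi d i <= j)%N) I J.

(* [inl] marks the elements of A and [inr] those of B; [S] and [T] list the two
   chosen subsets of A and of B in increasing order. *)
Definition prec (S T : seq nat) (u v : nat + nat) : bool :=
  match u, v with
  | inl x, inl y | inr x, inr y => (x < y)%N
  | inl x, inr y =>
      [exists r : 'I_(size S), (x <= nth 0 S r)%N && (nth 0 T r <= y)%N]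
  | inr x, inl y =>
      [forall r : 'I_(size S), (nth 0 T r <= x)%N ==> (nth 0 S r < y)%N]
  end.

(* [prec] extended by the smallest element 0, coming from either side, and by
   the largest element [inr D]. *)
Definition prec_ext (D : nat) (S T : seq nat) (u v : nat + nat) : bool :=
  let bottom w := (w == inl 0%N) || (w == inr 0%N) in
  let top w := w == inr D in
  if bottom v || top u then false
  else if bottom u || top v then true
  else prec S T u v.

(* D stands for d' = 'C(d, 2), and I and J are increasing lists. *)

Definition prec_phi (d : nat) (I J : seq nat) (i j : nat) : bool :=
  prec_ext 'C(d, 2) [seq phi d k | k <- I] J (inl (phi d i)) (inr j).

Definition j_of (d : nat) (I J : seq nat) (i : nat) : nat :=
  let D := 'C(d, 2) in
  \big[minn/D]_(j <- rcons J D | prec_phi d I J i j) j.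

Definition i_of (d : nat) (I J : seq nat) (j : nat) : nat :=
  \max_(i <- 0%N :: I | prec_phi d I J i j) i.

(* p ^ (i (d - i) + (d' - j) (d + j - phi i) - (d - i + d' - j) s), the common
   shape of X_j, Y_i and Y'_{i_r}; the subtractions are taken in R[i]. *)
Definition numdata (R : realType) (d p : nat) (s : R[i]) (i j : nat) : R[i] :=
  let D := 'C(d, 2) in
  npow p (i%:R * (d%:R - i%:R)
          + (D%:R - j%:R) * (d%:R + j%:R - (phi d i)%:R)
          - (d%:R - i%:R + D%:R - j%:R) * s).

Definition dataX (R : realType) (d p : nat) (s : R[i]) (I J : seq nat)
    (j : nat) : R[i] :=
  numdata d p s (i_of d I J j) j.

Definition dataY (R : realType) (d p : nat) (s : R[i]) (I J : seq nat)
    (i : nat) : R[i] :=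
  numdata d p s i (j_of d I J i).

(* Y'_{i_r} depends on both i_{r-1} and i_r; they are given here as i' and i. *)
Definition dataY' (R : realType) (d p : nat) (s : R[i]) (I J : seq nat)
    (i' i : nat) : R[i] :=
  numdata d p s i' (j_of d I J i).

(* [i_ 0 = j_ 0 = 0], [i_ r] and [j_ r] are the r-th elements for 1 <= r <= h,
   and [j_ h.+1 = D]. *)
Definition A_IJ (R : realType) (d p : nat) (s : R[i]) (I J : seq nat) : R[i] :=
  let D := 'C(d, 2) in
  let h := size I in
  let i_ r := nth 0%N (0%N :: I) r in
  let j_ r := nth 0%N (0%N :: rcons J D) r in
  let X := dataX d p s I J in
  let Y := dataY d p s I J in
  let Y' r := dataY' d p s I J (i_ r.-1) (i_ r) in
  Fab p (j_ h) D X * (zeta_Zp p (i_ h) s)^-1 *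
  \prod_(1 <= r < h.+1)
    (qbinom p%:R^-1 (j_ r.+1 - phi d (i_ r)) (j_ r - phi d (i_ r)) *
     qbinom p%:R^-1 (d - i_ r.-1) (d - i_ r) *
     (Y (i_ r) / ((1 - Y (i_ r)) * (1 - Y' r))) *
     Fab p (j_ r.-1) (j_ r) X *
     Fab p (i_ r.-1) (i_ r) Y).

Definition A_sum (R : realType) (d p : nat) (s : R[i]) : R[i] :=
  \sum_(I : {set 'I_(d - 2).+1} | sub_pos I)
    \sum_(J : {set 'I_('C(d, 2) - 1).+1} |
          [&& sub_pos J, #|I| == #|J| & phi_le d (elts I) (elts J)])
      A_IJ d p s (elts I) (elts J).

(* Main.v *)
From HB Require Import structures.
Require Import Defs.
From mathcomp Require Import all_boot all_order all_algebra all_fingroup all_solvable.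
From mathcomp Require Import ring lra zify.

(** Put D = d', and let L be the row vectors of length d and K the
    alternating d x d matrices over Z/p^N, for N large. On L x K there is a group
    of class two whose commutator form is the wedge product x^T y - y^T x.

    A normal subgroup of F of index p^n contains the kernel of the map from F to
    this group, because F modulo the subgroup receives a map from it as well; so
    normal subgroups may be counted in the finite model ([num_normal_model]).
    There, a normal subgroup C is governed by its projection Lam to L and its slice
    M in K: the condition is that M contains the span of Lam ^ L, and then C / M
    is a complement of K / M in an abelian group, so that each pair (Lam, M) carries
    |K : M|^d normal subgroups ([count_model]).

    Say that (Lam, M) is in the state (i, j) when Lam and M have colengths d - i
    and D - j modulo p. The span of Lam ^ L then has colength 'C(d - i, 2), which
    is D - phi(i), so phi(i) <= j. Replacing both lattices by their p-th roots
    (all x with p x in the lattice) yields a pair of smaller index, unless the state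
    is (d, D), and the number of pairs in a given state and with a given root is a
    power of p times a product of two Gaussian binomials, because the
    p-th root of the span of Lam ^ L is the span of (root Lam) ^ L: this is seen on
    the Smith normal form ([wedge_span_root]). At t = p^(-s) the resulting
    recursion ([weighted_count_rec]) reads
      u(x) = W(x) * sum over y >= x of B(x, y) u(y)
    for the generating functions u(x) of the states, where W(i, j) is the common
    shape [numdata] of the X_j, Y_i and Y'_{i_r}, and u(d, D) = 1. The bottom state
    is (d, D), and y >= x is the product order.

    The series converges exactly when |W(x)| < 1 for all other states x: the
    recursion is a geometric recursion with ratio W(x), perturbed by states that
    have already been summed ([tends_recursion]), and following the
    constant chain at x bounds the coefficients from below ([normal_count_lower]).

    It remains to solve the linear system. A coefficient B(x, y) is a product of a
    factor for the move in i and one for the move in j. Consecutive moves in one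
    direction add up to a function F_n ([chain_solve]), and on the last column
    j = D the whole sum is a quotient of zeta functions of free abelian groups, by a
    finite q-binomial theorem ([last_column]). Alternating runs in j and in i
    describe the solution as a sum over lattice paths from (0, 0) with corners
    (i_r, j_r), that is, over the pairs (I, J) ([path_total]). The index functions
    i(j) and j(i) name the row, respectively the column, in which the path meets a
    given column or row, so the numerical data are the values of W along
    the path ([A_IJ_path_factor]). *)

Set Implicit Arguments.
Unset Strict Implicit.
Unset Printing Implicit Defensive.

Local Open Scope ring_scope.

(** * Subgroups of elementary abelian sections *)

Lemma qbinomn0 (K : fieldType) (q : K) a : qbinom q a 0 = 1.
Proof. by rewrite /qbinom big_ord0. Qed.

Lemma qbinom0S (K : fieldType) (q : K) b : qbinom q 0 b.+1 = 0.
Proof. by rewrite /qbinom big_ord_recl /= subrr !mul0r. Qed.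

Lemma qbinom_rec (K : fieldType) (q : K) a b : q != 0 ->
  q ^+ b.+1 != 1 ->
  qbinom q a.+1 b.+1 * (q ^+ b.+1 - 1) = (q ^+ a.+1 - 1) * qbinom q a b.
Proof.
move=> q0 qb; rewrite /qbinom big_ord_recl /= expr0.
rewrite mulrAC mulfVK ?subr_eq0 //; congr (_ * _).
apply: eq_bigr => i _; rewrite /bump /= add1n !exprS -!mulrBr invfM.
by rewrite mulrACA divff // mul1r.
Qed.

Section CountComplements.

Local Open Scope group_scope.

Variables (gT : finGroupType) (p : nat) (A : {group gT}).
Hypotheses (p_pr : prime p) (abA : abelian A).

Definition transversals (B C : {group gT}) k :=
  [set H : {group gT} |
    [&& B \subset H, H \subset A, H :&: C == B & #|H| == (p ^ k * #|B|)%N]].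

Lemma card_adjoin (B : {group gT}) x : B \subset A -> x \in A -> x \notin B ->
  x ^+ p \in B -> #|B <*> <[x]>| = (p * #|B|)%N.
Proof.
move=> sBA Ax Bx Bxp.
have nBx : x \in 'N(B).
  by apply: (subsetP (sub_abelian_norm abA sBA)).
have sxN : <[x]> \subset 'N(B) by rewrite cycle_subG.
have nb : normal B (B <*> <[x]>) by rewrite /normal joing_subl join_subG normG.
rewrite -(Lagrange (normal_sub nb)) mulnC; congr (_ * _)%N.
rewrite -card_quotient ?normal_norm // quotientYidl // quotient_cycle //.
apply: nt_prime_order => //; last first.
  by apply: contra Bx => /eqP /coset_idr; apply.
by rewrite -morphX //; apply: coset_id.
Qed.

(** A member through x contains B<x>, and it meets C<x> in exactly B<x>:
    since x has order p modulo B, the part of <x> inside C lies in B. *)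
Lemma transversals_mem (B C : {group gT}) k x :
  B \subset C -> C \subset A -> x \in A -> x \notin C -> x ^+ p \in B ->
  [set H in transversals B C k.+1 | x \in gval H] =
  transversals (B <*> <[x]>) (C <*> <[x]>) k.
Proof.
move=> sBC sCA Ax Cx Bxp; have sBA := subset_trans sBC sCA.
have Bx : x \notin B by apply: contra Cx; apply: (subsetP sBC).
have xA : <[x]> \subset A by rewrite cycle_subG.
have cA (H G : {group gT}) : H \subset A -> G \subset A -> H <*> G = H * G.
  by move=> hH hG; rewrite cent_joinEr //; apply: (sub_abelian_cent2 abA).
apply/setP => H; rewrite !inE card_adjoin //= expnSr -mulnA.
rewrite join_subG cycle_subG.
case Hx: (x \in H); rewrite ?andbF ?andbT //=.
case BH: (B \subset H) => //=; case sHA: (H \subset A) => //=; congr (_ && _).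
have xH : <[x]> \subset H by rewrite cycle_subG.
have E : H :&: (C <*> <[x]>) = (H :&: C) * <[x]>.
  by rewrite cA // -group_modr.
rewrite E cA //; apply/eqP/eqP => [->//|e].
apply/eqP; rewrite eqEsubset; apply/andP; split; last by rewrite subsetI BH sBC.
apply/subsetP => y /[dup] yHC; rewrite inE => /andP [Hy Cy].
have : y \in B * <[x]> by rewrite -e -[y]mulg1 mem_mulg.
case/mulsgP => b z Bb xz eyz.
have Cz : z \in C.
  have -> : z = b^-1 * y by rewrite eyz mulKg.
  by rewrite groupM // groupV (subsetP sBC).
have e2 : <[x]> :&: C \subset B.
  have [pB|pB] := eqVneq (<[x]> :&: B) <[x]>.
    by case/negP: Bx; rewrite -cycle_subG -pB subsetIr.
  have : C :&: <[x]> \subset <[x ^+ p]>.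
    apply/subsetP => w; rewrite inE => /andP [Cw /cycleP [m em]].
    have [dv|ndv] := boolP (p %| m)%N.
      by rewrite em -(divnK dv) mulnC expgM mem_cycle.
    case/negP: Cx; have cop : coprime m p by rewrite coprime_sym prime_coprime.
    have m0 : (0 < m)%N by case: (m) ndv => //; rewrite dvdn0.
    case: (egcdnP p m0) => u v euv _.
    move: cop; rewrite /coprime => /eqP g1; rewrite g1 in euv.
    have : x ^+ (u * m) = x ^+ (v * p) * x by rewrite euv expgD expg1.
    move=> ex; have -> : x = (x ^+ (v * p))^-1 * x ^+ (u * m) by rewrite ex mulKg.
    rewrite groupM ?groupV //.
      by rewrite mulnC expgM groupX // (subsetP sBC).
    by rewrite mulnC expgM -em groupX.
  move/subset_trans; rewrite setIC; apply.
  by rewrite cycle_subG.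
by rewrite eyz groupM // (subsetP e2) // inE xz.
Qed.

(** The quotient of A by B is elementary abelian, so the members are the subspaces
    of dimension k that meet a given subspace of dimension w trivially. Choosing
    an element outside B first gives an induction on k. *)
Lemma card_transversals (K : numFieldType) (B C : {group gT}) n w k :
  B \subset C -> C \subset A -> (forall x, x \in A -> x ^+ p \in B) ->
  #|A| = (p ^ n * #|B|)%N -> #|C| = (p ^ w * #|B|)%N ->
  (#|transversals B C k|%:R = p%:R ^+ (w * k) * qbinom p%:R (n - w) k :> K)%R.
Proof.
have p1 := prime_gt1 p_pr; have p0 := prime_gt0 p_pr.
elim: k B C n w => [|k IH] B C n w sBC sCA Ap cA cC.
  rewrite muln0 expr0 qbinomn0 mulr1.
  suff -> : transversals B C 0 = [set B] by rewrite cards1.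
  apply/setP => H; rewrite !inE mul1n -val_eqE.
  apply/idP/eqP => [/and4P [BH _ _ /eqP e]|->].
    by apply/esym/val_inj/eqP; rewrite eqEcard BH e leqnn.
  by rewrite subxx (subset_trans sBC sCA) (setIidPl sBC) !eqxx.
have B0 : (0 < #|B|)%N by rewrite cardG_gt0.
have leW : (w <= n)%N.
  by move: (subset_leq_card sCA); rewrite cA cC leq_pmul2r // leq_exp2l.
have pos (z : nat) : (0 < z)%N -> (z%:R != 0 :> K)%R by move=> ?; rewrite pnatr_eq0 -lt0n.
(* double counting of the pairs x in H with x outside B *)
have dc : (\sum_(H in transversals B C k.+1) #|gval H :\: B| =
   \sum_(x in A :\: C) #|transversals (B <*> <[x]>) (C <*> <[x]>) k|)%N.
  transitivity (\sum_(H in transversals B C k.+1) \sum_(x in A :\: C) (x \in gval H))%N.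
    apply: eq_bigr => H; rewrite inE => /and4P [BH HA /eqP HC _].
    rewrite -sum1_card big_mkcond [RHS]big_mkcond /=; apply: eq_bigr => x _.
    rewrite !inE; have [Hx|nHx] := boolP (x \in H); last first.
      by rewrite andbF; case: ifP.
    by rewrite (subsetP HA) //= -HC inE Hx /=; case: (x \in C).
  rewrite exchange_big /=; apply: eq_bigr => x; rewrite inE => /andP [Cx Ax].
  rewrite -transversals_mem ?Ap // -sum1_card [RHS]big_mkcond [LHS]big_mkcond /=.
  by apply: eq_bigr => H _; rewrite [in RHS]inE; case: (H \in _); case: (x \in _).
have L : (\sum_(H in transversals B C k.+1) #|gval H :\: B| =
   #|transversals B C k.+1| * ((p ^ k.+1 - 1) * #|B|))%N.
  rewrite -sum_nat_const; apply: eq_bigr => H; rewrite inE => /and4P [BH _ _ /eqP e].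
  by rewrite cardsD (setIidPr BH) e mulnBl mul1n.
have R : ((\sum_(x in A :\: C) #|transversals (B <*> <[x]>) (C <*> <[x]>) k|)%:R =
   (p ^ n - p ^ w)%:R * #|B|%:R * p%:R ^+ (w * k) * qbinom p%:R (n - w).-1 k :> K)%R.
  rewrite natr_sum.
  transitivity (\sum_(x in A :\: C) (p%:R ^+ (w * k) * qbinom p%:R (n - w).-1 k) : K)%R.
    apply: eq_bigr => x; rewrite inE => /andP [Cx Ax].
    have nw : (w < n)%N.
      rewrite ltn_neqAle leW andbT; apply: contra Cx => /eqP e.
      suff -> : C :=: A by [].
      by apply/eqP; rewrite eqEcard sCA cA cC e /=.
    have Bx : x \notin B by apply: contra Cx; apply: (subsetP sBC).
    have sBA := subset_trans sBC sCA.
    have cB' := card_adjoin sBA Ax Bx (Ap _ Ax).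
    have cC' := card_adjoin sCA Ax Cx (subsetP sBC _ (Ap _ Ax)).
    have -> : (n - w).-1 = (n.-1 - w)%N by rewrite -!subn1 subnAC.
    have e1 : #|A| = (p ^ n.-1 * #|B <*> <[x]>|)%N.
      by rewrite /= cB' mulnA -expnSr prednK // (leq_ltn_trans _ nw).
    have e2 : #|C <*> <[x]>| = (p ^ w * #|B <*> <[x]>|)%N.
      by rewrite /= cB' cC' cC mulnCA.
    apply: (IH (B <*> <[x]>)%G (C <*> <[x]>)%G _ _ _ _ _ e1 e2) => [||y /Ap] /=.
    - by apply: genS; apply: setSU.
    - by rewrite join_subG sCA cycle_subG.
    - by apply: subsetP; apply: joing_subl.
  rewrite sumr_const -[LHS]mulr_natl !mulrA -natrM; congr (_%:R * _ * _)%R.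
  by rewrite cardsD (setIidPr sCA) cA cC mulnBl.
move/(congr1 (fun z => z%:R : K)): dc; rewrite L R.
rewrite !natrM mulrA natrB ?expn_gt0 ?p0 // natrB ?leq_exp2l // !natrX.
have Bn0 := pos _ B0.
have pk1 : ((p%:R ^+ k.+1 : K) != 1)%R.
  by rewrite -natrX pnatr_eq1 -(expn0 p) eqn_exp2l.
move=> e; apply: (@mulIf _ (p%:R ^+ k.+1 - 1)%R); first by rewrite subr_eq0.
apply: (mulIf Bn0); rewrite {}e.
case nw: (n - w)%N => [|m].
  have -> : n = w by apply/eqP; rewrite eqn_leq leW -subn_eq0 nw.
  by rewrite qbinom0S subrr !(mul0r, mulr0).
rewrite -[in RHS](mulrA _ (qbinom _ _ _)) qbinom_rec //; last exact: pos.
have -> : n = (w + m.+1)%N by rewrite -nw subnKC.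
by rewrite mulnS !exprD /=; ring.
Qed.

End CountComplements.

(** * Lattices with a prescribed p-th root *)

Section PowerMap.

Local Open Scope group_scope.

Variables (gT : finGroupType) (X : {group gT}) (abX : abelian X) (p : nat).

Lemma powm_morph : {in X &, {morph (fun x => x ^+ p) : x y / x * y}}.
Proof. by move=> x y Xx Xy; apply: expgMn; apply: (centsP abX). Qed.

Definition powm : {morphism X >-> gT} := Morphism powm_morph.

Lemma powmE x : powm x = x ^+ p. Proof. by []. Qed.

Lemma im_powm_sub (H : {group gT}) : H \subset X -> powm @* H \subset H.
Proof.
move=> sHX; apply/subsetP => y /morphimP [x Xx Hx ->]; rewrite powmE.
exact: groupX.
Qed.

Lemma mem_im_powm (H : {group gT}) x : x \in X -> x \in H ->
  x ^+ p \in powm @* H.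
Proof. by move=> Xx Hx; rewrite -powmE mem_morphim. Qed.

Lemma joinX_E (H G : {group gT}) : H \subset X -> G \subset X -> H <*> G = H * G.
Proof. by move=> hH hG; rewrite cent_joinEr //; apply: (sub_abelian_cent2 abX). Qed.

Lemma card_joinX (H G : {group gT}) : H \subset X -> G \subset X ->
  (#|H <*> G| * #|H :&: G| = #|H| * #|G|)%N.
Proof. by move=> hH hG; rewrite joinX_E // mul_cardG. Qed.

Lemma morphim_pre (H : {group gT}) : powm @* (powm @*^-1 H) = H :&: powm @* X.
Proof. by rewrite -morphpreIim morphpreK ?subsetIl // setIC. Qed.

(** The p-th power map identifies the quotient of X by the p-th root of H with
    H (X^p) / H. *)
Lemma index_root (H : {group gT}) : H \subset X ->
  #|X : H| = (#|X : H <*> powm @* X| * #|X : powm @*^-1 H|)%N.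
Proof.
move=> sHX; have sfX : powm @* X \subset X by apply: im_powm_sub.
have sJ : H <*> powm @* X \subset X by rewrite join_subG sHX.
have pX : powm @*^-1 (powm @* X) = X.
  by apply: morphimGK => //; apply: subsetIl.
rewrite -(Lagrange_index sJ (joing_subl _ _)); congr (_ * _)%N.
have -> : #|X : powm @*^-1 H| = #|powm @* X : H|.
  by have := @index_morphpre _ _ _ powm (powm @* X) H (subxx _); rewrite pX.
have e : (#|H <*> powm @* X : H| * #|H| = #|powm @* X : H| * #|H|)%N.
  rewrite mulnC Lagrange ?joing_subl //.
  apply/eqP; rewrite -(eqn_pmul2r (cardG_gt0 (powm @* X :&: H))).
  have CJ := card_joinX sHX sfX; rewrite setIC in CJ.
  have IL := Lagrange (subsetIl (powm @* X) H); rewrite indexgI in IL.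
  by rewrite /= CJ -{1}IL; apply/eqP; ring.
by move/eqP: e; rewrite eqn_pmul2r // => /eqP.
Qed.

Hypothesis p_pr : prime p.

(** Prescribing the p-th root L1 removes one layer of the lattice H; the bound D
    from below serves for slices, which contain a given span of wedges. *)
Definition lattices_over (D L1 : {group gT}) b :=
  [set H : {group gT} | [&& D \subset H, H \subset X, powm @*^-1 H == L1
     & #|X : H <*> powm @* X| == (p ^ b)%N]].

(** Write f for the power map. Such an H lies between (f L1) D and L1, and having
    L1 as p-th root means meeting f X in no more than f L1. So H is a transversal
    to (f X :&: L1) D in L1 modulo (f L1) D, where these have dimensions w and c. *)
Lemma card_lattices_over (K : numFieldType) (D L1 : {group gT}) w c b :
  'ker powm \subset L1 -> L1 \subset X -> D \subset L1 ->
  D :&: powm @* X \subset powm @* L1 ->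
  #|X : L1 <*> powm @* X| = (p ^ w)%N ->
  #|X : D <*> powm @* X| = (p ^ c)%N -> (b <= c)%N ->
  (#|lattices_over D L1 b|%:R =
     p%:R ^+ (w * (c - b)) * qbinom p%:R (c - w) (c - b) :> K)%R.
Proof.
move=> skL sLX sDL sDfL iw ic leb.
have sDX := subset_trans sDL sLX.
have sfLL := im_powm_sub sLX; have sfLX := subset_trans sfLL sLX.
have sfXX : powm @* X \subset X by apply: im_powm_sub.
pose B := (powm @* L1 <*> D)%G; pose C := ((powm @* X :&: L1) <*> D)%G.
have sIX : powm @* X :&: L1 \subset X by rewrite subIset // sfXX.
have BE : B :=: powm @* L1 * D by apply: joinX_E.
have CE : C :=: (powm @* X :&: L1) * D by apply: (@joinX_E (powm @* X :&: L1)%G).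
have sBC : B \subset C.
  by rewrite BE CE mulSg // subsetI morphimS.
have sCL : C \subset L1 by rewrite join_subG subsetIr.
have LpB x : x \in L1 -> x ^+ p \in B.
  move=> Lx; apply: (subsetP (joing_subl _ _)).
  by apply: mem_im_powm => //; apply: (subsetP sLX).
have ID : D :&: powm @* L1 = D :&: powm @* X.
  apply/eqP; rewrite eqEsubset setIS ?morphimS //=.
  by rewrite subsetI subsetIl.
have kc : (#|'ker powm| * #|powm @* L1| = #|L1|)%N.
  rewrite card_morphim (setIidPr sLX) Lagrange //.
have kX : (#|'ker powm| * #|powm @* X| = #|X|)%N.
  by rewrite card_morphim setIid Lagrange // subsetIl.
have cB : #|L1| = (p ^ c * #|B|)%N.
  have := card_joinX sfLX sDX; rewrite setIC ID => e1.
  have := card_joinX sDX sfXX => e2.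
  have := Lagrange (_ : D <*> powm @* X \subset X); rewrite join_subG sDX sfXX ic => /(_ isT) e3.
  apply/eqP; rewrite -(eqn_pmul2r (cardG_gt0 (D :&: powm @* X))) -mulnA e1.
  have := cardG_gt0 (powm @* X) => f0; rewrite -(eqn_pmul2r f0); apply/eqP.
  move: e1 e2 e3; rewrite -kc -kX /=.
  move: #|_ <*> _| #|_ :&: _| #|_ @* X| #|_ @* L1| #|D| #|'ker _| (p ^ c)%N #|_ <*> _| => a b1 b2 b3 b4 b5 b6 b7.
  move=> _ e2 e3; transitivity (b3 * (a * b1 * b6))%N; last by rewrite e2; ring.
  by transitivity (b3 * b1 * (b5 * b2))%N; [|rewrite -e3]; ring.
have cC : #|C| = (p ^ w * #|B|)%N.
  have sJ : L1 <*> powm @* X \subset X by rewrite join_subG sLX sfXX.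
  have := card_joinX sLX sfXX => e1.
  have := Lagrange sJ; rewrite iw => e2.
  have e3 := card_joinX sfLX sDX.
  have e4 := @card_joinX (powm @* X :&: L1)%G _ sIX sDX.
  have e5 : (powm @* X :&: L1) :&: D = powm @* L1 :&: D.
    by rewrite -setIA (setIidPr sDL) setIC -ID setIC.
  rewrite e5 in e4.
  have f0 := cardG_gt0 (powm @* X); have i0 := cardG_gt0 (powm @* L1 :&: D).
  have k0 := cardG_gt0 ('ker powm); have d0 := cardG_gt0 D.
  have h1 : #|powm @* X :&: L1| = (p ^ w * #|powm @* L1|)%N.
    rewrite -kX in e2; rewrite -kc setIC in e1.
    have J0 := cardG_gt0 (L1 <*> powm @* X).
    apply/eqP; rewrite -(eqn_pmul2l J0) e1 mulnA e2; apply/eqP; ring.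
  apply/eqP; rewrite -(eqn_pmul2r i0) e4 -mulnA e3 h1; apply/eqP; ring.
rewrite -(card_transversals p_pr (abelianS sLX abX) _ _ sBC sCL LpB cB cC).
congr (_%:R)%R; apply: eq_card => H; rewrite !inE.
have idx : H \subset L1 -> powm @*^-1 H = L1 ->
    (#|X : H <*> powm @* X| == (p ^ b)%N) = (#|H| == (p ^ (c - b) * #|B|)%N).
  move=> sHL eL; have sHX := subset_trans sHL sLX.
  have := index_root sHX; rewrite eL -(Lagrange_index sLX sHL) mulnC => /eqP.
  rewrite eqn_pmul2r ?indexg_gt0 // => /eqP <-.
  have L := Lagrange sHL.
  rewrite -(eqn_pmul2l (cardG_gt0 H)) L cB -{1}(subnKC leb) expnD.
  have pb : (0 < p ^ b)%N by rewrite expn_gt0 prime_gt0.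
  by rewrite [(#|H| * _)%N]mulnC -mulnA eqn_pmul2l // eq_sym.
apply/and4P/and4P => [[sDH sHX /eqP eL iH]|[sBH sHL /eqP HC iH]].
  have sHL : H \subset L1.
    apply/subsetP => x Hx; rewrite -eL !inE (subsetP sHX) //=.
    exact: groupX.
  have fL : powm @* L1 = H :&: powm @* X by rewrite -eL morphim_pre.
  split=> //.
  - by rewrite join_subG sDH fL subsetIl.
  - apply/eqP; rewrite CE BE -group_modr // setIA -fL.
    by rewrite (setIidPl sfLL).
  - by rewrite -idx.
have eL : powm @*^-1 H = L1.
  apply/eqP; rewrite eqEsubset; apply/andP; split; last first.
    rewrite -sub_morphim_pre //; apply: subset_trans sBH; apply: joing_subl.
  apply/subsetP => x; rewrite !inE => /andP [Xx Hx].
  have : x ^+ p \in B.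
    rewrite -HC inE Hx CE -[x ^+ p]mulg1 mem_mulg // inE mem_im_powm //.
    exact: (subsetP sHL).
  rewrite BE => /mulsgP [y d fy Dd e].
  have xX : x ^+ p \in powm @* X by apply: mem_im_powm.
  have fd : d \in powm @* L1.
    apply: (subsetP sDfL); rewrite inE Dd -(mulKg y d) -e groupM ?groupV //.
    by apply: (subsetP (morphimS _ sLX)).
  have : x ^+ p \in powm @* L1 by rewrite e groupM.
  by move=> h; rewrite -(morphimGK skL sLX) !inE Xx.
split; rewrite ?eL ?eqxx //; last by rewrite idx.
  exact: subset_trans (joing_subr _ _) sBH.
exact: subset_trans sHL sLX.
Qed.

Lemma lattices_overP (D L1 H : {group gT}) b : H \in lattices_over D L1 b ->
  #|X : H| = (p ^ b * #|X : L1|)%N.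
Proof.
by rewrite inE => /and4P [_ sHX /eqP eL /eqP iH]; rewrite index_root // eL iH.
Qed.

End PowerMap.

(** * Lattices modulo p^N and their exterior squares *)

Section Divisibility.

Variables (p N : nat).
Hypotheses (p_pr : prime p) (N_gt0 : (0 < N)%N).

Local Notation R := 'Z_(p ^ N).

Lemma pN_gt1 : (1 < p ^ N)%N.
Proof. by rewrite -(exp1n N) ltn_exp2r // prime_gt1. Qed.

Lemma pN_cast : (Zp_trunc (p ^ N)).+2 = (p ^ N)%N.
Proof. exact: Zp_cast pN_gt1. Qed.

Lemma natrN0 : (p ^ N)%:R = 0 :> R.
Proof. by rewrite pchar_Zp // pN_gt1. Qed.

(** For k <= N divisibility by p ^ k does not depend on the representative. *)
Definition divR (k : nat) (z : R) : bool := (p ^ k %| (z : nat))%N.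

Lemma divR_nat k n : (k <= N)%N -> divR k n%:R = (p ^ k %| n)%N.
Proof.
move=> lek; rewrite /divR val_Zp_nat ?pN_gt1 // /dvdn modn_dvdm //.
exact: dvdn_exp2l.
Qed.

Lemma divRP k (z : R) : (k <= N)%N ->
  reflect (exists w, z = (p ^ k)%:R * w) (divR k z).
Proof.
move=> lek; apply: (iffP idP) => [dz|[w ->]].
  exists (z %/ p ^ k)%:R; rewrite -natrM mulnC divnK //.
  by rewrite natr_Zp.
by rewrite -(natr_Zp w) -natrM divR_nat // dvdn_mulr.
Qed.

Lemma divR0z z : divR 0 z. Proof. by rewrite /divR expn0 dvd1n. Qed.

Lemma divRz0 k : divR k 0. Proof. by rewrite /divR dvdn0. Qed.

Lemma divRD k z w : (k <= N)%N -> divR k z -> divR k w -> divR k (z + w).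
Proof.
move=> lek /(divRP _ lek) [z' ->] /(divRP _ lek) [w' ->].
by apply/divRP => //; exists (z' + w'); rewrite mulrDr.
Qed.

Lemma divRMr k z w : (k <= N)%N -> divR k z -> divR k (z * w).
Proof.
move=> lek /(divRP _ lek) [z' ->].
by apply/divRP => //; exists (z' * w); rewrite mulrA.
Qed.

Lemma divRMl k z w : (k <= N)%N -> divR k z -> divR k (w * z).
Proof. by move=> lek dz; rewrite mulrC divRMr. Qed.

Lemma divRN k z : (k <= N)%N -> divR k z -> divR k (- z).
Proof. by move=> lek dz; rewrite -mulN1r divRMl. Qed.

Lemma divR_le k l z : (l <= k)%N -> divR k z -> divR l z.
Proof. by move=> lelk; apply: dvdn_trans; apply: dvdn_exp2l. Qed.

Lemma divRN0 z : divR N z -> z = 0.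
Proof. by move=> /(divRP _ (leqnn N)) [w ->]; rewrite natrN0 mul0r. Qed.

Lemma divR_mulp k z : (k <= N)%N -> divR k (p%:R * z) = divR k.-1 z.
Proof.
case: k => [|k] lek; first by rewrite !divR0z.
rewrite -{1}(natr_Zp z) -natrM divR_nat // expnS dvdn_pmul2l ?prime_gt0 //.
Qed.

Lemma card_divR k : (k <= N)%N -> #|[set z : R | divR k z]| = (p ^ (N - k))%N.
Proof.
move=> lek; have pk0 : (0 < p ^ k)%N by rewrite expn_gt0 prime_gt0.
have lt (i : 'I_(p ^ (N - k))) : (p ^ k * i < p ^ N)%N.
  by rewrite -{2}(subnKC lek) expnD ltn_pmul2l.
pose f (i : 'I_(p ^ (N - k))) : R := (p ^ k * i)%:R.
have vf i : f i = (p ^ k * i)%N :> nat by rewrite val_Zp_nat ?pN_gt1 // modn_small.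
rewrite -(card_ord (p ^ (N - k))) -(@card_imset _ _ f); last first.
  move=> i j /(congr1 (fun z : R => z : nat)); rewrite !vf => /eqP.
  by rewrite eqn_pmul2l // => /eqP /val_inj.
apply: eq_card => z; rewrite !inE; apply/idP/imsetP => [dz|[i _ ->]].
  have lz : (z %/ p ^ k < p ^ (N - k))%N.
    rewrite ltn_divLR // -expnD subnK //.
    by have := ltn_ord z; rewrite {2}pN_cast.
  by exists (Ordinal lz) => //; rewrite /f /= mulnC divnK // natr_Zp.
by rewrite /f divR_nat // dvdn_mulr.
Qed.

(** A residue is a unit times the power of p that divides it. *)
Lemma divR_gen (a : R) : exists2 k, (k <= N)%N &
  forall z, (exists y, z = y * a) <-> divR k z.
Proof.
have [a0|an0] := eqVneq (a : nat) 0%N.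
  have -> : a = 0 by apply: val_inj.
  exists N => // z; split=> [[y ->]|/divRN0 ->]; first by rewrite mulr0 divRz0.
  by exists 0; rewrite mulr0.
have a0 : (0 < a)%N by rewrite lt0n.
have [m co ea] := pfactor_coprime p_pr a0.
set k := logn p a in ea.
have leN : (k <= N)%N.
  rewrite -ltnS; have : (p ^ k < p ^ N)%N.
    apply: leq_ltn_trans (_ : a < p ^ N)%N.
      by rewrite ea leq_pmull //; case: m co ea => // _ ea; rewrite ea mul0n in an0.
    by have := ltn_ord a; rewrite {2}pN_cast.
  by rewrite ltn_exp2l ?prime_gt1 // => /ltnW; rewrite ltnS.
have eR : a = m%:R * (p ^ k)%:R by rewrite -natrM -ea natr_Zp.
have um : m%:R \is a @GRing.unit R.
  by rewrite unitZpE ?pN_gt1 // coprimeXl.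
exists k => // z; split=> [[y ->]|/(divRP _ leN) [w ->]].
  by apply/divRP => //; exists (y * m%:R); rewrite eR; ring.
by exists (w / m%:R); rewrite eR mulrA mulrVK // mulrC.
Qed.

End Divisibility.

Section Boxes.

Variables (p N d : nat).
Hypotheses (p_pr : prime p) (N_gt0 : (0 < N)%N).

Local Notation R := 'Z_(p ^ N).
Local Notation divR := (@divR p N).
Implicit Types (g : 'M[R]_d) (lam : 'I_d -> nat).

(** For g invertible this is the subgroup spanned by the rows of g multiplied
    by the p ^ (lam i): a subgroup in Smith normal form. *)
Definition box g lam : {set 'rV[R]_d} :=
  [set x | [forall i, divR (lam i) ((x *m invmx g) 0 i)]].

Lemma boxP g lam x :
  reflect (forall i, divR (lam i) ((x *m invmx g) 0 i)) (x \in box g lam).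
Proof. by rewrite inE; apply: forallP. Qed.

Lemma row_scale_mem (G : {group 'rV[R]_d}) (c : R) x : x \in G -> c *: x \in G.
Proof.
move=> Gx; rewrite -(natr_Zp c) scaler_nat.
exact: (groupX _ Gx).
Qed.

Lemma sum_mem (gT : finZmodType) (G : {group gT}) (I : Type) (r : seq I)
   (P : pred I) (F : I -> gT) : (forall i, P i -> F i \in G) ->
  \sum_(i <- r | P i) F i \in G.
Proof.
move=> h; elim/big_rec: _ => [|i x Pi Gx]; first exact: (group1 G).
exact: (groupM (h i Pi) Gx).
Qed.

(** The Smith normal form of an integral matrix whose rows lift all elements
    of L. *)
Lemma group_box (L : {group 'rV[R]_d}) :
  exists2 g, g \in unitmx & exists2 lam, (forall i, (lam i <= N)%N) &
    L = box g lam :> {set _}.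
Proof.
(* the d zero rows make the diagonal of the normal form reach every column *)
pose M0 : 'M[R]_(d + #|L|, d) := col_mx 0 (\matrix_(i < #|L|) enum_val i).
pose M : 'M[int]_(d + #|L|, d) := \matrix_(i, j) ((M0 i j : nat)%:Z).
have MR : map_mx (intr : int -> R) M = M0.
  by apply/matrixP => i j; rewrite [LHS]mxE [M i j]mxE; apply: natr_Zp.
have memL x : x \in L <-> exists c, x = c *m M0.
  split=> [Lx|[c ->]].
    exists (delta_mx 0 (rshift d (enum_rank_in Lx x))).
    by rewrite -rowE rowKd rowK enum_rankK_in.
  rewrite mulmx_sum_row; apply: (@sum_mem _ L) => i _; apply: row_scale_mem.
  case: (split_ordP i) => j ->; first by rewrite rowKu row0; apply: group1.
  by rewrite rowKd rowK; apply: enum_valP.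
have [U uU [V uV [s _ eM]]] := int_Smith_normal_form M.
pose g := map_mx (intr : int -> R) V; pose u := map_mx (intr : int -> R) U.
have ug : g \in unitmx by rewrite unitmxE det_map_mx rmorph_unit // -unitmxE.
have uu : u \in unitmx by rewrite unitmxE det_map_mx rmorph_unit // -unitmxE.
have /all_sig2 [lam lamN lamP] : forall j : 'I_d, {k | (k <= N)%N &
   forall z : R, (exists y, z = y * (s`_j)%:~R) <-> divR k z}.
  by move=> j; apply/cid2; exact: (divR_gen p_pr N_gt0 (s`_j)%:~R).
exists g => //; exists lam => //; apply/setP => x.
pose D : 'M[R]_(d + #|L|, d) := \matrix_(i, j) ((s`_i)%:~R *+ (i == j :> nat)).
have eM0 : M0 = u *m D *m g.
  rewrite -MR eM !map_mxM; congr (_ *m _ *m _).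
  by apply/matrixP => i j; rewrite !mxE rmorphMn.
have yD (y : 'rV_(d + #|L|)) j : (y *m D) 0 j = y 0 (lshift _ j) * (s`_j)%:~R.
  rewrite mxE (bigD1 (lshift _ j)) //= big1 ?addr0 ?mxE ?eqxx //.
  move=> i ne; rewrite mxE (_ : (_ == _) = false) ?mulr0 //.
  by apply: contraNF ne => e; apply/eqP/val_inj/eqP.
apply/idP/boxP => [/memL [c ->] j|h].
  apply/lamP; exists ((c *m u) 0 (lshift _ j)).
  by rewrite eM0 !mulmxA mulmxK // yD.
apply/memL.
have /all_sig [y yP] : forall j, {y | (x *m invmx g) 0 j = y * (s`_j)%:~R}.
  by move=> j; apply/cid; apply/lamP.
exists (row_mx (\row_j y j) 0 *m invmx u).
rewrite eM0 !mulmxA mulmxKV //; rewrite -[LHS](mulmxKV ug); congr (_ *m _).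
by apply/rowP => j; rewrite yP yD row_mxEl mxE.
Qed.

Lemma card_row_set (T : 'I_d -> {set R}) :
  #|[set x : 'rV[R]_d | [forall i, x 0 i \in T i]]| = (\prod_i #|T i|)%N.
Proof.
have -> : (\prod_i #|T i|)%N = #|family (fun i => mem (T i))|.
  by rewrite card_family foldrE big_map big_enum.
rewrite -(@card_imset _ _ (fun f : {ffun 'I_d -> R} => \row_i f i)); last first.
  by move=> f h /rowP e; apply/ffunP => i; have := e i; rewrite !mxE.
apply: eq_card => x; rewrite !inE; apply/forallP/imsetP => [h|[f /familyP h ->] i].
  exists [ffun i => x 0 i]; first by apply/familyP => i; rewrite ffunE h.
  by apply/rowP => i; rewrite mxE ffunE.
by rewrite mxE h.
Qed.

Lemma card_box g lam : g \in unitmx -> (forall i, (lam i <= N)%N) ->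
  #|box g lam| = (\prod_i p ^ (N - lam i))%N.
Proof.
move=> ug lamN.
rewrite (_ : (\prod_i _)%N = (\prod_i #|[set z : R | divR (lam i) z]|)%N); last first.
  by apply: eq_bigr => i _; rewrite card_divR.
rewrite -card_row_set -(@card_imset _ _ (fun x : 'rV[R]_d => x *m g)); last first.
  exact: (can_inj (mulmxK ug)).
apply: eq_card => x; apply/boxP/imsetP => [h|[y]].
  exists (x *m invmx g); last by rewrite mulmxKV.
  by rewrite inE; apply/forallP => i; rewrite inE h.
by rewrite inE => /forallP h -> i; rewrite mulmxK //; have := h i; rewrite inE.
Qed.

End Boxes.

Section Wedge.

Variables (p N d : nat).
Hypotheses (p_pr : prime p) (N_gt0 : (0 < N)%N).

Local Notation R := 'Z_(p ^ N).
Local Notation divR := (@divR p N).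
Implicit Types (g : 'M[R]_d) (lam : 'I_d -> nat).

(** The diagonal condition makes the definition right also for p = 2. *)
Definition altb (A : 'M[R]_d) := (A^T == - A) && [forall i, A i i == 0].

Definition altset : {set 'M[R]_d} := [set A | altb A].

Lemma altsetP (A : 'M[R]_d) : reflect ((forall i j, A j i = - A i j) /\ forall i, A i i = 0)
  (A \in altset).
Proof.
rewrite inE; apply: (iffP andP) => [[/eqP h /forallP k]|[h k]]; split.
- by move=> i j; have /matrixP/(_ i j) := h; rewrite !mxE.
- by move=> i; apply/eqP.
- by apply/eqP/matrixP => i j; rewrite !mxE.
- by apply/forallP => i; rewrite k.
Qed.

Lemma group_set_alt : group_set altset.
Proof.
apply/group_setP; split; first by apply/altsetP; split=> *; rewrite !mxE ?oppr0.
move=> A B /altsetP [hA kA] /altsetP [hB kB]; apply/altsetP; split=> [i j|i].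
  by rewrite !mxE hA hB opprD.
by rewrite mxE kA kB addr0.
Qed.
Canonical altgroup := Group group_set_alt.

Definition wedge (x y : 'rV[R]_d) : 'M[R]_d := x^T *m y - y^T *m x.

Lemma wedgeE x y i j : wedge x y i j = x 0 i * y 0 j - y 0 i * x 0 j.
Proof. by rewrite !mxE !big_ord1 !mxE. Qed.

Lemma wedge_alt x y : wedge x y \in altset.
Proof. by apply/altsetP; split=> *; rewrite !wedgeE; ring. Qed.

Lemma wedgeC x y : wedge y x = - wedge x y.
Proof. by rewrite /wedge opprB. Qed.

Lemma wedgeZl a x y : wedge (a *: x) y = a *: wedge x y.
Proof. by apply/matrixP => i j; rewrite [RHS]mxE !wedgeE !mxE; ring. Qed.

Lemma wedgeZr a x y : wedge x (a *: y) = a *: wedge x y.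
Proof. by rewrite wedgeC wedgeZl [in LHS]wedgeC scalerN opprK. Qed.

Lemma wedge_conj (g : 'M[R]_d) x y :
  wedge (x *m g) (y *m g) = g^T *m wedge x y *m g.
Proof. by rewrite /wedge !trmx_mul mulmxBr mulmxBl !mulmxA. Qed.

Lemma conj_alt (g A : 'M[R]_d) : A \in altset -> g^T *m A *m g \in altset.
Proof.
move=> /altsetP [hA kA].
have E i j : (g^T *m A *m g) i j = \sum_k \sum_l g k i * A k l * g l j.
  rewrite mxE exchange_big /=; apply: eq_bigr => l _.
  by rewrite mxE big_distrl /=; apply: eq_bigr => k _; rewrite mxE.
apply/altsetP; split=> [i j|i].
  rewrite !E -sumrN exchange_big; apply: eq_bigr => k _ /=.
  rewrite -sumrN; apply: eq_bigr => l _; rewrite (hA k l); ring.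
rewrite E.
have F (P : 'I_d -> 'I_d -> bool) : \sum_k \sum_(l | P k l) g k i * A k l * g l i =
   - \sum_k \sum_(l | P l k) g k i * A k l * g l i.
  rewrite -sumrN (exchange_big_dep xpredT) //=; apply: eq_bigr => k _ /=.
  rewrite -sumrN; apply: eq_bigr => l _; rewrite (hA k l); ring.
transitivity (\sum_(k < d) (\sum_(l < d | (l < k)%N) g k i * A k l * g l i +
   \sum_(l < d | (k < l)%N) g k i * A k l * g l i)).
  apply: eq_bigr => k _; rewrite (bigD1 k) //= kA mulr0 mul0r add0r.
  rewrite (bigID (fun l : 'I_d => (l < k)%N)) /=; congr (_ + _); apply: eq_bigl => l.
    by rewrite andbC; case: ltnP => //= h; rewrite neq_ltn h.
  by rewrite -leqNgt eq_sym -val_eqE /= -ltn_neqAle.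
by rewrite big_split /= (F (fun k l => (l < k)%N)) /= addNr.
Qed.

(** As wedge is the commutator form of the group built below, this is the
    commutator subgroup of a lattice with the whole group. *)
Definition wedge_span (L : {group 'rV[R]_d}) : {group 'M[R]_d} :=
  <<[set wedge x y | x in L, y in [set: 'rV[R]_d]]>>%G.

Lemma wedge_spanS (L1 L2 : {group 'rV[R]_d}) : L1 \subset L2 ->
  wedge_span L1 \subset wedge_span L2.
Proof. by move=> s; apply: genS; apply: imset2S. Qed.

Lemma mem_wedge_span (L : {group 'rV[R]_d}) x y : x \in L ->
  wedge x y \in wedge_span L.
Proof. by move=> Lx; apply: mem_gen; apply: imset2_f. Qed.

Lemma wedge_span_alt L : wedge_span L \subset altset.
Proof. by rewrite gen_subG; apply/subsetP => _ /imset2P [x y _ _ ->]; apply: wedge_alt. Qed.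

(** The analogue of [box] in the exterior square, with respect to the basis
    of the wedges of the rows of g. *)
Definition wbox g lam : {set 'M[R]_d} :=
  [set A in altset | [forall i, forall j,
     divR (minn (lam i) (lam j)) (((invmx g)^T *m A *m invmx g) i j)]].

Lemma wboxP g lam (A : 'M[R]_d) :
  reflect (A \in altset /\ forall i j, divR (minn (lam i) (lam j))
     (((invmx g)^T *m A *m invmx g) i j)) (A \in wbox g lam).
Proof.
rewrite /wbox [in X in reflect _ X]inE; apply: (iffP andP) => [[h /forallP k]|[h k]]; split=> //.
  by move=> i j; move/forallP: (k i).
by apply/forallP => i; apply/forallP.
Qed.

Lemma group_set_wbox g lam : (forall i, (lam i <= N)%N) -> group_set (wbox g lam).
Proof.
move=> lamN; apply/group_setP; split.
  apply/wboxP; split; first exact: group1.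
  by move=> i j; rewrite mulmx0 mul0mx mxE divRz0.
move=> A B /wboxP [hA kA] /wboxP [hB kB]; apply/wboxP; split; first exact: groupM.
move=> i j; rewrite mulmxDr mulmxDl mxE divRD //.
by rewrite geq_min lamN.
Qed.

Lemma alt_sum (A : 'M[R]_d) : A \in altset ->
  A = \sum_(i < d) \sum_(j < d | (i < j)%N) wedge (A i j *: delta_mx 0 i) (delta_mx 0 j).
Proof.
move=> /altsetP [hA kA]; apply/matrixP => k l; rewrite summxE.
have E i j : wedge (A i j *: delta_mx 0 i) (delta_mx 0 j) k l =
   A i j * ((k == i) && (l == j))%:R - A i j * ((k == j) && (l == i))%:R.
  rewrite wedgeE !mxE !eqxx /=.
  by case: eqP; case: eqP; case: eqP; case: eqP => *; rewrite /=; ring.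
transitivity (\sum_(i < d) \sum_(j < d | (i < j)%N) A i j * ((k == i) && (l == j))%:R
   - \sum_(i < d) \sum_(j < d | (i < j)%N) A i j * ((k == j) && (l == i))%:R); last first.
  rewrite -sumrB; apply: eq_bigr => i _; rewrite summxE -sumrB.
  by apply: eq_bigr => j _; rewrite E.
have S1 a b : \sum_(i < d) \sum_(j < d | (i < j)%N) A i j * ((a == i) && (b == j))%:R =
    if (a < b)%N then A a b else 0.
  rewrite (bigD1 a) //= [X in _ + X]big1 ?addr0; last first.
    by move=> i /negbTE ne; apply: big1 => j _; rewrite eq_sym ne /= mulr0.
  case: ifP => ab.
    rewrite (bigD1 b) //= !eqxx mulr1 big1 ?addr0 // => j /andP [_ /negbTE ne].
    by rewrite [b == j]eq_sym ne andbF mulr0.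
  apply: big1 => j aj; rewrite eqxx /=; case: eqP => [e|_]; last by rewrite mulr0.
  by rewrite -e ab in aj.
rewrite S1.
have -> : \sum_(i < d) \sum_(j < d | (i < j)%N) A i j * ((k == j) && (l == i))%:R =
    if (l < k)%N then A l k else 0.
  by rewrite -S1; apply: eq_bigr => i _; apply: eq_bigr => j _; rewrite andbC.
case: ltngtP => [||/val_inj ->]; rewrite ?subr0 ?kA ?subr0 // => _.
by rewrite sub0r hA.
Qed.

(** The wedge of two rows of g can be reached from either factor, so the smaller
    of the two exponents counts. *)
Lemma wedge_span_box (L : {group 'rV[R]_d}) g lam : g \in unitmx ->
  (forall i, (lam i <= N)%N) -> L = box g lam :> {set _} ->
  wedge_span L = wbox g lam :> {set _}.
Proof.
move=> ug lamN eL; apply/eqP; rewrite eqEsubset; apply/andP; split.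
  rewrite (_ : wbox g lam = Group (group_set_wbox g lamN)) // gen_subG.
  apply/subsetP => _ /imset2P [x y Lx _ ->] /=; apply/wboxP; split.
    exact: wedge_alt.
  move=> i j; rewrite -wedge_conj wedgeE.
  have /boxP h : x \in box g lam by rewrite -eL.
  have mN : (minn (lam i) (lam j) <= N)%N by rewrite geq_min lamN.
  apply: divRD => //; [|apply: divRN => //].
    by apply: divRMr => //; apply: divR_le (h i); rewrite geq_minl.
  by apply: divRMl => //; apply: divR_le (h j); rewrite geq_minr.
apply/subsetP => A /wboxP [hA kA].
set A' := (invmx g)^T *m A *m invmx g in kA.
have eA : A = g^T *m A' *m g.
  rewrite /A' !mulmxA -trmx_mul mulVmx // trmx1 mul1mx.
  by rewrite -mulmxA mulVmx // mulmx1.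
have aA : A' \in altset by apply: conj_alt.
rewrite eA (alt_sum aA) mulmx_sumr mulmx_suml.
apply: (@sum_mem _ (wedge_span L)) => i _; rewrite mulmx_sumr mulmx_suml.
apply: (@sum_mem _ (wedge_span L)) => j _; rewrite -wedge_conj.
have inL (a : R) k : divR (lam k) a -> (a *: delta_mx 0 k) *m g \in L.
  move=> da; rewrite -[_ \in _]/(_ \in (L : {set _})) eL; apply/boxP => l.
  rewrite mulmxK // !mxE eqxx /=; case: eqP => [->|]; last by rewrite mulr0 divRz0.
  by rewrite mulr1.
case: (leqP (lam i) (lam j)) => [le|/ltnW le].
  by apply: mem_wedge_span; apply: inL; have := kA i j; rewrite (minn_idPl le).
rewrite -scalemxAl (_ : wedge _ _ = wedge (delta_mx 0 i *m g) ((A' i j *: delta_mx 0 j) *m g)).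
  rewrite wedgeC; apply: groupVr; apply: mem_wedge_span; apply: inL.
  by have := kA i j; rewrite (minn_idPr le).
by rewrite -!scalemxAl wedgeZl wedgeZr.
Qed.

End Wedge.

Local Open Scope group_scope.

Lemma card_root (gT : finGroupType) (X : {group gT}) (abX : abelian X) p
    (H : {group gT}) : H \subset X ->
  (#|X : H <*> powm abX p @* X| * #|H| = #|powm abX p @*^-1 H|)%N.
Proof.
move=> sHX; have sRX : powm abX p @*^-1 H \subset X by apply: subsetIl.
have /eqP := Lagrange sHX.
rewrite -(Lagrange sRX) (index_root abX p sHX) mulnA.
by rewrite eqn_pmul2r ?indexg_gt0 // mulnC => /eqP.
Qed.

Local Close Scope group_scope.

Lemma minn_pred a b : minn a.-1 b.-1 = (minn a b).-1.
Proof. lia. Qed.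

Section BoxRoots.

Local Open Scope group_scope.
Local Open Scope ring_scope.

Variables (p N d : nat).
Hypotheses (p_pr : prime p) (N_gt0 : (0 < N)%N).

Local Notation R := 'Z_(p ^ N).
Local Notation divR := (@divR p N).
Local Notation gL := ([set: 'rV[R]_d]%G).
Local Notation gK := (@altgroup p N d).
Implicit Types (g : 'M[R]_d) (lam : 'I_d -> nat).

Definition powL := powm (FinRing.zmod_abelian gL) p.
Definition powK := powm (FinRing.zmod_abelian gK) p.

Lemma root_box g lam (L : {group 'rV[R]_d}) : (forall i, (lam i <= N)%N) ->
  L = box g lam :> {set _} ->
  powL @*^-1 L = box g (fun i => (lam i).-1).
Proof.
move=> lamN eL; apply/setP => x; rewrite eL !inE /=; apply: eq_forallb => i.
rewrite FinRing.zmodXgE -scaler_nat -scalemxAl mxE divR_mulp //.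
Qed.

Lemma root_wbox g lam (W : {group 'M[R]_d}) : (forall i, (lam i <= N)%N) ->
  W = wbox g lam :> {set _} ->
  powK @*^-1 W = wbox g (fun i => (lam i).-1).
Proof.
move=> lamN eW; apply/setP => A; rewrite eW.
apply/idP/wboxP => [|[aA h]].
  move/morphpreP => [aA /wboxP [_ h]]; split=> // i j; have := h i j.
  rewrite -[powK A]/(A *+ p)%R.
  rewrite -scaler_nat -scalemxAr -scalemxAl mxE divR_mulp ?geq_min ?lamN //.
  by rewrite minn_pred.
apply/morphpreP; split=> //; apply/wboxP; split; first exact: (groupX p (aA : A \in gK)).
move=> i j; rewrite -[powK A]/(A *+ p)%R.
by rewrite -scaler_nat -scalemxAr -scalemxAl mxE divR_mulp ?geq_min ?lamN // -minn_pred.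
Qed.

(** In Smith normal form both sides lower every lam i by one, and the truncated
    predecessor commutes with minima. *)
Lemma wedge_span_root (L : {group 'rV[R]_d}) :
  powK @*^-1 (wedge_span L) = wedge_span (powL @*^-1 L)%G.
Proof.
have [g ug [lam lamN eL]] := group_box p_pr N_gt0 L.
have lamN' i : ((lam i).-1 <= N)%N by apply: leq_trans (lamN i); apply: leq_pred.
rewrite (root_wbox lamN (wedge_span_box p_pr N_gt0 ug lamN eL)).
by rewrite (wedge_span_box p_pr N_gt0 ug lamN' (root_box lamN eL)).
Qed.

Definition upper (M : 'M[R]_d) : {ffun 'I_d * 'I_d -> R} :=
  [ffun u : 'I_d * 'I_d => if (u.1 < u.2)%N then M u.1 u.2 else 0].

Lemma upper_inj (A B : 'M[R]_d) : A \in altset p N d -> B \in altset p N d ->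
  upper A = upper B -> A = B.
Proof.
move=> /altsetP [sA zA] /altsetP [sB zB] /ffunP e.
have lt_eq (i j : 'I_d) : (i < j)%N -> A i j = B i j.
  by move=> lt; have := e (i, j); rewrite !ffunE /= lt.
apply/matrixP => i j; case: (ltngtP i j) => [/lt_eq //|/lt_eq h|/val_inj ->].
  by rewrite sA sB h.
by rewrite zA zB.
Qed.

Lemma card_wbox g lam : g \in unitmx -> (forall i, (lam i <= N)%N) ->
  #|wbox g lam| = (\prod_(i < d) \prod_(j < d | (i < j)%N) p ^ (N - minn (lam i) (lam j)))%N.
Proof.
move=> ug lamN.
pose T (u : 'I_d * 'I_d) : {set R} :=
  if (u.1 < u.2)%N then [set z | divR (minn (lam u.1) (lam u.2)) z] else [set 0].
transitivity (\prod_u #|T u|)%N; last first.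
  rewrite -(pair_bigA _ (fun i j => #|T (i, j)|)) /=; apply: eq_bigr => i _.
  rewrite [RHS]big_mkcond /=; apply: eq_bigr => j _; rewrite /T /=.
  by case: ifP => _; rewrite ?cards1 // card_divR ?geq_min ?lamN.
pose F (A : 'M[R]_d) := upper ((invmx g)^T *m A *m invmx g).
have alt' A : A \in altset p N d -> (invmx g)^T *m A *m invmx g \in altset p N d.
  by apply: conj_alt.
rewrite -(@card_in_imset _ _ F); last first.
  move=> A B /wboxP [hA _] /wboxP [hB _] /(upper_inj (alt' _ hA) (alt' _ hB)).
  move=> e'; have K C : g^T *m ((invmx g)^T *m C *m invmx g) *m g = C.
    by rewrite !mulmxA -trmx_mul mulVmx // trmx1 mul1mx -mulmxA mulVmx // mulmx1.
  by rewrite -(K A) e' K.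
transitivity #|family (fun u => mem (T u))|; last first.
  by rewrite card_family foldrE big_map big_enum.
apply: eq_card => f; apply/imsetP/familyP => [[A /wboxP [hA kA] ->] u|h].
  by rewrite -[_ \in mem _]/(_ \in T u) ffunE /T; case: ifP => _; rewrite inE.
pose B : 'M[R]_d := \matrix_(i, j) (if (i < j)%N then f (i, j) else
  if (j < i)%N then - f (j, i) else 0).
have aB : B \in altset p N d.
  apply/altsetP; split=> [i j|i]; rewrite !mxE ?ltnn //.
  by case: ltngtP => //; rewrite ?opprK ?oppr0.
have K : (invmx g)^T *m (g^T *m B *m g) *m invmx g = B.
  by rewrite !mulmxA -trmx_mul mulmxV // trmx1 mul1mx -mulmxA mulmxV // mulmx1.
have fT u : f u \in T u by apply: h.
exists (g^T *m B *m g).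
  apply/wboxP; split; first exact: conj_alt.
  move=> i j; rewrite K mxE; case: ltngtP => [lt|lt|_]; last exact: divRz0.
    by have := fT (i, j); rewrite /T lt inE.
  have := fT (j, i); rewrite /T lt inE minnC => hh.
  by apply: divRN; rewrite // geq_min lamN.
apply/ffunP => u; rewrite ffunE K mxE; case: ifP => nlt.
  by rewrite nlt -surjective_pairing.
by have := fT u; rewrite /T nlt inE => /eqP.
Qed.

Lemma box_index g lam (L : {group 'rV[R]_d}) : g \in unitmx ->
  (forall i, (lam i <= N)%N) -> L = box g lam :> {set _} ->
  #|gL : L| = (p ^ \sum_i lam i)%N.
Proof.
move=> ug lamN eL.
have e0 : gL = box g (fun=> 0%N) :> {set _}.
  by apply/setP => x; rewrite inE; apply/esym/boxP => i; apply: divR0z.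
have cL : #|L| = #|box g lam| by rewrite -eL.
have cT : #|gL| = #|box g (fun=> 0%N)| by rewrite -e0.
have := Lagrange (subsetT L); rewrite cL cT !card_box //.
set P := (\prod_i _)%N => e.
have P0 : (0 < P)%N by apply: prodn_gt0 => i; rewrite expn_gt0 prime_gt0.
apply/eqP; rewrite -(eqn_pmul2l P0) e expn_sum -big_split /=; apply/eqP/eq_bigr => i _.
by rewrite -expnD subn0 subnK.
Qed.

Lemma pair_count (S : pred 'I_d) :
  (\sum_(i < d) \sum_(j < d | (i < j)%N) (S i && S j) = 'C(\sum_(i < d) S i, 2))%N.
Proof.
set a := (\sum_(i < d) S i)%N; set s := (\sum_(i < d) _)%N.
have e : (s + s + a = a * a)%N.
  have es : s = (\sum_(i < d) \sum_(j < d | (j < i)%N) (S i && S j))%N.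
    rewrite /s (exchange_big_dep xpredT) //=; apply: eq_bigr => i _.
    by apply: eq_bigr => j _; rewrite andbC.
  rewrite {2}es /s /a -!big_split /= big_distrl /=; apply: eq_bigr => i _.
  rewrite [RHS]big_distrr /= [RHS](bigD1 i) //= mulnn.
  have -> : (S i ^ 2 = S i)%N by case: (S i).
  rewrite addnC; congr (_ + _)%N.
  rewrite [RHS](bigID (fun j : 'I_d => (i < j)%N)) /=; congr (_ + _)%N.
    apply: eq_big => j; last by rewrite mulnb.
    by rewrite -val_eqE /= neq_ltn; case: ltngtP.
  apply: eq_big => j; last by rewrite mulnb.
  by rewrite -val_eqE /= neq_ltn; case: ltngtP.
by rewrite bin2; move: e; clearbody a s; nia.
Qed.

Lemma box_top_index g lam (L : {group 'rV[R]_d}) : g \in unitmx ->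
  (forall i, (lam i <= N)%N) -> L = box g lam :> {set _} ->
  #|gL : L <*> powL @* gL| = (p ^ \sum_i (0 < lam i))%N.
Proof.
move=> ug lamN eL.
have lamN' i : ((lam i).-1 <= N)%N by apply: leq_trans (lamN i); apply: leq_pred.
apply/eqP; rewrite -(eqn_pmul2r (cardG_gt0 L)) card_root ?subsetT //.
rewrite (root_box lamN eL) eL !card_box // expn_sum -big_split /=.
apply/eqP/eq_bigr => i _; rewrite -expnD; congr (_ ^ _)%N.
by have := lamN i; lia.
Qed.

Lemma wbox_top_index g lam (W : {group 'M[R]_d}) : g \in unitmx ->
  (forall i, (lam i <= N)%N) -> W = wbox g lam :> {set _} ->
  #|gK : W <*> powK @* gK| = (p ^ 'C(\sum_i (0 < lam i), 2))%N.
Proof.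
move=> ug lamN eW.
have lamN' i : ((lam i).-1 <= N)%N by apply: leq_trans (lamN i); apply: leq_pred.
have sW : W \subset gK by rewrite eW; apply/subsetP => A /wboxP [].
apply/eqP; rewrite -(eqn_pmul2r (cardG_gt0 W)) card_root //.
rewrite (root_wbox lamN eW) eW !card_wbox // -pair_count expn_sum -big_split /=.
apply/eqP/eq_bigr => i _; rewrite expn_sum -big_split /=.
apply: eq_bigr => j _; rewrite -expnD; congr (_ ^ _)%N.
by have := lamN i; have := lamN j; lia.
Qed.

(** The colength of a box modulo p is the number of positive exponents, and that of
    its span of wedges is the number of pairs of positive exponents. *)
Lemma wedge_top_index (L : {group 'rV[R]_d}) a :
  #|gL : L <*> powL @* gL| = (p ^ a)%N ->
  #|gK : wedge_span L <*> powK @* gK| = (p ^ 'C(a, 2))%N.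
Proof.
have [g ug [lam lamN eL]] := group_box p_pr N_gt0 L.
rewrite (box_top_index ug lamN eL) (wbox_top_index ug lamN (wedge_span_box p_pr N_gt0 ug lamN eL)).
by move/eqP; rewrite eqn_exp2l ?prime_gt1 // => /eqP ->.
Qed.

(** All exponents of the box are at most m < N, and what p kills is divisible by
    p ^ N.-1. *)
Lemma small_index_ker (L : {group 'rV[R]_d}) m : #|gL : L| = (p ^ m)%N -> (m < N)%N ->
  ('ker powL \subset L) /\ ('ker powK \subset wedge_span L).
Proof.
have [g ug [lam lamN eL]] := group_box p_pr N_gt0 L.
rewrite (box_index ug lamN eL) => /eqP; rewrite eqn_exp2l ?prime_gt1 // => /eqP em lt.
have lam1 i : (lam i <= N.-1)%N.
  by rewrite -ltnS prednK //; apply: leq_ltn_trans lt; rewrite -em (bigD1 i) ?leq_addr.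
have d0 (z : R) : z *+ p = 0 -> divR N.-1 z.
  by move=> z0; rewrite -(divR_mulp p_pr) // mulr_natl z0 divRz0.
split; apply/subsetP => x /morphpreP [hx]; rewrite inE => /eqP e.
  rewrite -[_ \in _]/(_ \in (L : {set _})) eL; apply/boxP => i.
  apply: (divR_le (lam1 i)); apply: d0.
  have : (x *+ p) *m invmx g = 0 by rewrite (e : x *+ p = 0) mul0mx.
  by move/matrixP/(_ 0 i); rewrite -scaler_nat -scalemxAl !mxE mulr_natl.
rewrite -[_ \in _]/(_ \in (wedge_span L : {set _})) (wedge_span_box p_pr N_gt0 ug lamN eL).
apply/wboxP; split=> // i j.
apply: (@divR_le _ _ N.-1); first by rewrite geq_min lam1.
apply: d0; have : (invmx g)^T *m (x *+ p) *m invmx g = 0.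
  by rewrite (e : x *+ p = 0) mulmx0 mul0mx.
by move/matrixP/(_ i j); rewrite -scaler_nat -scalemxAr -scalemxAl [LHS]mxE mulr_natl => ->; rewrite mxE.
Qed.

End BoxRoots.

Local Open Scope group_scope.
Local Open Scope ring_scope.

(** * Finite quotients and preimages *)

Section FiniteQuotient.

Variables (G : groupType) (N : set G).
Hypothesis nN : normal_subgroup N.
Local Open Scope group_scope.

Lemma nsub1 : N 1. Proof. by case: nN. Qed.

Lemma nsubV x : N x -> N x^-1.
Proof. by move=> Nx; case: nN => _ h _; rewrite -[x^-1]mul1g; apply: h => //; apply: nsub1. Qed.

Lemma nsubM x y : N x -> N y -> N (x * y).
Proof. by move=> Nx Ny; case: nN => _ h _; rewrite -[y]invgK; apply: h => //; apply: nsubV. Qed.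

Lemma nsubJ x y : N x -> N (x ^ y). Proof. by case: nN => _ _ h; apply: h. Qed.

Definition lcoset_set (x : G) : set G := [set (x * y)%g | y in N]%classic.

Lemma lcoset_setE x z : lcoset_set x z <-> N (x^-1 * z).
Proof.
split=> [[y Ny <-]|h]; first by rewrite mulKg.
by exists (x^-1 * z) => //; rewrite mulVKg.
Qed.

Lemma lcoset_set_eq x y : lcoset_set x = lcoset_set y <-> N (x^-1 * y).
Proof.
split=> [e|h]; first by apply/lcoset_setE; rewrite e; apply/lcoset_setE; rewrite mulVg; apply: nsub1.
apply/predeqP => z; split=> /lcoset_setE hz; apply/lcoset_setE.
  rewrite (_ : y^-1 * z = (x^-1 * y)^-1 * (x^-1 * z)).
    by apply: nsubM => //; apply: nsubV.
  by rewrite invgM invgK -mulgA mulVKg.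
rewrite (_ : x^-1 * z = (x^-1 * y) * (y^-1 * z)); first exact: nsubM.
by rewrite -mulgA mulVKg.
Qed.

Lemma coset_index m : has_index N m -> exists k : G -> 'I_m,
  (forall i, exists x, k x = i) /\ (forall x y, k x = k y <-> N (x^-1 * y)).
Proof.
move=> /card_set_bijP [f [fI fi fs]].
have fN x : (f (lcoset_set x) < m)%N by apply: fI; exists x.
exists (fun x => Ordinal (fN x)); split=> [i|x y].
  have [c [x _ ec] ef] := fs i (ltn_ord i).
  by exists x; apply/val_inj; rewrite /= -ef -ec.
rewrite -lcoset_set_eq; split=> [/(congr1 val) /= e|e].
  by apply: (fi _ _ _ _ e); apply/mem_set; [exists x|exists y].
by apply/val_inj; rewrite /= e.
Qed.

(** The quotient of G by N, realised on a numbering of the cosets. *)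
Lemma finite_quotient m : has_index N m ->
  exists (Q : finGroupType) (rho : {multiplicative G -> Q}),
    [/\ #|Q| = m, forall z, exists x, rho x = z & forall x, rho x = 1 <-> N x].
Proof.
move=> /coset_index [k [ks kN]].
have [r rK] : exists r : 'I_m -> G, forall i, k (r i) = i.
  by exists (fun i => sval (cid (ks i))) => i; case: cid.
have rN x : N ((r (k x))^-1 * x) by apply/kN; rewrite rK.
have kM x y x' y' : k x = k x' -> k y = k y' -> k (x * y) = k (x' * y').
  move=> /kN hx /kN hy; apply/kN.
  rewrite (_ : _ * _ = (x^-1 * x') ^ y * (y^-1 * y')); first exact: nsubM (nsubJ _ hx) hy.
  by rewrite /conjg invgM !mulgA mulgK -!mulgA.
pose mu i j := k (r i * r j); pose iv i := k (r i)^-1.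
have muA : associative mu.
  by move=> a b c; rewrite /mu (kM _ _ (r a) (r b * r c)) ?rK // mulgA; apply: kM; rewrite ?rK.
have mu1 : left_id (k 1) mu.
  by move=> a; rewrite /mu (kM _ _ 1 (r a)) ?rK // mul1g rK.
have muV : left_inverse (k 1) iv mu.
  by move=> a; rewrite /mu (kM _ _ (r a)^-1 (r a)) ?rK // mulVg.
pose Q : finGroupType := HB.pack_for finGroupType 'I_m (Finite_isGroup.Build 'I_m muA mu1 muV).
have kmul : {morph (k : G -> Q) : x y / x * y}.
  by move=> x y; apply: kM; rewrite ?rK.
exists Q, (HB.pack_for {multiplicative G -> Q} (k : G -> Q) (isMultiplicative.Build G Q k kmul)).
split; first exact: card_ord.
  by move=> z; apply: ks.
move=> x /=; rewrite -[1]/(k 1); split.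
  by move/esym/kN; rewrite invg1 mul1g.
by move=> Nx; apply/esym/kN; rewrite invg1 mul1g.
Qed.

End FiniteQuotient.

Lemma card_finset (T : finType) (A : {set T}) : ([set` A] #= `I_#|A|)%card.
Proof.
pose f x := index x (enum A).
have -> : `I_#|A|%classic = (f @` [set` A])%classic.
  apply/predeqP => k; split=> [lt|[x Ax <-]].
    have /card_gt0P [x0 _] : (0 < #|A|)%N by apply: leq_ltn_trans lt.
    exists (nth x0 (enum A) k); first by rewrite /= -mem_enum mem_nth // -cardE.
    by rewrite /f index_uniq ?enum_uniq // -cardE.
  by rewrite /= cardE index_mem mem_enum.
apply/card_esym/inj_card_eq => x y /set_mem Ax /set_mem Ay e.
by rewrite -(nth_index x (_ : x \in enum A)) ?mem_enum // -/(f x) e nth_index // mem_enum.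
Qed.

Section Preimages.

Variables (G : groupType) (E : finGroupType) (EG : {group E}) (g : {multiplicative G -> E}).
Hypothesis g_im : forall z, z \in EG <-> exists x, g x = z.
Local Open Scope group_scope.

Definition preim_set (M : {set E}) : set G := fun x => g x \in M.

Lemma gmul1 : g 1 = 1.
Proof. by apply: (mulgI (g 1)); rewrite -gmulfM !mulg1. Qed.

Lemma gmulV x : g x^-1 = (g x)^-1.
Proof. by apply: (mulgI (g x)); rewrite -gmulfM !mulgV gmul1. Qed.

Lemma gin x : g x \in EG. Proof. by apply/g_im; exists x. Qed.

Lemma preim_inj (M1 M2 : {group E}) : M1 \subset EG -> M2 \subset EG ->
  preim_set M1 = preim_set M2 -> M1 = M2.
Proof.
move=> s1 s2 /predeqP e; apply/val_inj/setP => z /=; apply/idP/idP => hz.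
  have /g_im [x ex] := fintype.subsetP s1 _ hz.
  by have [h _] := e x; move: (h); rewrite /preim_set ex; apply.
have /g_im [x ex] := fintype.subsetP s2 _ hz.
by have [_ h] := e x; move: (h); rewrite /preim_set ex; apply.
Qed.

Lemma preim_normal (M : {group E}) : normal M EG -> normal_subgroup (preim_set M).
Proof.
move=> /andP [sM nM]; split; rewrite /preim_set ?gmul1 ?group1 //.
  by move=> x y; rewrite gmulfM gmulV => hx hy; rewrite groupM ?groupV.
move=> x y hx; rewrite /conjg !gmulfM gmulV -/(_ ^ _).
have /normP <- := fintype.subsetP nM _ (gin y).
by rewrite memJ_conjg.
Qed.

Lemma preim_index (M : {group E}) : M \subset EG ->
  has_index (preim_set M) #|EG : M|.
Proof.
move=> sM; rewrite /has_index -card_lcosets.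
pose psi (c : {set E}) : set G := fun z => g z \in c.
have -> : left_cosets (preim_set M) = (psi @` [set` lcosets M EG])%classic.
  have cE x : [set (x * y)%g | y in preim_set M]%classic = psi (g x *: M).
    apply/predeqP => z; rewrite /psi mem_lcoset; split=> [[y hy <-]|h].
      by rewrite gmulfM mulKg.
    by exists (x^-1 * z); rewrite ?mulVKg // /preim_set gmulfM gmulV.
  apply/predeqP => c; split=> [[x _ <-]|[c' /imsetP [z EGz ->] <-]].
    rewrite cE; exists (g x *: M) => //.
    by apply/lcosetsP; exists (g x) => //; apply: gin.
  by have /g_im [x <-] := EGz; rewrite lcosetE -cE; exists x.
apply: (card_eq_trans (inj_card_eq _) (card_finset _)).
move=> c1 c2 /set_mem /lcosetsP [z1 E1 e1] /set_mem /lcosetsP [z2 E2 e2] /predeqP h.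
have sub c z : z \in EG -> c = z *: M -> c \subset EG.
  by move=> Ez ->; rewrite mul_subG // sub1set.
apply/setP => z; apply/idP/idP => hz.
  have /g_im [x ex] := fintype.subsetP (sub _ _ E1 e1) _ hz.
  by have [k _] := h x; move: (k); rewrite /psi ex; apply.
have /g_im [x ex] := fintype.subsetP (sub _ _ E2 e2) _ hz.
by have [_ k] := h x; move: (k); rewrite /psi ex; apply.
Qed.

(** A normal subgroup that contains the kernel of g is the preimage of its
    image. *)
Lemma num_normal_preim m :
  (forall N, normal_subgroup N -> has_index N m -> forall x, g x = 1 -> N x) ->
  num_normal G m = #|[set M : {group E} | normal M EG & #|EG : M| == m]|.
Proof.
move=> kerN; set S := [set M : {group E} | _].
rewrite /num_normal.
have -> : [set N : set G | normal_subgroup N /\ has_index N m]%classic =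
   ((fun M : {group E} => preim_set M) @` [set` S])%classic.
  apply/predeqP => N; split=> [[nN iN]|[M]]; last first.
    rewrite /= inE => /andP [nM /eqP iM] <-; split; first exact: preim_normal.
    by rewrite -iM; apply: preim_index; apply: normal_sub.
  pose A : {set E} := [set z | `[< exists2 x, N x & g x = z >]].
  have AP z : z \in A <-> exists2 x, N x & g x = z by rewrite inE; split=> /asboolP.
  have gA : group_set A.
    apply/group_setP; split; first by apply/AP; exists 1; [apply: nsub1|apply: gmul1].
    move=> _ _ /AP [x Nx <-] /AP [y Ny <-]; apply/AP; exists (x * y); last exact: gmulfM.
    exact: nsubM.
  pose M := Group gA.
  have sM : M \subset EG.
    by apply/fintype.subsetP => z /AP [x _ <-]; apply: gin.
  have nM : normal M EG.
    rewrite /normal sM; apply/fintype.subsetP => _ /g_im [y <-]; rewrite inE.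
    apply/fintype.subsetP => _ /imsetP [_ /AP [x Nx <-] ->]; apply/AP.
    by exists (x ^ y); [apply: nsubJ|rewrite /conjg !gmulfM gmulV].
  have eN : preim_set M = N.
    apply/predeqP => x; split=> [/AP [y Ny e]|Nx]; last by apply/AP; exists x.
    rewrite -(mulKVg y x); apply: nsubM => //; apply: (kerN N) => //.
    by rewrite gmulfM gmulV e mulVg.
  exists M => //=; rewrite inE nM; apply/eqP/card_eq_II.
  have := preim_index sM; rewrite eN => i1.
  exact: card_eq_trans (card_esym i1) iN.
apply: card_fset_set.
apply: (card_eq_trans (inj_card_eq _) (card_finset _)).
move=> M1 M2 /set_mem /=; rewrite inE => /andP [/normal_sub s1 _].
by move=> /set_mem /=; rewrite inE => /andP [/normal_sub s2 _]; apply: preim_inj.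
Qed.

End Preimages.

(** * A finite model of the free class-two group *)

Section Collect.

Variable Q : finGroupType.
Hypothesis nilQ : nilpotent2 Q.
Local Open Scope group_scope.

Definition central (z : Q) := forall x, x * z = z * x.

Lemma central_comm x y : central [~ x, y].
Proof. by move=> z; apply/esym/commgP/eqP; apply: nilQ. Qed.

Lemma centralM x y : central x -> central y -> central (x * y).
Proof. by move=> hx hy z; rewrite mulgA hx -!mulgA hy. Qed.

Lemma central1 : central 1. Proof. by move=> z; rewrite mulg1 mul1g. Qed.

Lemma centralX x n : central x -> central (x ^+ n).
Proof.
by move=> hx; elim: n => [|n IH]; [apply: central1|rewrite expgS; apply: centralM].
Qed.

Lemma central_prod (I : Type) (r : seq I) (P : pred I) F :
  (forall i, central (F i)) -> central (\prod_(i <- r | P i) F i).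
Proof. by move=> h; apply: big_ind => //; [apply: central1|apply: centralM]. Qed.

Lemma prod_centralM (I : Type) (r : seq I) (P : pred I) (F G : I -> Q) :
  (forall i, central (F i)) ->
  \prod_(i <- r | P i) (F i * G i) = \prod_(i <- r | P i) F i * \prod_(i <- r | P i) G i.
Proof.
move=> hF; elim: r => [|i r IH]; first by rewrite !big_nil mulg1.
rewrite !big_cons IH; case: (P i) => //.
by rewrite -!mulgA; congr (_ * _); rewrite !mulgA (central_prod r P hF).
Qed.

Lemma comm_mull (x y z : Q) : [~ x * y, z] = [~ x, z] * [~ y, z].
Proof. by rewrite commMgJ /conjg -(central_comm x z y) mulKg. Qed.

Lemma comm_expX (x y : Q) a b : [~ x ^+ a, y ^+ b] = [~ x, y] ^+ (a * b).
Proof.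
have cm z : commute z [~ x, y] by apply: central_comm.
rewrite commXg; last by apply: central_comm.
by rewrite commgX; [rewrite -expgM mulnC|apply: central_comm].
Qed.

Variables (T : eqType) (y : T -> Q).

Definition pprod (r : seq T) (a : T -> nat) := \prod_(i <- r) y i ^+ a i.

(** The commutator part of a collected product: one factor for each pair of
    entries of r, the later entry k coming first in the commutator. *)
Fixpoint cprod (r : seq T) (w : T -> T -> nat) : Q :=
  if r is i :: r' then \prod_(k <- r') [~ y k, y i] ^+ w k i * cprod r' w else 1.

Lemma cprod_central r w : central (cprod r w).
Proof.
elim: r => [|i r IH] /=; first exact: central1.
by apply: centralM => //; apply: central_prod => k; apply/centralX/central_comm.
Qed.

Lemma cprodD r w w' : cprod r (fun k i => w k i + w' k i)%N = cprod r w * cprod r w'.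
Proof.
elim: r => [|i r IH] /=; first by rewrite mulg1.
under eq_bigr do rewrite expgD.
rewrite prod_centralM; last by move=> k; apply/centralX/central_comm.
rewrite IH -!mulgA; congr (_ * _); rewrite !mulgA; congr (_ * _).
by rewrite cprod_central.
Qed.

Lemma comm_pprod r a z b : [~ pprod r a, z ^+ b] = \prod_(k <- r) [~ y k, z] ^+ (a k * b).
Proof.
rewrite /pprod; elim: r => [|k r IH]; first by rewrite !big_nil comm1g.
by rewrite !big_cons comm_mull IH comm_expX.
Qed.

(** Collection in class two: moving y_i ^ b_i to the left across y_k ^ a_k
    costs [~ y_k, y_i] ^ (a_k * b_i). *)
Lemma pprodM r a b : pprod r a * pprod r b =
  pprod r (fun i => a i + b i)%N * cprod r (fun k i => a k * b i)%N.
Proof.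
rewrite /pprod; elim: r => [|i r IH] /=; first by rewrite !big_nil mulg1.
rewrite !big_cons expgD -!mulgA; congr (_ * _).
rewrite [in LHS]mulgA (commgC (\prod_(j <- r) y j ^+ a j)) -/(pprod r a) comm_pprod.
have hc : central (\prod_(k <- r) [~ y k, y i] ^+ (a k * b i)).
  by apply: central_prod => k; apply/centralX/central_comm.
rewrite -!mulgA; congr (_ * _); rewrite mulgA hc -mulgA.
rewrite -/(pprod r b) in IH *; rewrite IH.
by rewrite [LHS]mulgA [RHS]mulgA; congr (_ * _); rewrite hc.
Qed.

Lemma eq_pprod r a b : {in r, forall i, y i ^+ a i = y i ^+ b i} -> pprod r a = pprod r b.
Proof. by move=> h; apply: eq_big_seq. Qed.

Lemma eq_cprod (o : rel T) r w w' : pairwise o r ->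
  (forall i k, o i k -> [~ y k, y i] ^+ w k i = [~ y k, y i] ^+ w' k i) ->
  cprod r w = cprod r w'.
Proof.
move=> + h; elim: r => [|i r IH] //= /andP [/allP hi /IH ->]; congr (_ * _).
by apply: eq_big_seq => k kr; apply: h; apply: hi.
Qed.

Lemma cprod0 r (w : T -> T -> nat) : (forall i k, w i k = 0%N) -> cprod r w = 1.
Proof.
move=> h; elim: r => [|i r IH] //=; rewrite IH mulg1 big1 // => k _.
by rewrite h expg0.
Qed.

End Collect.

Section Model.

Variables (p N d : nat).
Hypotheses (p_pr : prime p) (N_gt0 : (0 < N)%N).

Local Notation R := 'Z_(p ^ N).
Local Notation gL := ([set: 'rV[R]_d]%G).
Local Notation gK := (@altgroup p N d).

(** A bilinear form whose antisymmetrisation is [wedge], without dividing by 2;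
    used as a cocycle it produces a group with commutator form [wedge]. *)
Definition cocycle (a b : 'rV[R]_d) : 'M[R]_d :=
  \matrix_(i, j) (if (j < i)%N then a 0 i * b 0 j
                  else if (i < j)%N then - (a 0 j * b 0 i) else 0).

Lemma cocycleDl a b c : cocycle (a + b) c = cocycle a c + cocycle b c.
Proof. by apply/matrixP => i j; rewrite !mxE; case: ltngtP => _; ring. Qed.

Lemma cocycleDr a b c : cocycle a (b + c) = cocycle a b + cocycle a c.
Proof. by apply/matrixP => i j; rewrite !mxE; case: ltngtP => _; ring. Qed.

Lemma cocycle0l c : cocycle 0 c = 0.
Proof. by apply/matrixP => i j; rewrite !mxE; case: ltngtP => _; ring. Qed.

Lemma cocycle0r c : cocycle c 0 = 0.
Proof. by apply/matrixP => i j; rewrite !mxE; case: ltngtP => _; ring. Qed.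

Lemma cocycleNl a c : cocycle (- a) c = - cocycle a c.
Proof. by apply/matrixP => i j; rewrite !mxE; case: ltngtP => _; ring. Qed.

Lemma cocycle_alt a b : cocycle a b \in gK.
Proof.
apply/altsetP; split=> [i j|i]; rewrite !mxE ?ltnn //;
by case: ltngtP => _; rewrite ?opprK ?oppr0.
Qed.

Lemma cocycle_wedge a b : cocycle a b - cocycle b a = wedge a b.
Proof.
apply/matrixP => i j; rewrite wedgeE !mxE.
by case: ltngtP => [||/val_inj ->]; move=> *; ring.
Qed.

Definition model : Type := ('rV[R]_d * 'M[R]_d)%type.
HB.instance Definition _ := Finite.on model.

Definition model_mul (x y : model) : model := (x.1 + y.1, x.2 + y.2 + cocycle x.1 y.1).
Definition model_one : model := (0, 0).
Definition model_inv (x : model) : model := (- x.1, - x.2 + cocycle x.1 x.1).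

Lemma model_mulA : associative model_mul.
Proof.
move=> [a u] [b v] [c w]; rewrite /model_mul /=; congr (_, _); first by rewrite addrA.
rewrite cocycleDl cocycleDr; move: (cocycle b c) (cocycle a b) (cocycle a c) => x y z.
by apply/matrixP => i j; rewrite !mxE; ring.
Qed.

Lemma model_mul1 : left_id model_one model_mul.
Proof. by move=> [a u]; rewrite /model_mul /= cocycle0l !add0r addr0. Qed.

Lemma model_mulV : left_inverse model_one model_inv model_mul.
Proof. by move=> [a u]; rewrite /model_mul /= cocycleNl addNr addrAC addrK addNr. Qed.

HB.instance Definition _ :=
  Finite_isGroup.Build model model_mulA model_mul1 model_mulV.

Lemma mulmE (x y : model) : (x * y)%g = (x.1 + y.1, x.2 + y.2 + cocycle x.1 y.1).
Proof. by []. Qed.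

Lemma model_commE (x y : model) : [~ x, y]%g = ((0, wedge x.1 y.1) : model).
Proof.
apply: (mulgI (y * x)%g); rewrite -commgC !mulmE /= cocycle0r !addr0.
congr (_, _); first by rewrite addrC.
by rewrite -cocycle_wedge [x.2 + _]addrC -!addrA; congr (_ + (_ + _)); rewrite [RHS]addrC subrK.
Qed.

Lemma fstm_morph : {in setT &, {morph (fun x : model => x.1 : 'rV[R]_d) : x y / (x * y)%g}}.
Proof. by []. Qed.
Definition fstm : {morphism [set: model] >-> 'rV[R]_d} := Morphism fstm_morph.

Lemma fst_expg (x : model) n : (x ^+ n)%g.1 = x.1 *+ n.
Proof. by elim: n => [|n IH] //; rewrite expgS mulmE /= IH mulrS. Qed.

Lemma model_nilpotent : nilpotent2 model.
Proof. by move=> x y z; rewrite !model_commE /= /wedge trmx0 mul0mx mulmx0 subrr. Qed.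

(** The group law is defined for arbitrary matrices; the alternating ones give
    the subgroup generated by the standard generators. *)
Definition alt_model_set : {set model} := [set x | x.2 \in gK].

Lemma alt_modelP (x : model) : (x \in alt_model_set) = (x.2 \in gK). Proof. by rewrite in_set. Qed.

Lemma group_set_alt_model : group_set alt_model_set.
Proof.
apply/group_setP; split; first by rewrite alt_modelP group1.
move=> x y; rewrite !alt_modelP => hx hy; rewrite mulmE /=.
exact: (groupM (groupM hx hy) (cocycle_alt _ _)).
Qed.
Canonical alt_model := Group group_set_alt_model.

Definition gen (i : 'I_d) : model := (delta_mx 0 i, 0).

Lemma gen_alt_model i : gen i \in alt_model. Proof. by rewrite alt_modelP group1. Qed.

(** Wedges of basis vectors are commutators of generators, and they span the
    alternating matrices. *)
Lemma gen_generates (A : {group model}) : (forall i, gen i \in A) -> A \subset alt_model -> A = alt_model.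
Proof.
move=> gA sA; apply/val_inj/eqP; rewrite eqEsubset sA /=; apply/subsetP => x.
rewrite alt_modelP => hx.
have zM (u v : 'M[R]_d) : (((0, u) : model) * ((0, v) : model))%g = ((0, u + v) : model).
  by rewrite mulmE /= cocycle0l !addr0.
have zX (u : 'M[R]_d) n : (((0, u) : model) ^+ n)%g = ((0, u *+ n) : model).
  by elim: n => [|n IH] //; rewrite expgS IH zM mulrS.
have wA i j c : ((0, wedge (c *: delta_mx 0 i) (delta_mx 0 j)) : model) \in A.
  rewrite wedgeZl -(natr_Zp c) scaler_nat -zX groupX //.
  by rewrite (_ : (0, _) = [~ gen i, gen j]%g) ?groupR // model_commE.
have kA (u : 'M[R]_d) : u \in gK -> ((0, u) : model) \in A.
  move=> /alt_sum ->; elim/big_rec: _ => [|i u' _ hu]; first exact: (group1 A).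
  rewrite -zM groupM //; elim/big_rec: _ => [|j v _ hv]; first exact: (group1 A).
  by rewrite -zM groupM.
have [z zA ez] : exists2 z : model, z \in A & z.1 = x.1.
  exists (\prod_(i < d) gen i ^+ (x.1 0%R i : nat))%g.
    by apply: group_prod => i _; apply: groupX.
  rewrite -[LHS]/(fstm _) morph_prod ?inE //.
  apply/rowP => j.
  have E (I : Type) (r : seq I) (F : I -> 'rV[R]_d) : (\prod_(i <- r) F i)%g = \sum_(i <- r) F i.
    by elim: r => [|i r IH]; rewrite ?big_nil // !big_cons IH.
  rewrite E summxE (bigD1 j) //= big1 ?addr0 => [|i ne].
    by rewrite fst_expg -scaler_nat mxE mxE !eqxx mulr1 natr_Zp.
  by rewrite fst_expg -scaler_nat mxE mxE eqxx /= eq_sym (negbTE ne) mulr0.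
have zK : z.2 \in gK by rewrite -alt_modelP; apply: (subsetP sA).
have -> : x = (z * ((0, x.2 - z.2)%R : model))%g.
  rewrite mulmE /= ez cocycle0r !addr0; case: (x) => a u /=; congr (_, _).
  by rewrite addrC subrK.
rewrite groupM // kA //; exact: (groupM hx (groupVr zK)).
Qed.

Section Hom.

Variables (Q : finGroupType) (nilQ : nilpotent2 Q) (y : 'I_d -> Q).
Hypothesis yq : forall i, (y i ^+ (p ^ N) = 1)%g.

(** Reads the coordinates of x as the exponents of a collected product of the
    elements y i, so it is the homomorphism that sends the standard generators to
    the y i. *)
Definition gen_hom (x : model) : Q :=
  (pprod y (enum 'I_d) (fun i => x.1 0%R i : nat) *
   cprod y (enum 'I_d) (fun k i => x.2 k i : nat))%g.

Lemma exp_natR (z : Q) n : (z ^+ (p ^ N) = 1 -> z ^+ ((n%:R : R) : nat) = z ^+ n)%g.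
Proof. by move=> h; rewrite val_Zp_nat ?pN_gt1 // expg_mod. Qed.

Lemma sorted_enum : pairwise (fun i j : 'I_d => i < j)%N (enum 'I_d).
Proof.
rewrite -(pairwise_map (fun i : 'I_d => i : nat) ltn) val_enum_ord.
by rewrite -sorted_pairwise ?iota_ltn_sorted //; apply: ltn_trans.
Qed.

Lemma gen_homM : {morph gen_hom : x x' / (x * x')%g}.
Proof.
move=> x x'; rewrite /gen_hom mulmE /=.
set r := enum 'I_d.
have cy i k : (([~ y k, y i] ^+ (p ^ N)) = 1)%g.
  by rewrite -[(p ^ N)%N]muln1 -comm_expX // yq comm1g.
rewrite -!mulgA [in RHS](mulgA (cprod _ _ _)) -(cprod_central nilQ).
rewrite -[in RHS]mulgA mulgA pprodM // -!mulgA; congr (_ * _)%g.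
  apply: eq_pprod => i _; rewrite mxE -(natr_Zp (x.1 0%R i)) -(natr_Zp (x'.1 0%R i)).
  by rewrite -natrD !natr_Zp exp_natR.
rewrite -!cprodD //; apply: (@eq_cprod _ _ y (fun i j : 'I_d => i < j)%N) => [|i k lt]; first exact: sorted_enum.
rewrite !mxE lt -[in LHS](natr_Zp (x.2 k i)) -[in LHS](natr_Zp (x'.2 k i)).
rewrite -[in LHS](natr_Zp (x.1 0%R k)) -[in LHS](natr_Zp (x'.1 0%R i)).
by rewrite -natrM -!natrD exp_natR // addnC addnA.
Qed.

Lemma gen_hom_gen i : gen_hom (gen i) = y i.
Proof.
rewrite /gen_hom cprod0 ?mulg1 => [|k j]; last by rewrite mxE.
rewrite /pprod; have := enum_uniq 'I_d; have : i \in enum 'I_d by rewrite mem_enum.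
have v1 : nat_of_ord (1 : R) = 1%N by rewrite -[1%R]/(1%:R) val_Zp_nat ?pN_gt1 // modn_small ?pN_gt1.
elim: (enum 'I_d) => [|j r IH] //=; rewrite inE big_cons mxE eqxx /=.
have [<- _|ne /= ir] := eqVneq i j.
  move=> /andP [ni _]; rewrite mulr1n v1 expg1 big_seq big1 ?mulg1 // => k kr.
  by rewrite mxE eqxx /=; case: eqP kr ni => // -> ->.
by move=> /andP [_ ur]; rewrite expg0 mul1g; apply: IH.
Qed.

End Hom.

End Model.

(** F maps onto the model by its universal property. The quotient of F by a normal
    subgroup of index p ^ n has class two and exponent dividing p ^ N, hence it
    receives the homomorphism [gen_hom] from the model. The two maps from F to the
    quotient agree on the generators, so the subgroup contains the kernel of the
    map to the model. *)
Theorem num_normal_model (d : nat) (F : groupType) (p N n : nat) : prime p ->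
  (0 < N)%N -> (n <= N)%N -> free_nilpotent2 d F ->
  num_normal F (p ^ n) =
  #|[set M : {group model p N d} | normal M (alt_model p N d) & #|alt_model p N d : M| == (p ^ n)%N]|.
Proof.
move=> p_pr N0 leN [nilF [x UP]].
pose E := alt_model p N d.
have sR (a b : subg_of E) : sgval [~ a, b]%g = [~ sgval a, sgval b]%g.
  by apply: (morphR (sgval_morphism E)); rewrite inE.
have nilS : nilpotent2 (subg_of E).
  by move=> a b c; apply: val_inj; rewrite -[LHS]/(sgval [~ [~ a, b], c]%g) sR sR; apply: model_nilpotent.
have [[f fx] _] : (exists f : {multiplicative F -> subg_of E},
    forall i, f (x i) = subg E (gen p N i)) /\ True.
  by split=> //; have [h _] := UP _ nilS; apply: h.
pose g0 (z : F) : model p N d := sgval (f z).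
have g0M : {morph g0 : a b / (a * b)%g}.
  by move=> a b; rewrite /g0 gmulfM.
pose g : {multiplicative F -> model p N d} :=
  HB.pack_for {multiplicative F -> model p N d} g0 (isMultiplicative.Build F (model p N d) g0 g0M).
have gx i : g (x i) = gen p N i by rewrite /g /= /g0 fx subgK // gen_alt_model.
have g_im z : z \in E <-> exists t, g t = z.
  pose A : {set model p N d} := [set z | `[< exists t, g t = z >]].
  have AP u : u \in A <-> exists t, g t = u by rewrite inE; split=> /asboolP.
  have gA : group_set A.
    apply/group_setP; split; first by apply/AP; exists 1%g; apply: gmul1.
    by move=> _ _ /AP [a <-] /AP [b <-]; apply/AP; exists (a * b)%g; apply: gmulfM.
  have sA : Group gA \subset E by apply/subsetP => _ /AP [t <-]; apply: subgP.
  have genA i : gen p N i \in Group gA by apply/AP; exists (x i); apply: gx.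
  have eA := gen_generates genA sA.
  by rewrite /E -eA; apply: AP.
apply: (num_normal_preim g_im) => M nM iM t gt1.
have [Q [rho [cQ rs rk]]] := finite_quotient nM iM.
have rR a b : rho [~ a, b]%g = [~ rho a, rho b]%g.
  by rewrite /commg /conjg !gmulfM !gmulV.
have nilQ : nilpotent2 Q.
  move=> a b c; have [a' <-] := rs a; have [b' <-] := rs b; have [c' <-] := rs c.
  by rewrite -!rR nilF gmul1.
pose y i := rho (x i).
have yq i : (y i ^+ (p ^ N) = 1)%g.
  rewrite -(subnKC leN) expnD expgM -cQ.
  by have := expg_cardG (in_setT (y i)); rewrite cardsT => ->; rewrite expg1n.
pose h0 (z : F) : Q := gen_hom y (g z).
have h0M : {morph h0 : a b / (a * b)%g}.
  by move=> a b; rewrite /h0 gmulfM gen_homM.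
pose h : {multiplicative F -> Q} :=
  HB.pack_for {multiplicative F -> Q} h0 (isMultiplicative.Build F Q h0 h0M).
have e : rho =1 h.
  have [_ u] := UP Q nilQ; apply: u => i.
  by rewrite /h /= /h0 gx gen_hom_gen.
apply/rk; rewrite e -[h t]/(gen_hom y (g t)) gt1 -(gmul1 g).
exact: (gmul1 h).
Qed.

(** * The recursion over pairs of lattices *)

(** So phi d i counts the pairs of basis vectors that are not both among
    the last d - i. *)
Lemma phi_compl d i : (i <= d)%N -> (phi d i + 'C(d - i, 2) = 'C(d, 2))%N.
Proof.
move=> lei; rewrite /phi.
have e : (i * d = 'C(i.+1, 2) + ('C(d, 2) - 'C(d - i, 2)))%N /\ ('C(d - i, 2) <= 'C(d, 2))%N.
  have [k ->] : exists k, d = (i + k)%N by exists (d - i)%N; rewrite subnKC.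
  rewrite addKn; elim: i {lei} => [|i [IH le]]; first by rewrite !add0n subnn.
  have b2 m : 'C(m.+1, 2) = (m + 'C(m, 2))%N by rewrite binS bin1 addnC.
  have e1 : 'C(i.+1 + k, 2) = (i + k + 'C(i + k, 2))%N by rewrite addSn b2.
  rewrite (b2 i.+1) e1; move: 'C(_, 2) 'C(_, 2) 'C(_, 2) IH le => x y z IH le.
  by split; lia.
by case: e => -> le; rewrite addKn subnK.
Qed.

Lemma phi_compl_sub d i j : (i <= d)%N -> (j <= 'C(d, 2))%N ->
  ('C(d - i, 2) - ('C(d, 2) - j) = j - phi d i)%N.
Proof. by move=> hi hj; rewrite -(phi_compl hi) in hj *; lia. Qed.

Lemma phi_compl_le d i j : (i <= d)%N -> (phi d i <= j)%N ->
  ('C(d, 2) - j <= 'C(d - i, 2))%N.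
Proof. by move=> hi hj; rewrite -(phi_compl hi); lia. Qed.

Lemma qbinom_small (K : fieldType) (q : K) a b : (a < b)%N -> qbinom q a b = 0.
Proof.
by move=> lt; rewrite /qbinom (bigD1 (Ordinal lt)) //= subrr mul0r mul0r.
Qed.

Lemma qbinom_inv (K : fieldType) (q : K) a b : q != 0 -> (b <= a)%N ->
  qbinom q a b = q ^+ (b * (a - b)) * qbinom q^-1 a b.
Proof.
move=> q0 leba.
have E (x y : nat) : (y <= x)%N -> q^-1 ^+ x - q^-1 ^+ y = (q ^+ y - q ^+ x) / q ^+ (x + y).
  move=> lexy; rewrite !exprVn mulrBl exprD; congr (_ - _).
    by field; rewrite !expf_neq0.
  by field; rewrite !expf_neq0.
rewrite /qbinom.
have -> : q ^+ (b * (a - b)) = \prod_(i < b) q ^+ (a - b).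
  by rewrite prodr_const card_ord -exprM mulnC.
rewrite -big_split /=; apply: eq_bigr => i _.
have lib : (i < b)%N by [].
rewrite !E; [|exact: ltnW|exact: leq_trans (ltnW lib) leba].
have [eb|nb] := eqVneq (q ^+ b) (q ^+ i).
  by rewrite eb subrr mul0r invr0 !mulr0.
have nb1 : q ^+ b - q ^+ i != 0 by rewrite subr_eq0.
have nb2 : q ^+ i - q ^+ b != 0 by rewrite subr_eq0 eq_sym.
have qn n : q ^+ n != 0 by rewrite expf_neq0.
have ea : q ^+ (a + i) = q ^+ (a - b) * q ^+ (b + i).
  by rewrite -exprD addnA subnK.
by rewrite ea; field; rewrite nb1 nb2 !qn.
Qed.

Lemma qbinom_count (K : numFieldType) (p w c b : nat) : (0 < p)%N -> (b <= c)%N ->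
  p%:R ^+ (w * (c - b)) * qbinom p%:R (c - w) (c - b) =
  p%:R ^+ (b * (c - b)) * qbinom (p%:R^-1 : K) (c - w) (c - b).
Proof.
move=> p0 leb; have pn0 : (p%:R : K) != 0 by rewrite pnatr_eq0 -lt0n.
case: (posnP (c - b)) => [->|cb]; first by rewrite !muln0 !qbinomn0.
case: (leqP w b) => [lewb|ltwb]; last by rewrite !qbinom_small ?mulr0 //; lia.
rewrite qbinom_inv //; last by lia.
by rewrite mulrA -exprD; congr (_ ^+ _ * _); rewrite mulnC -mulnDr mulnC; congr (_ * _)%N; lia.
Qed.

Section Colength.

Variables (gT : finGroupType) (X : {group gT}) (abX : abelian X) (p : nat).
Hypothesis p_pr : prime p.
Local Notation f := (powm abX p).

Lemma colength_le (D H : {group gT}) c : D \subset H -> H \subset X ->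
  #|X : D <*> f @* X| = (p ^ c)%N ->
  exists2 b, (b <= c)%N & #|X : H <*> f @* X| = (p ^ b)%N.
Proof.
move=> sDH sHX e.
have : (#|X : H <*> f @* X| %| p ^ c)%N.
  by rewrite -e; apply: indexgS; apply: genS; apply: setSU.
by move/(dvdn_pfactor _ _ p_pr) => [b leb ->]; exists b.
Qed.

(** Nakayama's lemma, for the nilpotent action of p. *)
Lemma colength0 N (H : {group gT}) : (forall x, x \in X -> (x ^+ (p ^ N))%g = 1%g) ->
  H \subset X -> #|X : H <*> f @* X| = 1%N -> H = X.
Proof.
move=> exN sHX e.
have sR : H \subset f @*^-1 H.
  by rewrite -sub_morphim_pre // im_powm_sub.
have /eqP eR : H == f @*^-1 H :> {set gT}.
  by rewrite eqEcard sR /= -card_root // e mul1n leqnn.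
apply/val_inj/eqP; rewrite eqEsubset sHX /=; apply/subsetP => x Xx.
have : (x ^+ (p ^ N))%g \in H by rewrite exN.
elim: N {exN} => [|N IH]; first by rewrite expn0 expg1.
rewrite expnSr expgM => h; apply: IH; rewrite -[_ \in _]/(_ \in (H : {set _})) eR.
by apply/morphpreP; split; [apply: groupX | apply: h].
Qed.

End Colength.

Section PairRecursion.

Variables (p N d : nat).
Hypotheses (p_pr : prime p) (N_gt0 : (0 < N)%N).

Local Notation R := 'Z_(p ^ N).
Local Notation D := 'C(d, 2).
Local Notation gL := ([set: 'rV[R]_d]%G).
Local Notation gK := (@altgroup p N d).
Local Notation fL := (@powL p N d).
Local Notation fK := (@powK p N d).
Local Notation pairT := ({group 'rV[R]_d} * {group 'M[R]_d})%type.

Local Notation abL := (FinRing.zmod_abelian gL).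
Local Notation abK := (FinRing.zmod_abelian gK).
Local Notation latL := (lattices_over abL p 1%G).
Local Notation latK := (lattices_over abK p).

(** The possible projections and slices of the normal subgroups of index p ^ n. *)
Definition pairs (n : nat) : {set pairT} :=
  [set u : pairT | [&& u.2 \subset gK, wedge_span u.1 \subset u.2
    & (#|gL : u.1| * #|gK : u.2| == p ^ n)%N]].

(** The state (i, j) records the colengths of the two lattices modulo p. *)
Definition pairs_at (n i j : nat) : {set pairT} :=
  [set u in pairs n | (#|gL : u.1 <*> fL @* gL| == p ^ (d - i))%N
    && (#|gK : u.2 <*> fK @* gK| == p ^ (D - j))%N].

(** The number of normal subgroups that have u as projection and slice, see
    [card_fiber_model]. *)
Definition weight (u : pairT) : nat := (#|gK : u.2| ^ d)%N.

Definition weighted_count (n i j : nat) : nat := (\sum_(u in pairs_at n i j) weight u)%N.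

Lemma pairsE n u : (u \in pairs n) = [&& u.2 \subset gK, wedge_span u.1 \subset u.2
    & (#|gL : u.1| * #|gK : u.2| == p ^ n)%N].
Proof. by rewrite in_set. Qed.

Lemma pairs_atE n i j u : (u \in pairs_at n i j) =
  [&& u \in pairs n, (#|gL : u.1 <*> fL @* gL| == p ^ (d - i))%N
    & (#|gK : u.2 <*> fK @* gK| == p ^ (D - j))%N].
Proof. by rewrite in_set. Qed.

Lemma exp_gL (x : 'rV[R]_d) : (x ^+ (p ^ N))%g = 1%g.
Proof. by rewrite FinRing.zmodXgE -scaler_nat natrN0 // scale0r. Qed.

Lemma exp_gK (x : 'M[R]_d) : (x ^+ (p ^ N))%g = 1%g.
Proof. by rewrite FinRing.zmodXgE -scaler_nat natrN0 // scale0r. Qed.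

Lemma box1 (g : 'M[R]_d) : g \in unitmx -> 1%G = box g (fun=> N) :> {set _}.
Proof.
move=> ug; apply/setP => x; rewrite inE; apply/eqP/boxP => [-> i|h].
  by rewrite mul0mx mxE divRz0.
have e : x *m invmx g = 0.
  by apply/matrixP => i j; rewrite ord1 [RHS]mxE; apply: (divRN0 p_pr N_gt0 (h j)).
by rewrite -[x](mulmxKV ug) e mul0mx.
Qed.

Lemma colength_gL : #|gL : 1%G <*> fL @* gL| = (p ^ d)%N.
Proof.
have u1 : 1%:M \in @unitmx R d by apply: unitmx1.
rewrite (box_top_index p_pr N_gt0 u1 _ (box1 u1)) //.
by rewrite N_gt0 sum_nat_const card_ord muln1.
Qed.

(** The bound phi d i <= j holds since the second lattice contains a span of
    wedges, of colength 'C(d - i, 2). *)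
Lemma pairs_type n u : u \in pairs n -> exists i j,
  [/\ (i <= d)%N, (phi d i <= j)%N, (j <= D)%N & u \in pairs_at n i j].
Proof.
move=> up; have /and3P [sM sW _] : [&& u.2 \subset gK, wedge_span u.1 \subset u.2
    & (#|gL : u.1| * #|gK : u.2| == p ^ n)%N] by rewrite -pairsE.
have [a lea ea] := colength_le p_pr (sub1G u.1) (subsetT _) colength_gL.
have [b leb eb] := colength_le p_pr sW sM (wedge_top_index p_pr N_gt0 ea).
have le : ('C(a, 2) <= D)%N by apply: leq_bin2l.
exists (d - a)%N, (D - b)%N; split; rewrite ?leq_subr //.
  by have := phi_compl (leq_subr a d); rewrite subKn //; lia.
by rewrite pairs_atE up !subKn ?(leq_trans leb le) // ea eb !eqxx.
Qed.

Lemma pairs_at_uniq n i j i' j' u : (i <= d)%N -> (i' <= d)%N -> (j <= D)%N -> (j' <= D)%N ->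
  u \in pairs_at n i j -> u \in pairs_at n i' j' -> i = i' /\ j = j'.
Proof.
move=> hi hi' hj hj'; rewrite !pairs_atE => /and3P [_ /eqP -> /eqP ->] /and3P [_].
by rewrite !eqn_exp2l ?prime_gt1 // => /eqP e1 /eqP e2; lia.
Qed.

Lemma sum_pairs (K : nmodType) n (h : pairT -> K) :
  \sum_(u in pairs n) h u =
  \sum_(i < d.+1) \sum_(j < D.+1 | (phi d i <= j)%N) \sum_(u in pairs_at n i j) h u.
Proof.
transitivity (\sum_(u in pairs n) \sum_(i < d.+1) \sum_(j < D.+1 | (phi d i <= j)%N)
   if u \in pairs_at n i j then h u else 0).
  apply: eq_bigr => u up; have [i [j [hi hp hj hu]]] := pairs_type up.
  rewrite (bigD1 (inord i : 'I_d.+1)) //= (bigD1 (inord j : 'I_D.+1)) ?inordK //=.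
  rewrite hu [X in _ + X + _]big1 ?addr0 ?big1 ?addr0 // => [i' ni|j' /andP [_ nj]].
    apply: big1 => j' _; case: ifP => hu'; last by [].
    have [e _] := pairs_at_uniq hi (leq_ord i') hj (leq_ord j') hu hu'.
    by case/negP: ni; apply/eqP/val_inj; rewrite /= inordK.
  case: ifP => hu'; last by [].
  have [_ e] := pairs_at_uniq hi hi hj (leq_ord j') hu hu'.
  by case/negP: nj; apply/eqP/val_inj; rewrite /= inordK.
rewrite exchange_big; apply: eq_bigr => i _ /=.
rewrite (exchange_big_dep (fun j : 'I_D.+1 => phi d i <= j)%N) //=; apply: eq_bigr => j hj.
rewrite [RHS](bigID (fun u => u \in pairs n)) /= [X in _ = _ + X]big1 ?addr0.
  rewrite -big_mkcondr /=; apply: eq_bigl => u.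
  by rewrite hj andbT andbC.
by move=> u /andP []; rewrite pairs_atE => /andP [->].
Qed.

Definition root_pair (u : pairT) : pairT := ((fL @*^-1 u.1)%G, (fK @*^-1 u.2)%G).

(** Taking p-th roots divides the index by p to the colength, so on a fiber the
    condition on the index is automatic. *)
Lemma root_fiber m i j (v : pairT) : (i <= d)%N -> (j <= D)%N -> v \in pairs m ->
  [set u in pairs_at (m + ((d - i) + (D - j))) i j | root_pair u == v] =
  [set u : pairT | (u.1 \in latL v.1 (d - i))
     && (u.2 \in latK (wedge_span u.1) v.2 (D - j))].
Proof.
move=> hi hj; rewrite pairsE => /and3P [sM1 sW1 /eqP ind].
apply/setP => u; rewrite in_set [RHS]in_set pairs_atE pairsE [u.1 \in _]in_set [u.2 \in _]in_set.
have -> : (root_pair u == v) = (fL @*^-1 u.1 == v.1 :> {set _}) && (fK @*^-1 u.2 == v.2 :> {set _}).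
  by case: v {sM1 sW1 ind} => v1 v2.
rewrite sub1G subsetT /=.
case e1: (fL @*^-1 u.1 == v.1 :> {set _}); last by rewrite !andbF.
case e2: (fK @*^-1 u.2 == v.2 :> {set _}); last by rewrite !andbF.
case c1: (_ == (p ^ (d - i))%N); last by rewrite !andbF.
case c2: (_ == (p ^ (D - j))%N); last by rewrite !andbF.
case sM: (u.2 \subset gK); last by rewrite !andbF.
case sW: (wedge_span u.1 \subset u.2); last by rewrite !andbF.
rewrite /= !andbT.
rewrite (index_root abL p (subsetT u.1)) (eqP c1) (eqP e1).
rewrite (index_root abK p sM) (eqP c2) (eqP e2).
by rewrite mulnACA ind -!expnD addnC eqxx.
Qed.

Definition wt i j := ((d - i) + (D - j))%N.

(** The transition coefficient from the state of a pair to the state of its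
    p-th root; the powers of p that normalise it are gathered in [wcoef]. *)
Definition Bcoef (K : fieldType) i j i' j' : K :=
  qbinom p%:R^-1 i' i * qbinom p%:R^-1 (j' - phi d i) (j - phi d i).

Definition wcoef i j : nat := p ^ (i * (d - i) + (D - j) * (d + (j - phi d i))).

Lemma root_pair_in n i j u : u \in pairs_at n i j ->
  (wt i j <= n)%N && (root_pair u \in pairs (n - wt i j)).
Proof.
rewrite pairs_atE pairsE => /andP [/and3P [sM sW /eqP ind] /andP [/eqP c1 /eqP c2]].
rewrite (index_root abL p (subsetT u.1)) c1 in ind.
rewrite (index_root abK p sM) c2 in ind.
rewrite mulnACA -expnD -/(wt i j) in ind.
have p0 k : (0 < p ^ k)%N by rewrite expn_gt0 prime_gt0.
have le : (wt i j <= n)%N.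
  by rewrite -(leq_exp2l _ _ (prime_gt1 p_pr)) -ind leq_pmulr // muln_gt0 !indexg_gt0.
rewrite le /= pairsE subsetIl -(wedge_span_root p_pr N_gt0) morphpreS //=.
by rewrite -(eqn_pmul2l (p0 (wt i j))) -expnD subnKC // ind.
Qed.

(** First choose the projection over the given root, then a slice that contains its
    span of wedges; [wedge_span_root] puts the second count in the form of
    [card_lattices_over] whatever the first choice was. *)
Lemma card_fiber (K : numFieldType) m i j i' j' v : (m < N)%N ->
  (i <= d)%N -> (phi d i <= j)%N -> (j <= D)%N -> (i' <= d)%N -> (j' <= D)%N ->
  v \in pairs_at m i' j' ->
  (#|[set u : pairT | (u.1 \in latL v.1 (d - i))
     && (u.2 \in latK (wedge_span u.1) v.2 (D - j))]|)%:R
  = p%:R ^+ (i * (d - i) + (D - j) * (j - phi d i)) * Bcoef K i j i' j' :> K.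
Proof.
move=> mN hi hp hj hi' hj'; rewrite pairs_atE pairsE.
move=> /andP [/and3P [sM sW /eqP ind] /andP [/eqP c1 /eqP c2]].
have p0 := prime_gt0 p_pr.
have [ker1 ker2] : ('ker fL \subset v.1) /\ ('ker fK \subset wedge_span v.1).
  have : (#|gL : v.1| %| p ^ m)%N by rewrite -ind dvdn_mulr.
  move/(dvdn_pfactor _ _ p_pr) => [m' lem em'].
  by apply: (small_index_ker p_pr N_gt0 em'); apply: leq_ltn_trans lem mN.
have hc := phi_compl_le hi hp.
have fibK L : L \in latL v.1 (d - i) ->
   (#|latK (wedge_span L) v.2 (D - j)|)%:R =
   p%:R ^+ ((D - j) * (j - phi d i)) * qbinom p%:R^-1 (j' - phi d i) (j - phi d i) :> K.
  rewrite in_set => /and4P [_ _ /eqP eL /eqP iL].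
  have sLv : L \subset v.1 by rewrite -eL -sub_morphim_pre ?subsetT //; apply: im_powm_sub; apply: subsetT.
  have sWL : wedge_span L \subset v.2 by apply: subset_trans sW; apply: wedge_spanS.
  have ev : wedge_span v.1 = fK @*^-1 (wedge_span L) :> {set _}.
    by rewrite (wedge_span_root p_pr N_gt0); congr (_ : {set _}); congr wedge_span; apply/val_inj.
  have sI : wedge_span L :&: fK @* gK \subset fK @* v.2.
    by rewrite -morphim_pre -ev; apply: morphimS.
  rewrite (card_lattices_over p_pr K (subset_trans ker2 sW) sM sWL sI c2
     (wedge_top_index p_pr N_gt0 iL) hc).
  by rewrite (qbinom_count _ _ p0 hc) !phi_compl_sub.
have fibL : (#|latL v.1 (d - i)|)%:R =
   p%:R ^+ (i * (d - i)) * qbinom p%:R^-1 i' i :> K.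
  have sI : 1%G :&: fL @* gL \subset fL @* v.1 by rewrite (setIidPl (sub1G _)) sub1G.
  rewrite (card_lattices_over p_pr K ker1 (subsetT _) (sub1G _) sI c1 colength_gL) ?leq_subr //.
  by rewrite qbinom_count ?leq_subr // !subKn // mulnC.
transitivity (\sum_(L in latL v.1 (d - i))
  (#|latK (wedge_span L) v.2 (D - j)|)%:R : K).
  rewrite -natr_sum; congr (_%:R); rewrite -sum1_card.
  under eq_bigl do rewrite in_set.
  rewrite -(pair_big_dep (fun L => L \in latL v.1 (d - i))
     (fun L M => M \in latK (wedge_span L) v.2 (D - j))
     (fun _ _ => 1%N)) /=.
  by apply: eq_bigr => L _; rewrite sum1_card.
rewrite (eq_bigr _ fibK) sumr_const -[LHS]mulr_natl fibL /Bcoef exprD.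
by rewrite mulrACA mulrA.
Qed.

(** Sort the pairs by their p-th roots. *)
Lemma weighted_count_rec (K : numFieldType) n i j : (n <= N)%N -> (0 < wt i j)%N ->
  (i <= d)%N -> (phi d i <= j)%N -> (j <= D)%N ->
  (weighted_count n i j)%:R = (if (wt i j <= n)%N then (wcoef i j)%:R *
     \sum_(i' < d.+1) \sum_(j' < D.+1 | (phi d i' <= j')%N)
       Bcoef K i j i' j' * (weighted_count (n - wt i j) i' j')%:R else 0) :> K.
Proof.
move=> leN wt0 hi hp hj; case: leqP => le; last first.
  rewrite /weighted_count big1 // => u /root_pair_in /andP [le' _].
  by rewrite leqNgt le in le'.
set m := (n - wt i j)%N.
have mN : (m < N)%N by rewrite /m; lia.
have en : (m + wt i j = n)%N by rewrite subnK.
transitivity (\sum_(v in pairs m) \sum_(u in pairs_at n i j | root_pair u == v) (weight u)%:R : K).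
  rewrite /weighted_count natr_sum (partition_big root_pair (fun v => v \in pairs m)) //.
  by move=> u /root_pair_in /andP [].
rewrite sum_pairs mulr_sumr; apply: eq_bigr => i' _; rewrite mulr_sumr; apply: eq_bigr => j' hj'.
rewrite /weighted_count natr_sum !mulr_sumr; apply: eq_bigr => v hv.
have vp : v \in pairs m by move: hv; rewrite pairs_atE => /andP [].
have := root_fiber hi hj vp; rewrite en => /setP fib.
transitivity (\sum_(u in [set u : pairT | (u.1 \in latL v.1 (d - i))
     && (u.2 \in latK (wedge_span u.1) v.2 (D - j))])
   (p%:R ^+ ((D - j) * d) * (weight v)%:R) : K).
  apply: eq_big => u; first by rewrite -fib in_set.
  move=> uf; have : u \in [set u in pairs_at n i j | root_pair u == v] by rewrite in_set.
  rewrite fib in_set => /andP [_ /(lattices_overP) e].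
  by rewrite /weight e expnMn natrM -natrX expnM.
rewrite sumr_const -[LHS]mulr_natl (card_fiber K mN hi hp hj (leq_ord i') (leq_ord j') hv).
rewrite /wcoef natrX mulnDr [in RHS]addnCA [in RHS]addnC !exprD; ring.
Qed.

Lemma weighted_count_bot n : weighted_count n d D = (n == 0)%N.
Proof.
have full u : u \in pairs_at n d D -> u = (gL, gK).
  rewrite pairs_atE pairsE !subnn expn0 => /andP [/and3P [sM sW _] /andP [/eqP c1 /eqP c2]].
  have e1 := colength0 (fun x _ => exp_gL x) (subsetT _) c1.
  have e2 := colength0 (fun x _ => exp_gK x) sM c2.
  by case: u e1 e2 {sM sW c1 c2} => u1 u2 /= -> ->.
have [en|n0] := posnP n; last first.
  rewrite /weighted_count big1 ?gtn_eqF // => u /[dup] /full -> .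
  rewrite pairs_atE pairsE !indexgg => /andP [/and3P [_ _ /eqP e] _]; move: e.
  rewrite mul1n => e; have : (p ^ 0 == p ^ n)%N by rewrite expn0 e.
  by rewrite eqn_exp2l ?prime_gt1 // => /eqP e'; rewrite -e' in n0.
subst n; pose top : pairT := (gL, gK).
have top_in : top \in pairs_at 0 d D.
  rewrite pairs_atE pairsE /= !indexgg subxx wedge_span_alt !subnn /=.
  have sf1 : fL @* gL \subset gL by apply: subsetT.
  have sf2 : fK @* gK \subset gK by apply: im_powm_sub.
  have -> : gL <*> fL @* gL = gL by apply: (joing_idPl sf1).
  have -> : gK <*> fK @* gK = gK by apply: (joing_idPl sf2).
  by rewrite !indexgg.
rewrite /weighted_count (_ : pairs_at 0 d D = [set top]); last first.
  by apply/setP => u; rewrite in_set1; apply/idP/eqP => [/full //|->].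
by rewrite big_set1 /weight /= indexgg exp1n.
Qed.

End PairRecursion.

(** * Normal subgroups of the model *)

Section Complements.

Local Open Scope group_scope.
Variables (gT : finGroupType) (A Z : {group gT}) (T : finType).
Variables (h : T -> gT) (m : T -> nat).
Hypotheses (abA : abelian A) (sZA : Z \subset A) (hA : forall i, h i \in A).
Hypothesis genA : A \subset <<[set h i | i : T]>> <*> Z.
Hypothesis relA : forall c : T -> nat, \prod_i h i ^+ c i \in Z -> forall i, (m i %| c i)%N.
Hypothesis ordA : forall i z, z \in Z -> (h i * z) ^+ m i = 1.

Definition section_group (u : T -> gT) : {group gT} :=
  <<[set (h i * u i)%g | i in T]>>%G.

Lemma abel_commute x y : x \in A -> y \in A -> commute x y.
Proof. by move=> Ax Ay; apply: (centsP abA). Qed.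

Lemma prodM_abel (F G : T -> gT) : (forall i, F i \in A) -> (forall i, G i \in A) ->
  \prod_i (F i * G i) = \prod_i F i * \prod_i G i.
Proof.
move=> hF hG; elim: (index_enum T) => [|i r IH]; first by rewrite !big_nil mulg1.
rewrite !big_cons IH -!mulgA; congr (_ * _); rewrite !mulgA; congr (_ * _).
by apply: abel_commute => //; apply: group_prod.
Qed.

Lemma section_groupP (u : T -> gT) x : (forall i, u i \in Z) ->
  x \in section_group u -> exists c : T -> nat, x = \prod_i (h i * u i) ^+ c i.
Proof.
move=> hu; have huA i : h i * u i \in A by rewrite groupM // (subsetP sZA).
pose B := [set x | `[< exists c : T -> nat, x = \prod_i (h i * u i)%g ^+ c i >]].
have BP y : y \in B <-> exists c : T -> nat, y = \prod_i (h i * u i) ^+ c i.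
  by rewrite inE; split=> /asboolP.
have gB : group_set B.
  apply/group_setP; split; first by apply/BP; exists (fun=> 0%N); rewrite big1.
  move=> _ _ /BP [c ->] /BP [c' ->]; apply/BP; exists (fun i => c i + c' i)%N.
  rewrite -prodM_abel; first by apply: eq_bigr => i _; rewrite expgD.
    by move=> i; apply: groupX.
  by move=> i; apply: groupX.
move=> Dx; apply/BP; apply: (subsetP _ x Dx); rewrite -[B]/(gval (Group gB)) gen_subG.
apply/subsetP => _ /imsetP [i _ ->]; apply/BP; exists (fun j => (j == i) : nat).
have ui := index_enum_uniq T; have ii : i \in index_enum T by rewrite mem_index_enum.
elim: (index_enum T) ui ii => [|j r IH] //=; rewrite inE big_cons => /andP [nj ur].
have [ij _|ne /= ir] := eqVneq i j.
  subst j; rewrite expg1 big_seq big1 ?mulg1 // => k kr.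
  by case: eqP kr nj => // -> ->.
by rewrite mul1g; apply: IH.
Qed.

Lemma section_group_sub u : (forall i, u i \in Z) -> section_group u \subset A.
Proof.
move=> hu; rewrite gen_subG; apply/subsetP => _ /imsetP [i _ ->].
by rewrite groupM // (subsetP sZA).
Qed.

Lemma section_group_TI u : (forall i, u i \in Z) -> section_group u :&: Z = 1.
Proof.
move=> hu; apply/trivgP/subsetP => x; rewrite inE => /andP [/(section_groupP hu) [c ->]].
have uA i : u i \in A by apply: (subsetP sZA).
rewrite (eq_bigr (fun i => h i ^+ c i * u i ^+ c i)); last first.
  by move=> i _; rewrite expgMn //; apply: abel_commute.
rewrite prodM_abel; [|by move=> i; apply: groupX|by move=> i; apply: groupX].
rewrite groupMr; last by apply: group_prod => i _; apply: groupX.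
move=> /relA dv; rewrite inE -prodM_abel; [|by move=> i; apply: groupX|by move=> i; apply: groupX].
rewrite big1 // => i _; rewrite -expgMn; last exact: abel_commute.
by have /dvdnP [k ->] := dv i; rewrite mulnC expgM ordA // expg1n.
Qed.

Lemma section_group_full u : (forall i, u i \in Z) -> A \subset section_group u <*> Z.
Proof.
move=> hu; apply: (subset_trans genA); rewrite join_subG joing_subr andbT gen_subG.
apply/subsetP => _ /imsetP [i _ ->]; rewrite -(mulgK (u i) (h i)) groupM ?groupV //.
  by apply: (subsetP (joing_subl _ _)); apply: mem_gen; apply/imsetP; exists i.
by apply: (subsetP (joing_subr _ _)).
Qed.

(** A complement of Z contains exactly one element of each coset of Z by some h i.
    Conversely any choice of such elements generates a complement, because the
    relations of the h i modulo Z hold for all their translates by Z. *)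
Lemma card_complements :
  #|[set C : {group gT} | [&& C \subset A, C :&: Z == 1 & A \subset C <*> Z]]| = (#|Z| ^ #|T|)%N.
Proof.
rewrite -(card_ffun_on T (mem Z)).
rewrite -(@card_in_imset _ _ (fun u : {ffun T -> gT} => section_group u)); last first.
  move=> u v /ffun_onP hu /ffun_onP hv e; apply/ffunP => i.
  have: (h i * u i)^-1 * (h i * v i) \in section_group u :&: Z.
    rewrite inE; apply/andP; split.
      have mem_sec (w : T -> gT) : h i * w i \in section_group w.
        by apply: mem_gen; apply/imsetP; exists i.
      by rewrite groupM // ?groupV ?mem_sec // e mem_sec.
    by rewrite invMg -mulgA mulKg groupM ?groupV.
  rewrite (section_group_TI hu) inE => /eqP; rewrite invMg -mulgA mulKg => e1.
  by apply: (mulgI (u i)^-1); rewrite e1 mulVg.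
apply: eq_card => C; rewrite inE; apply/and3P/imsetP => [[sC /eqP tC fC]|[u /ffun_onP hu ->]]; last first.
  by rewrite section_group_sub // section_group_TI // section_group_full.
have AE (B : {group gT}) : B \subset A -> B <*> Z = B * Z.
  by move=> sB; rewrite cent_joinEr //; apply: (sub_abelian_cent2 abA).
have ex i : exists z, (z \in Z) && (h i * z \in C).
  have : h i \in C * Z by rewrite -AE // (subsetP fC).
  case/mulsgP => c z Cc Zz e; exists z^-1; rewrite groupV Zz /=.
  by rewrite e mulgK.
pose u := [ffun i => xchoose (ex i)].
have hu i : u i \in Z by rewrite ffunE; have /andP [] := xchooseP (ex i).
exists u; first by apply/ffun_onP.
apply/val_inj/eqP; rewrite eq_sym eqEcard; apply/andP; split.
  rewrite gen_subG; apply/subsetP => _ /imsetP [i _ ->]; rewrite ffunE.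
  by have /andP [] := xchooseP (ex i).
have cE (B : {group gT}) : B \subset A -> B :&: Z = 1 -> A \subset B <*> Z -> (#|B| * #|Z| = #|A|)%N.
  move=> sB tB fB; rewrite -(TI_cardMg tB) -AE //.
  suff -> : B <*> Z = A by [].
  by apply/eqP; rewrite eqEsubset fB join_subG sB sZA.
have := cE _ sC tC fC; rewrite -(cE _ (section_group_sub hu) (section_group_TI hu) (section_group_full hu)).
by move/eqP; rewrite eqn_pmul2r // => /eqP ->.
Qed.

End Complements.

Section RelativeComplements.

Local Open Scope group_scope.
Variables (gT : finGroupType) (A Z M : {group gT}) (T : finType).
Variables (h : T -> gT) (m : T -> nat).
Hypotheses (sMZ : M \subset Z) (sZA : Z \subset A) (nMA : A \subset 'N(M)).
Hypotheses (abA : abelian (A / M)) (hA : forall i, h i \in A).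
Hypothesis genA : A \subset <<[set h i | i : T]>> <*> Z.
Hypothesis relA : forall c : T -> nat, \prod_i h i ^+ c i \in Z -> forall i, (m i %| c i)%N.
Hypothesis ordA : forall i z, z \in Z -> (h i * z) ^+ m i \in M.

Lemma card_rel_complements :
  #|[set C : {group gT} | [&& M \subset C, C \subset A, C :&: Z == M & A \subset C <*> Z]]|
  = (#|Z : M| ^ #|T|)%N.
Proof.
have nMZ := subset_trans sZA nMA.
have sMA := subset_trans sMZ sZA.
have nh i : h i \in 'N(M) by apply: (subsetP nMA).
have sgN : <<[set h i | i in T]>> \subset 'N(M).
  by rewrite gen_subG; apply/subsetP => _ /imsetP [i _ ->].
rewrite -card_quotient //.
rewrite -(@card_complements _ (A / M)%G (Z / M)%G T (fun i => coset M (h i)) m abA); first last.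
- move=> i _ /morphimP [z nz Zz ->]; rewrite -morphM // -morphX ?groupM //.
  by apply: coset_id; apply: ordA.
- move=> c; rewrite (eq_bigr (fun i => coset M (h i ^+ c i))); last first.
    by move=> i _; rewrite morphX.
  have nc i : h i ^+ c i \in 'N(M) by apply: groupX.
  rewrite -morph_prod // => hq; apply: relA.
  have nP : \prod_i h i ^+ c i \in 'N(M) by apply: group_prod.
  move: hq; case/morphimP => z nz Zz /(rcoset_kercosetP nP nz).
  by case/rcosetP => w Mw ->; rewrite groupM // (subsetP sMZ).
- apply: (subset_trans (quotientS M genA)); rewrite quotientY // quotient_gen //; last first.
    by rewrite gen_subG in sgN.
  rewrite join_subG joing_subr andbT; apply: (subset_trans _ (joing_subl _ _)); apply: genS.
  apply/subsetP => _ /morphimP [_ _ /imsetP [i _ ->] ->].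
  by apply/imsetP; exists i.
- by move=> i; apply: mem_quotient.
- exact: quotientS.
rewrite -(@card_in_imset _ _ (fun C : {group gT} => (C / M)%G)); last first.
  move=> C1 C2; rewrite !inE => /and4P [s1 t1 _ _] /and4P [s2 t2 _ _] /(congr1 val) /= e.
  apply: val_inj; apply: (quotient_inj _ _ e).
    by rewrite /normal s1 (subset_trans t1).
  by rewrite /normal s2 (subset_trans t2).
apply: eq_card => C; rewrite inE; apply/imsetP/and3P => [[B]|[sC tC fC]].
  rewrite inE => /and4P [sMB sBA /eqP tB fB] ->; split.
  - exact: quotientS.
  - by rewrite -quotientGI // tB trivg_quotient.
  - rewrite -quotientY ?quotientS //; exact: (subset_trans sBA).
pose B := (coset M @*^-1 C)%G.
have BM : (B / M)%G = C by apply: val_inj; rewrite /= cosetpreK.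
have nMA' : normal M A by rewrite /normal sMA.
have sB : B \subset A by rewrite sub_cosetpre_quo.
have sMB : M \subset B by apply: sub_cosetpre.
have nB : B \subset 'N(M) by apply: subset_trans sB nMA.
exists B; rewrite ?BM // inE sMB sB /=; apply/andP; split.
  rewrite eqEsubset subsetI sMB sMZ !andbT.
  rewrite -quotient_sub1 ?(subset_trans (subsetIl _ _)) // quotientGI //.
  by rewrite -[B / M]/(gval (B / M)%G) BM (eqP tC).
rewrite -(quotientSGK nMA); last by apply: (subset_trans sMB); apply: joing_subl.
by rewrite quotientY // -[B / M]/(gval (B / M)%G) BM.
Qed.

End RelativeComplements.

Lemma expg_index (gT : finGroupType) (G H : {group gT}) x :
  normal H G -> x \in G -> (x ^+ #|G : H|)%g \in H.
Proof.
move=> /andP [sHG nHG] Gx; have nx := subsetP nHG x Gx.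
apply: coset_idr; first exact: groupX.
rewrite morphX // -card_quotient //; apply/eqP.
by rewrite -order_dvdn order_dvdG // mem_quotient.
Qed.

Lemma sub_double_succ n x : (x <= n)%N ->
  exists2 k, ((n + n).+1 - x = k.+1)%N & (n <= k)%N.
Proof. by move=> h; exists (n + n - x)%N; lia. Qed.

Section ModelCount.

Variables (p n d : nat).
Hypothesis p_pr : prime p.
Local Notation N := (n + n).+1.
Local Notation R := 'Z_(p ^ N).
Local Notation gL := ([set: 'rV[R]_d]%G).
Local Notation gK := (@altgroup p N d).
Local Notation E := (alt_model p N d).
Local Notation mod := (model p N d).
Implicit Types (L : {group 'rV[R]_d}) (M : {group 'M[R]_d}) (C : {group mod}).

Definition vert (M : {set 'M[R]_d}) : {set mod} := [set x | (x.1 == 0) && (x.2 \in M)].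

Lemma vertP (M : {set 'M[R]_d}) (x : mod) :
  reflect (x.1 = 0 /\ x.2 \in M) (x \in vert M).
Proof. by rewrite in_set; apply: (iffP andP) => [[/eqP h k]|[-> k]]; split. Qed.

Lemma group_set_vert M : group_set (vert M).
Proof.
apply/group_setP; split; first by apply/vertP; split=> //; apply: (group1 M).
move=> x y /vertP [x0 xM] /vertP [y0 yM]; apply/vertP; rewrite mulmE /= x0 y0 cocycle0l !addr0.
by split=> //; apply: (groupM xM yM).
Qed.
Canonical vert_group M := Group (group_set_vert M).

Definition over_lattice (L : {set 'rV[R]_d}) : {set mod} := [set x | (x.1 \in L) && (x.2 \in gK)].

Lemma over_latticeP (L : {set 'rV[R]_d}) (x : mod) :
  reflect (x.1 \in L /\ x.2 \in gK) (x \in over_lattice L).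
Proof. by rewrite [x \in over_lattice L]in_set; apply: (iffP andP). Qed.

Lemma group_set_over_lattice L : group_set (over_lattice L).
Proof.
apply/group_setP; split; first by apply/over_latticeP; split; apply: group1.
move=> x y /over_latticeP [x0 xM] /over_latticeP [y0 yM]; apply/over_latticeP; rewrite mulmE /=; split.
  exact: (groupM x0 y0).
exact: (groupM (groupM xM yM) (cocycle_alt _ _)).
Qed.
Canonical over_lattice_group L := Group (group_set_over_lattice L).

Definition slice (C : {set mod}) : {set 'M[R]_d} := [set u | ((0, u) : mod) \in C].

Lemma group_set_slice C : group_set (slice C).
Proof.
apply/group_setP; split; first by rewrite inE; apply: (group1 C).
move=> u v; rewrite !inE => hu hv; have := groupM hu hv.
by rewrite mulmE /= cocycle0l !addr0.
Qed.
Canonical slice_group C := Group (group_set_slice C).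

Lemma card_vert (M : {set 'M[R]_d}) : #|vert M| = #|M|.
Proof.
rewrite -(@card_imset _ _ (fun u : 'M[R]_d => ((0, u) : mod))); last by move=> u v [].
apply: eq_card => x; apply/vertP/imsetP => [[x0 xM]|[u uM ->]] //.
by exists x.2 => //; rewrite -x0; case: (x).
Qed.

Lemma vert_slice C : vert (slice C) = C :&: vert (setT : {set 'M[R]_d}).
Proof.
apply/setP => x; rewrite in_setI; apply/vertP/andP => [[x0]|[Cx /vertP [x0 _]]].
  rewrite inE => xC; have e : x = ((0, x.2) : mod) by rewrite -x0; case: (x).
  by rewrite e; split=> //; apply/vertP; rewrite inE.
by split=> //; rewrite inE -x0; case: (x) Cx.
Qed.

Lemma card_slice C : #|C| = (#|fstm p N d @* C| * #|slice C|)%N.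
Proof.
rewrite -(card_vert (slice C)) vert_slice card_morphim setTI -indexgI mulnC.
have -> : C :&: 'ker (fstm p N d) = C :&: vert (setT : {set 'M[R]_d}).
  congr (_ :&: _); apply/setP => x; apply/idP/vertP => [/morphpreP [_]|[x0 _]].
    by rewrite inE => /eqP h; split; rewrite ?inE.
  by apply/morphpreP; rewrite !inE; split=> //; apply/eqP.
have sVC : vert (slice C) \subset C by rewrite vert_slice subsetIl.
by rewrite -vert_slice (Lagrange sVC).
Qed.

Lemma card_E : #|E| = (#|gL| * #|gK|)%N.
Proof.
have eL : fstm p N d @* E = gL.
  apply/setP => a; rewrite in_setT; apply/morphimP; exists ((a, 0) : mod); rewrite ?in_setT //.
  by rewrite alt_modelP; apply: (group1 gK).
have eK : slice E = gK by apply/setP => u; rewrite in_set alt_modelP.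
by rewrite card_slice eL eK.
Qed.

Definition pair_of (C : {group mod}) : {group 'rV[R]_d} * {group 'M[R]_d} :=
  ((fstm p N d @* C)%G, slice_group C).

Lemma fst_imP C a : reflect (exists2 x, x \in C & a = x.1) (a \in fstm p N d @* C).
Proof.
apply: (iffP morphimP) => [[x _ Cx ->]|[x Cx ->]]; first by exists x.
by exists x; rewrite ?inE.
Qed.

Lemma pair_of_in C : normal C E -> #|E : C| = (p ^ n)%N -> pair_of C \in pairs p N d n.
Proof.
move=> /andP [sC nC] ind; rewrite pairsE /=.
have sM : slice C \subset gK.
  by apply/subsetP => u; rewrite inE => /(subsetP sC); rewrite alt_modelP.
apply/and3P; split=> //.
  rewrite gen_subG; apply/subsetP => _ /imset2P [a b /fst_imP [x Cx ->] _ ->].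
  have yE : ((b, 0) : mod) \in E by rewrite alt_modelP; apply: group1.
  rewrite inE -(model_commE x ((b, 0) : mod)).
  rewrite commgEl groupM ?groupV // memJ_norm //.
  by apply: (subsetP nC).
rewrite -(eqn_pmul2r (cardG_gt0 C)) -ind [X in _ == X]mulnC Lagrange //.
have l1 := Lagrange (subsetT (fstm p N d @* C)); have l2 := Lagrange sM.
by rewrite (card_slice C) card_E -l1 -l2 /=; apply/eqP; ring.
Qed.

Section Fiber.

Variables (L : {group 'rV[R]_d}) (M : {group 'M[R]_d}).
Hypothesis LM : (L, M) \in pairs p N d n.

(** Normality holds by itself: the commutators of elements over L lie in the span
    of wedges of L, hence in M. *)
Lemma fiber_eq :
  [set C : {group mod} | [&& normal C E, #|E : C| == (p ^ n)%N & pair_of C == (L, M)]] =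
  [set C : {group mod} | [&& vert M \subset C, C \subset over_lattice L, C :&: vert gK == vert M
     & over_lattice L \subset C <*> vert gK]].
Proof.
have := LM; rewrite pairsE /= => /and3P [sM sW /eqP ind].
have sZ : vert M \subset vert gK.
  by apply/subsetP => x /vertP [x0 xM]; apply/vertP; split=> //; apply: (subsetP sM).
have VI C : C \subset E -> C :&: vert gK = vert (slice C).
  move=> sC; rewrite vert_slice; apply/setP => x; rewrite !in_setI.
  case Cx: (x \in C) => //=; have := subsetP sC _ Cx; rewrite alt_modelP => xK.
  rewrite [LHS]in_set [RHS]in_set in_setT; congr (_ && _); exact: xK.
have vE : vert gK \subset E by apply/subsetP => x /vertP [_]; rewrite alt_modelP.
have nV C : C \subset E -> C <*> vert gK = (C * vert gK)%g.
  move=> sC; apply: norm_joinEl; apply/subsetP => x Cx; rewrite inE.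
  apply/subsetP => _ /imsetP [z /vertP [z0 zK] ->]; rewrite conjg_mulR model_commE z0.
  have w0 : wedge 0 x.1 = 0 by rewrite /wedge trmx0 mul0mx mulmx0 subrr.
  by rewrite mulmE /= w0 z0 cocycle0l !addr0; apply/vertP.
apply/setP => C; rewrite !in_set.
apply/and3P/and4P => [[nC /eqP iC /eqP [eL eM]]|[sVC sCT /eqP tC fC]].
  have sC := normal_sub nC.
  have eVM : vert M = C :&: vert gK by rewrite VI // -[slice C]/(gval (slice_group C)) eM.
  split; rewrite -?eVM //.
  - by rewrite eVM subsetIl.
  - apply/subsetP => x Cx; apply/over_latticeP; split.
      by rewrite -eL; apply/fst_imP; exists x.
    by have := subsetP sC _ Cx; rewrite alt_modelP.
  - rewrite nV //; apply/subsetP => x /over_latticeP; rewrite -eL => [[/fst_imP [y Cy e] xK]].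
    have yK : y.2 \in gK by have := subsetP sC _ Cy; rewrite alt_modelP.
    have -> : x = (y * ((0, x.2 - y.2)%R : mod))%g.
      by rewrite mulmE /= -e cocycle0r !addr0 addrC subrK; case: (x).
    apply: mem_mulg => //; apply/vertP; split=> //.
    exact: (groupM xK (groupVr yK)).
have sC : C \subset E by apply: (subset_trans sCT); apply/subsetP => x /over_latticeP [_]; rewrite alt_modelP.
have eM : slice_group C = M.
  apply/val_inj/setP => u /=; rewrite inE.
  have := congr1 (fun S : {set mod} => ((0, u) : mod) \in S) tC.
  rewrite (VI C sC) => h; have : (((0, u) : mod) \in vert (slice C)) = (u \in slice C).
    by apply/vertP/idP => [[]|] //.
  rewrite h => e1; have e2 : (((0, u) : mod) \in vert M) = (u \in M).
    by apply/vertP/idP => [[]|] //.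
  by rewrite -e2 e1 in_set.
have eL : (fstm p N d @* C)%G = L.
  apply/val_inj/setP => a /=; apply/fst_imP/idP => [[x Cx ->]|La].
    by have /over_latticeP [] := subsetP sCT _ Cx.
  have : ((a, 0) : mod) \in (C * vert gK)%g.
    by rewrite -nV // (subsetP fC) //; apply/over_latticeP; split=> //; apply: group1.
  case/mulsgP => x y Cx /vertP [y0 _] /(congr1 fst) /= e.
  by exists x => //; rewrite e y0 addr0.
have eP : pair_of C = (L, M) by rewrite /pair_of eL eM.
have nC : normal C E.
  rewrite /normal sC; apply/subsetP => y Ey; rewrite inE.
  apply/subsetP => _ /imsetP [x Cx ->]; rewrite conjg_mulR groupM // model_commE.
  apply: (subsetP sVC); apply/vertP; split=> //.
  apply: (subsetP sW); apply: mem_wedge_span.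
  by have /over_latticeP [] := subsetP sCT _ Cx.
split=> //; last by rewrite eP.
have := Lagrange sC; rewrite (card_slice C) card_E.
rewrite -[fstm p N d @* C]/(gval (fstm p N d @* C)%G) eL -[slice C]/(gval (slice_group C)) eM.
have := Lagrange (subsetT L); have := Lagrange sM => /= <- <- h.
apply/eqP; move: h; rewrite mulnACA ind => /eqP; rewrite eqn_pmul2l ?muln_gt0 ?cardG_gt0 //.
by move/eqP.
Qed.

Lemma dvd_bin2 k : (p ^ k %| 'C(p ^ k.+1, 2))%N.
Proof.
rewrite bin2 expnS -mulnA; set q := (p ^ k)%N.
have -> : (p * (q * (p * q).-1) = q * (p * (p * q).-1))%N by ring.
have ev : ~~ odd (p * (p * q).-1).
  have q0 : (0 < p * q)%N by rewrite -expnS expn_gt0 prime_gt0.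
  rewrite oddM; case op: (odd p) => //=.
  by rewrite -subn1 oddB // oddM op /= oddX op orbT.
by rewrite -(even_halfK ev) -muln2 mulnA muln2 doubleK dvdn_mulr.
Qed.

Lemma model_expg (x : mod) m : (x ^+ m)%g = ((x.1 *+ m, x.2 *+ m + cocycle x.1 x.1 *+ 'C(m, 2)) : mod).
Proof.
elim: m => [|m IH]; first by rewrite expg0 !mulr0n addr0.
rewrite expgSr IH mulmE /= !mulrSr binS bin1 addnC mulrnDr.
congr (_, _); rewrite -!addrA; congr (_ + _).
have -> : cocycle (x.1 *+ m) x.1 = cocycle x.1 x.1 *+ m.
  by elim: m {IH} => [|m IH]; rewrite ?mulr0n ?cocycle0l // !mulrS cocycleDl IH.
by rewrite addrCA; congr (_ + _); rewrite addrC.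
Qed.

(** The lifts h i of the generators of the box satisfy (h i * z) ^ (p ^ (N - lam i))
    = 1 modulo M for all z in K: the cocycle contributes a multiple
    of 'C(p ^ (N - lam i), 2), which is divisible by p ^ n as N > 2 n, and p ^ n
    annihilates K modulo M. So [card_rel_complements] applies. *)
Lemma card_fiber_model :
  #|[set C : {group mod} | [&& normal C E, #|E : C| == (p ^ n)%N & pair_of C == (L, M)]]| =
  (#|gK : M| ^ d)%N.
Proof.
rewrite fiber_eq.
have := LM; rewrite pairsE => /and3P [sM sW /eqP ind]; rewrite /= in sM sW ind.
have N0 : (0 < N)%N by [].
have [g ug [lam lamN eL]] := group_box p_pr N0 L.
have lamn i : (lam i <= n)%N.
  have h : (p ^ (\sum_i lam i) %| p ^ n)%N by rewrite -ind -(box_index p_pr N0 ug lamN eL) dvdn_mulr.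
  rewrite dvdn_Pexp2l ?prime_gt1 // in h; apply: leq_trans h.
  by rewrite (bigD1 i) //= leq_addr.
have sZ : vert M \subset vert gK.
  by apply/subsetP => x /vertP [x0 xM]; apply/vertP; split=> //; apply: (subsetP sM).
have sZA : vert gK \subset over_lattice L.
  by apply/subsetP => x /vertP [x0 xM]; apply/over_latticeP; rewrite x0; split=> //; apply: (group1 L).
have comA (x y : mod) : x \in over_lattice L -> [~ x, y]%g \in vert M.
  move=> /over_latticeP [Lx _]; rewrite model_commE; apply/vertP; split=> //.
  by apply: (subsetP sW); apply: mem_wedge_span.
have nMA : over_lattice L \subset 'N(vert M).
  apply/subsetP => x Ax; rewrite inE; apply/subsetP => _ /imsetP [z Mz ->].
  rewrite conjg_mulR; apply: (groupM (Mz : z \in vert_group M)); apply: comA.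
  by apply: (subsetP (subset_trans sZ sZA)).
have abA : abelian (over_lattice_group L / vert_group M).
  apply: sub_der1_abelian; rewrite derg1 gen_subG; apply/subsetP => _ /imset2P [x y Ax _ ->].
  exact: comA.
pose h (i : 'I_d) : mod := ((p ^ lam i)%:R *: row i g, 0).
have hg i : ((p ^ lam i)%:R *: row i g) *m invmx g = (p ^ lam i)%:R *: delta_mx 0 i.
  by rewrite -scalemxAl rowE mulmxK.
have hA i : h i \in over_lattice_group L.
  apply/over_latticeP; split; last exact: (group1 gK).
  rewrite -[_ \in _]/(_ \in (L : {set _})) eL; apply/boxP => j; rewrite /h /= hg !mxE /=.
  case: eqP => [->|_]; last by rewrite mulr0 divRz0.
  by apply/(divRP p_pr N0) => //; exists 1.
have genA : over_lattice_group L \subset <<[set h i | i : 'I_d]>> <*> vert_group gK.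
  apply/subsetP => x Ax; have /over_latticeP [Lx Kx] := Ax.
  have /boxP bx : x.1 \in box g lam by rewrite -eL.
  have /all_sig [w wP] : forall i, {w : R | (x.1 *m invmx g) 0 i = (p ^ lam i)%:R * w}.
    by move=> i; apply/cid; apply/(divRP p_pr N0 _ (lamN i)).
  pose P : mod := (\prod_(i < d) h i ^+ (w i : nat))%g.
  have PH : P \in <<[set h i | i : 'I_d]>>%g.
    by apply: group_prod => i _; apply: groupX; apply: mem_gen; apply/imsetP; exists i.
  have P1 : P.1 = x.1.
    have E (r : seq 'I_d) : (\prod_(i <- r) h i ^+ (w i : nat))%g.1 =
        \sum_(i <- r) (w i * (p ^ lam i)%:R) *: row i g.
      elim: r => [|i r IH]; first by rewrite !big_nil.
      rewrite !big_cons mulmE /= IH; congr (_ + _).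
      by rewrite fst_expg /= -scaler_nat scalerA natr_Zp.
    rewrite /P E -[RHS](mulmxKV ug) [RHS]mulmx_sum_row; apply: eq_bigr => i _.
    by rewrite wP mulrC.
  have PA : P \in over_lattice_group L by apply: group_prod => i _; apply: groupX.
  have /over_latticeP [_ PK] := PA.
  have -> : x = (P * ((0, x.2 - P.2)%R : mod))%g.
    by rewrite mulmE /= P1 cocycle0r !addr0 addrC subrK; case: (x).
  rewrite groupM ?(subsetP (joing_subl _ _) _ PH) //.
  apply: (subsetP (joing_subr _ _)); apply/vertP; split=> //.
  exact: (groupM Kx (groupVr PK)).
have relA (c : 'I_d -> nat) : (\prod_i h i ^+ c i)%g \in vert_group gK ->
    forall i, (p ^ (N - lam i) %| c i)%N.
  move=> /vertP [c0 _] i; move: c0.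
  have E (r : seq 'I_d) : (\prod_(i <- r) h i ^+ c i)%g.1 =
        \sum_(i <- r) (c i * p ^ lam i)%:R *: row i g.
    elim: r => [|j r IH]; first by rewrite !big_nil.
    rewrite !big_cons mulmE /= IH; congr (_ + _).
    by rewrite fst_expg /= -scaler_nat scalerA natrM.
  rewrite E => /(congr1 (fun v => (v *m invmx g) 0 i)).
  rewrite mul0mx [RHS]mxE mulmx_suml summxE (bigD1 i) //= big1 ?addr0; last first.
    move=> j ne; rewrite -scalemxAl rowE mulmxK // !mxE eqxx /= eq_sym (negbTE ne).
    by rewrite mulr0.
  rewrite -scalemxAl rowE mulmxK // !mxE !eqxx mulr1 => e.
  have : divR N ((c i * p ^ lam i)%:R : R) by rewrite e divRz0.
  rewrite (divR_nat p_pr) // -{1}(subnK (lamN i)) expnD dvdn_pmul2r //.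
  by rewrite expn_gt0 prime_gt0.
have mulpn (u : 'M[R]_d) k : u \in gK -> (p ^ n %| k)%N -> u *+ k \in M.
  move=> uK /dvdnP [k' ->]; rewrite mulnC mulrnA; apply: (groupX k').
  have : (#|gK : M| %| p ^ n)%N by rewrite -ind dvdn_mull.
  case/dvdnP => k2 ->; rewrite mulnC mulrnA; apply: (groupX k2).
  apply: (expg_index _ uK).
  by rewrite /normal sM sub_abelian_norm // FinRing.zmod_abelian.
have ordA i z : z \in vert_group gK -> ((h i * z) ^+ (p ^ (N - lam i))%N)%g \in vert_group M.
  move=> /vertP [z0 zK]; rewrite model_expg; apply/vertP => /=.
  rewrite z0 !addr0 !cocycle0r !addr0 add0r; split.
    by rewrite -scaler_nat scalerA -natrM -expnD subnK // natrN0 // scale0r.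
  have [k ek lek] : exists2 k, (N - lam i = k.+1)%N & (n <= k)%N.
    exact: sub_double_succ (lamn i).
  rewrite ek; apply: (groupM (mulpn _ _ zK _) (mulpn _ _ (cocycle_alt _ _) _)).
    by apply: dvdn_exp2l; apply: leqW.
  by apply: dvdn_trans (dvd_bin2 k); apply: dvdn_exp2l.
have -> : #|gK : M| = #|vert_group gK : vert_group M|.
  apply/eqP; rewrite -(eqn_pmul2l (cardG_gt0 M)) Lagrange // -{1}(card_vert M).
  by rewrite -[vert M]/(gval (vert_group M)) (Lagrange sZ) card_vert.
by rewrite (card_rel_complements sZ sZA nMA abA hA genA relA ordA) card_ord.
Qed.

End Fiber.

Theorem count_model :
  #|[set C : {group mod} | normal C E & #|E : C| == (p ^ n)%N]| =
  (\sum_(u in pairs p N d n) weight u)%N.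
Proof.
rewrite -sum1_card (partition_big pair_of (fun u => u \in pairs p N d n)) /=; last first.
  by move=> C; rewrite in_set => /andP [nC /eqP iC]; apply: pair_of_in.
apply: eq_bigr => [[L M]] LM; rewrite /weight /= -(card_fiber_model LM) -sum1_card.
by apply: eq_bigl => C; rewrite !in_set -andbA.
Qed.

End ModelCount.

(** * Identities for Gaussian binomials *)

Section QBinom.

Variables (K : fieldType) (q : K).
Hypotheses (q0 : q != 0) (q1 : forall k, q ^+ k.+1 != 1).

Definition qfact n := \prod_(k < n) (q ^+ k.+1 - 1).

Lemma qfact_neq0 n : qfact n != 0.
Proof. by apply/prodf_neq0 => k _; rewrite subr_eq0. Qed.

Lemma qfactS n : qfact n.+1 = qfact n * (q ^+ n.+1 - 1).
Proof. by rewrite /qfact big_ord_recr. Qed.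

Lemma qbinom_fact a b : qbinom q (a + b) b = qfact (a + b) / (qfact b * qfact a).
Proof.
elim: b => [|b IH]; first by rewrite addn0 qbinomn0 /qfact big_ord0 mul1r divff ?qfact_neq0.
have h := qbinom_rec (a + b) q0 (q1 b); rewrite addnS.
have d0 : q ^+ b.+1 - 1 != 0 by rewrite subr_eq0.
apply: (mulIf d0); rewrite h IH !qfactS; field.
by rewrite !qfact_neq0 d0.
Qed.

Lemma qbinom_nn n : qbinom q n n = 1.
Proof. by rewrite -{1}[n]add0n qbinom_fact /qfact !big_ord0 add0n mulr1 divff ?qfact_neq0. Qed.

Lemma qbinom_sym a b : (b <= a)%N -> qbinom q a (a - b) = qbinom q a b.
Proof.
move=> h; have [c ->] : exists c, a = (c + b)%N by exists (a - b)%N; rewrite subnK.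
by rewrite addnK [in RHS]qbinom_fact {1}addnC qbinom_fact addnC [qfact b * _]mulrC.
Qed.

(** Two-step flags, counted from either end. *)
Lemma qbinom_trinom a b c : (a <= b)%N -> (b <= c)%N ->
  qbinom q b a * qbinom q c b = qbinom q c a * qbinom q (c - a) (b - a).
Proof.
move=> ab bc; have [k ek] : exists k, b = (k + a)%N by exists (b - a)%N; rewrite subnK.
have [l el] : exists l, c = (l + b)%N by exists (c - b)%N; rewrite subnK.
have -> : (c - a = l + k)%N by rewrite el ek addnA addnK.
have -> : (b - a = k)%N by rewrite ek addnK.
rewrite {1}ek el qbinom_fact (_ : l + b = l + k + a)%N ?ek ?addnA // [RHS]mulrC.
rewrite !qbinom_fact -addnA qbinom_fact.
by field; rewrite !qfact_neq0.
Qed.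

Lemma qbinom_pascal n m :
  qbinom q n.+1 m.+1 = q ^+ m.+1 * qbinom q n m.+1 + qbinom q n m.
Proof.
have [lt|le] := ltnP n m.
  by rewrite !qbinom_small ?mulr0 ?addr0 //; lia.
have [k ->] : exists k, n = (k + m)%N by exists (n - m)%N; rewrite subnK.
case: k => [|k]; first by rewrite add0n [qbinom q m m.+1]qbinom_small // !qbinom_nn mulr0 add0r.
have -> : (k.+1 + m).+1 = (k.+1 + m.+1)%N by rewrite addnS.
rewrite !qbinom_fact [X in _ * qbinom q X _](_ : _ = k + m.+1)%N; last by rewrite addnS.
rewrite qbinom_fact !addnS !addSn !qfactS.
have kn j : q ^+ j.+1 - 1 != 0 by rewrite subr_eq0.
have e : q ^+ (k + m).+2 = q ^+ k.+1 * q ^+ m.+1 by rewrite -exprD addSn addnS.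
have k1 := kn k; have m1 := kn m; rewrite e.
move: (q ^+ k.+1) (q ^+ m.+1) (q ^+ (k + m).+1) k1 m1 => x y z k1 m1.
by field; rewrite !qfact_neq0 k1 m1.
Qed.

(** A finite form of the q-binomial theorem. By the q-Pascal rule the m-th term
    for n passes on the fraction q ^ m * T of itself to the m-th term for n + 1 and
    the fraction 1 - q ^ m * T to the next one, so the sum does not depend on n. *)
Lemma qbinom_sum1 n (T : K) :
  \sum_(m < n.+1) qbinom q n m * T ^+ (n - m) * \prod_(k < m) (1 - q ^+ k * T) = 1.
Proof.
elim: n => [|n IH]; first by rewrite big_ord1 qbinomn0 big_ord0 !mulr1.
rewrite -[RHS]IH big_ord_recl qbinomn0 subn0 big_ord0 mulr1 mul1r.
set c := fun m => \prod_(k < m) (1 - q ^+ k * T).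
transitivity (T ^+ n.+1 + \sum_(m < n.+1) (q ^+ m.+1 * qbinom q n m.+1 * T ^+ (n - m) * c m.+1
   + qbinom q n m * T ^+ (n - m) * c m.+1)).
  by congr (_ + _); apply: eq_bigr => m _; rewrite lift0 qbinom_pascal subSS !mulrDl.
rewrite big_split /= addrA big_ord_recr /= [qbinom q n n.+1]qbinom_small // mulr0 !mul0r addr0.
have -> : T ^+ n.+1 + \sum_(m < n) q ^+ m.+1 * qbinom q n m.+1 * T ^+ (n - m) * c m.+1 =
   \sum_(m < n.+1) q ^+ m * qbinom q n m * T ^+ (n - m).+1 * c m.
  rewrite [RHS]big_ord_recl qbinomn0 /c big_ord0 subn0 expr0 !mulr1 mul1r; congr (_ + _).
  apply: eq_bigr => m _; rewrite lift0 subnSK //.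
rewrite -big_split /=; apply: eq_bigr => m _; rewrite /c big_ord_recr /= exprS.
by ring.
Qed.

End QBinom.

(** * Sums over index sets and the functions F_n *)

Section SublistSums.

Variable K : nmodType.

(** The recursion peels off the smallest element of an index set, which is how
    the sums over sets of integers are used below. *)
Fixpoint sumsub (T : Type) (l : seq T) (f : seq T -> K) : K :=
  if l is x :: l' then sumsub l' f + sumsub l' (fun s => f (x :: s)) else f [::].

Lemma sumsub_map (T T' : Type) (g : T -> T') l (f : seq T' -> K) :
  sumsub (map g l) f = sumsub l (fun s => f (map g s)).
Proof. by elim: l f => [|x l IH] f //=; rewrite !IH. Qed.

Lemma eq_sumsub (T : eqType) (l : seq T) (f g : seq T -> K) :
  (forall s, subseq s l -> f s = g s) -> sumsub l f = sumsub l g.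
Proof.
elim: l f g => [|x l IH] f g h /=; first exact: h.
congr (_ + _); apply: IH => s hs; apply: h; last by rewrite /= eqxx.
by apply: subseq_trans hs (subseq_cons _ _).
Qed.

Lemma sumsub0 (T : Type) (l : seq T) : sumsub l (fun=> 0) = 0 :> K.
Proof. by elim: l => //= x l ->; rewrite addr0. Qed.

Lemma sumsub_sum (T : Type) (I : Type) (r : seq I) (P : pred I) (l : seq T) (F : I -> seq T -> K) :
  sumsub l (fun s => \sum_(i <- r | P i) F i s) = \sum_(i <- r | P i) sumsub l (F i).
Proof.
elim: l F => [|x l IH] F //=; rewrite IH (IH (fun i s => F i (x :: s))).
by rewrite big_split.
Qed.

Lemma sumsub_iota a k (f : seq nat -> K) :
  sumsub (iota a k) f =
  f [::] + \sum_(a <= c < a + k) sumsub (iota c.+1 (a + k - c.+1)) (fun s => f (c :: s)).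
Proof.
elim: k a f => [|k IH] a f; first by rewrite addn0 big_geq ?addr0.
rewrite /= (IH a.+1 f) addnS -addSn [in RHS]big_ltn ?leq_addr // -addrA; congr (_ + _).
by rewrite addrC; congr (_ + _); rewrite addKn.
Qed.

Definition open_itv a b := iota a.+1 (b - a).-1.

Lemma subseq_open_itv s a b : subseq s (open_itv a b) -> path ltn a s /\ all (ltn^~ b) s.
Proof.
move=> h; split.
  apply: (subseq_path (fun _ _ _ => @ltn_trans _ _ _) h).
  by have := iota_ltn_sorted a (b - a).-1.+1.
by apply/allP => x /(mem_subseq h); rewrite mem_iota /= => /andP []; lia.
Qed.

Lemma sumsub_open_itv a b (f : seq nat -> K) :
  sumsub (open_itv a b) f = f [::] + \sum_(a.+1 <= c < b) sumsub (open_itv c b) (fun s => f (c :: s)).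
Proof.
rewrite /open_itv sumsub_iota; congr (_ + _).
case: (ltnP a b) => [lt|le]; last by rewrite !big_geq //; lia.
have -> : (a.+1 + (b - a).-1 = b)%N by lia.
by apply: eq_big_nat => c _; congr (sumsub (iota _ _) _); lia.
Qed.

Lemma sum_filter_sets (T : finType) (l : seq T) (F : seq T -> K) : uniq l ->
  \sum_(I : {set T} | I \subset l) F [seq x <- l | x \in I] = sumsub l F.
Proof.
elim: l F => [|x l IH] F /=.
  move=> _; rewrite (big_pred1 (finset.set0 : {set T})) // => I.
  apply/idP/eqP => [/subsetP h|->]; last by apply/subsetP => y; rewrite in_set0.
  by apply/setP => y; rewrite in_set0; apply/negP => /h.
move=> /andP [xl ul]; rewrite (bigID (fun I : {set T} => x \notin I)) /=; congr (_ + _).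
  rewrite -IH //; apply: eq_big => I.
    apply/andP/idP => [[/subsetP h nx]|/subsetP h].
      apply/subsetP => y yI; have := h y yI; rewrite inE => /orP [/eqP e|//].
      by rewrite -e yI in nx.
    split; last by apply: contra xl => /h.
    by apply/subsetP => y /h yl; rewrite inE yl orbT.
  by move=> /andP [_ /negbTE ->].
rewrite -IH // (reindex_onto (fun J : {set T} => x |: J) (fun I => I :\ x)) /=; last first.
  by move=> I /andP [_]; rewrite negbK => /setD1K.
apply: eq_big => J.
  rewrite !inE eqxx /= andbT; apply/andP/idP => [[/subsetP h /eqP e]|/subsetP h].
    apply/subsetP => y yJ; have := h y; rewrite !inE yJ orbT => /(_ isT) /orP [/eqP ey|//].
    by move: yJ; rewrite -e ey !inE eqxx.
  split; first by apply/subsetP => y; rewrite !inE => /orP [->|/h ->] //; rewrite orbT.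
  by apply/eqP/setU1K; apply: contra xl => /h.
move=> /andP [_ /eqP e]; rewrite !inE eqxx /=; congr (F (_ :: _)).
apply: eq_in_filter => y yl; rewrite !inE.
by case: eqP yl xl => // -> ->.
Qed.

Lemma sum_sub_pos n (F : seq nat -> K) :
  \sum_(I : {set 'I_n.+1} | sub_pos I) F (elts I) = sumsub (iota 1 n) F.
Proof.
pose l := [seq lift ord0 i | i <- enum 'I_n].
have el : enum 'I_n.+1 = ord0 :: l by rewrite enum_ordSl.
have ul : uniq l by have := enum_uniq 'I_n.+1; rewrite el => /andP [].
have -> : iota 1 n = map val l.
  by have := val_enum_ord n.+1; rewrite el /= => -[].
rewrite sumsub_map -(sum_filter_sets _ ul).
apply: eq_big => I.
  apply/idP/subsetP => [h x xI|h].
    have : x \in enum 'I_n.+1 by rewrite mem_enum.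
    rewrite el inE => /orP [/eqP e|//]; by rewrite /sub_pos -e xI in h.
  apply/negP => /h; have := enum_uniq 'I_n.+1.
  by rewrite el /= => /andP [/negP].
move=> h; rewrite /elts; congr (F (map _ _)).
have -> : enum I = filter (mem I) (enum 'I_n.+1).
  by rewrite -[enum 'I_n.+1]/(filter predT _) -filter_predI; apply: eq_filter => x; rewrite /= andbT.
by rewrite el /= (negbTE h).
Qed.

End SublistSums.

Section Flags.

Variables (K : numFieldType) (p : nat).
Hypothesis p_gt1 : (1 < p)%N.
Local Notation q := (p%:R^-1 : K).

Lemma q_neq0 : q != 0.
Proof. by rewrite invr_eq0 pnatr_eq0 -lt0n ltnW. Qed.

Lemma p_exp_neq1 k : (p%:R : K) ^+ k.+1 != 1.
Proof. by rewrite -natrX pnatr_eq1 -(expn0 p) eqn_exp2l. Qed.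

Lemma q_exp_neq1 k : q ^+ k.+1 != 1.
Proof. by rewrite exprVn invr_eq1 p_exp_neq1. Qed.

Fixpoint flag_from (a n : nat) (s : seq nat) : K :=
  if s is c :: s' then qbinom q (head n s' - a) (c - a) * flag_from a n s' else 1.

Lemma flag_num_cons n c s :
  flag_num q n (c :: s) = qbinom q (head n s) c * flag_num q n s.
Proof. by rewrite /flag_num /= big_ord_recl /= nth0. Qed.

Lemma flag_from_shift x n s : flag_from x (x + n) (map (addn x) s) = flag_num q n s.
Proof.
elim: s => [|c s IH]; first by rewrite /flag_num big_ord0.
rewrite flag_num_cons -IH /=; congr (qbinom _ _ _ * _); last by rewrite addKn.
by case: s {IH} => [|e s] /=; rewrite addKn.
Qed.

(** Moving the base point of a flag from a to its first step c. *)
Lemma flag_fromE a c n s : (a <= c)%N -> path ltn c s -> all (ltn^~ n) (c :: s) ->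
  flag_from a n (c :: s) = qbinom q (n - a) (c - a) * flag_from c n s.
Proof.
elim: s a c => [|e s IH] a c ac; first by [].
move=> /= /andP [ce es] /and3P [cn en sn].
have -> : qbinom q (head n s - a) (e - a) * flag_from a n s = flag_from a n (e :: s) by [].
have -> : qbinom q (head n s - c) (e - c) * flag_from c n s = flag_from c n (e :: s) by [].
have hall : all (ltn^~ n) (e :: s) by rewrite /= en.
rewrite (IH a e (leq_trans ac (ltnW ce)) es hall) (IH c e (ltnW ce) es hall).
rewrite !mulrA; congr (_ * _).
have := qbinom_trinom q_neq0 q_exp_neq1 (leq_sub2r a (ltnW ce)) (leq_sub2r a (ltnW en)).
have -> : (n - a - (c - a) = n - c)%N by lia.
by have -> : (e - a - (c - a) = e - c)%N by lia.
Qed.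

Definition geom_ratio (Z : nat -> K) c := Z c / (1 - Z c).

Lemma Fab_sumsub x y (Z : nat -> K) : (x < y)%N ->
  Fab p x y Z = sumsub (open_itv x y) (fun s => flag_from x y s * \prod_(c <- s) geom_ratio Z c).
Proof.
move=> xy; rewrite /Fab /Fn.
have -> : open_itv x y = map (addn x) (iota 1 (y - x).-1).
  by rewrite /open_itv -iotaDl addn1.
rewrite sumsub_map -sum_sub_pos; apply: eq_bigr => I _.
have -> : flag_from x y = flag_from x (x + (y - x)) by rewrite subnKC // ltnW.
rewrite flag_from_shift; congr (_ * _).
by rewrite big_map /elts big_map big_enum.
Qed.

(** Peel off the smallest element of the index set. *)
Lemma Fab_rec x y (Z : nat -> K) : (x < y)%N ->
  Fab p x y Z = 1 + \sum_(x.+1 <= c < y) qbinom q (y - x) (c - x) * geom_ratio Z c * Fab p c y Z.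
Proof.
move=> xy; rewrite Fab_sumsub // sumsub_open_itv /= big_nil mulr1; congr (_ + _).
apply: eq_big_nat => c /andP [xc cy]; rewrite Fab_sumsub //.
have L (T : Type) (l : seq T) (f : seq T -> K) a : a * sumsub l f = sumsub l (fun s => a * f s).
  by elim: l f => [|z l IH] f //=; rewrite mulrDr !IH.
rewrite L; apply: eq_sumsub => s /subseq_open_itv [ps sy].
rewrite -[qbinom _ (head y s - x) _ * _]/(flag_from x y (c :: s)).
rewrite (flag_fromE (ltnW xc) ps) /= ?cy // big_cons.
by ring.
Qed.

Lemma eq_Fab x y (Z Z' : nat -> K) : (x < y)%N -> (forall c, (x < c < y)%N -> Z c = Z' c) ->
  Fab p x y Z = Fab p x y Z'.
Proof.
move=> xy h; rewrite !Fab_sumsub //; apply: eq_sumsub => s /subseq_open_itv [ps sy].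
congr (_ * _); apply: eq_big_seq => c cs; rewrite /geom_ratio h //.
have /= -> := allP sy c cs.
by have /= -> := allP (order_path_min (fun _ _ _ => @ltn_trans _ _ _) ps) c cs.
Qed.

End Flags.

(** * The linear system and its solution by lattice paths *)

Section PhiFacts.

Variable d : nat.
Local Notation D := 'C(d, 2).

Lemma phiE i : (i <= d)%N -> phi d i = (D - 'C(d - i, 2))%N.
Proof. by move=> h; rewrite -(phi_compl h) addnK. Qed.

Lemma phi_leD i : (i <= d)%N -> (phi d i <= D)%N.
Proof. by move=> h; rewrite phiE // leq_subr. Qed.

Lemma phi_mono i i' : (i <= i')%N -> (i' <= d)%N -> (phi d i <= phi d i')%N.
Proof.
move=> h h'; rewrite !phiE ?(leq_trans h) //; apply: leq_sub2l.
by apply: leq_bin2l; apply: leq_sub2l.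
Qed.

Lemma phi_lt i i' : (i < i')%N -> (i' < d)%N -> (phi d i < phi d i')%N.
Proof.
move=> h h'; rewrite !phiE ?(ltnW h') ?(ltnW (ltn_trans h h')) //.
have e : (d - i = (d - i').-1.+2 + (i' - i).-1)%N by lia.
have e' : (d - i' = (d - i').-1.+1)%N by lia.
have l : ('C(d - i', 2) < 'C(d - i, 2))%N.
  apply: leq_trans (_ : 'C((d - i').-1.+2, 2) <= _)%N.
    by rewrite binS {1}e' bin1; lia.
  by rewrite e; apply: leq_bin2l; apply: leq_addr.
have m : ('C(d - i, 2) <= D)%N by apply: leq_bin2l; apply: leq_subr.
by lia.
Qed.

Lemma phi0 : phi d 0 = 0%N. Proof. by rewrite /phi. Qed.

Lemma phi_ltD i : (i <= d)%N -> (phi d i < D)%N -> (i < d.-1)%N.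
Proof.
move=> h; rewrite phiE //; case: (ltnP i d.-1) => // le.
have : (d - i < 2)%N by lia.
by move=> /bin_small ->; rewrite subn0 ltnn.
Qed.

Lemma phi_gt0 i : (0 < i)%N -> (i <= d)%N -> (1 < d)%N -> (0 < phi d i)%N.
Proof.
move=> i0 h d1; apply: leq_trans (phi_mono i0 h).
by rewrite -phi0; apply: phi_lt.
Qed.

End PhiFacts.

Section Chains.

Variable K : comNzRingType.

(** Unroll v along its own recursion until w is used, at y say: V x y sums the
    weights of all chains from x to y. *)
Lemma chain_solve (P : pred nat) (beta V : nat -> nat -> K) (Z w v : nat -> K) (b : nat) a :
  (forall x, (a <= x <= b)%N ->
     v x = \sum_(x.+1 <= y < b.+1 | P y) beta y x * (Z y * v y + w y)) ->
  (forall x y, (a <= x)%N -> (x < y <= b)%N -> P y ->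
     V x y = beta y x + \sum_(x.+1 <= c < y) beta c x * Z c * V c y) ->
  (forall c y, (c < y <= b)%N -> P y -> P c) ->
  forall x, (a <= x <= b)%N -> v x = \sum_(x.+1 <= y < b.+1 | P y) V x y * w y.
Proof.
move=> hv hV hP x; have [n] := ubnP (b - x); elim: n x => // n IH x hn /andP [ax xb].
rewrite hv ?ax //.
transitivity (\sum_(x.+1 <= y < b.+1 | P y) beta y x * w y +
  \sum_(x.+1 <= c < b.+1 | P c) \sum_(x.+1 <= y < b.+1 | P y && (c < y)%N)
     beta c x * Z c * (V c y * w y)).
  rewrite -big_split /= big_nat_cond [RHS]big_nat_cond.
  apply: eq_bigr => c /andP [/andP [xc cb] Pc].
  have cb' : (c <= b)%N by rewrite -ltnS.
  have hc : (a <= c <= b)%N by rewrite cb' (leq_trans ax (ltnW xc)).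
  have hs : (b - c < n)%N by lia.
  rewrite (IH c hs hc) mulrDr addrC; congr (_ + _).
  rewrite mulrA mulr_sumr (big_nat_widenl _ x.+1) //; last exact: leqW.
rewrite (exchange_big_dep_nat P) /=; last by move=> c y _ _ _ /andP [].
rewrite -big_split /= big_nat_cond [RHS]big_nat_cond.
apply: eq_bigr => y /andP [/andP [xy yb] Py].
have yb' : (y <= b)%N by rewrite -ltnS.
have xyb : (x < y <= b)%N by rewrite xy yb'.
rewrite (hV x y ax xyb Py) mulrDl; congr (_ + _); rewrite mulr_suml.
rewrite [RHS](big_nat_widen _ _ b.+1) //; last exact: ltnW.
rewrite big_nat_cond [RHS]big_nat_cond; apply: eq_big => c; last first.
  by move=> _; rewrite mulrA.
case: (x < c < b.+1)%N => //=; rewrite Py /= andbC.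
case cy: (c < y)%N => //=; apply: (hP c y) => //.
by rewrite cy yb'.
Qed.

End Chains.

Section Paths.

Variables (K : numFieldType) (p d : nat) (t : K) (u : nat -> nat -> K).
Hypotheses (p_gt1 : (1 < p)%N) (d_gt1 : (1 < d)%N).
Local Notation D := 'C(d, 2).
Local Notation q := (p%:R^-1 : K).

Definition Wnum i j : K := (wcoef p d i j)%:R * t ^+ wt d i j.
Definition Wrow i : nat -> K := Wnum i.
Definition Wcol j : nat -> K := fun i => Wnum i j.

Hypothesis u_bot : u d D = 1.
Hypothesis Wneq1 : forall i j, (i <= d)%N -> (phi d i <= j)%N -> (j <= D)%N ->
  (0 < wt d i j)%N -> 1 - Wnum i j != 0.
Hypothesis u_rec : forall i j, (i <= d)%N -> (phi d i <= j)%N -> (j <= D)%N ->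
  (0 < wt d i j)%N ->
  u i j = Wnum i j * \sum_(i' < d.+1) \sum_(j' < D.+1 | (phi d i' <= j')%N)
     Bcoef p d K i j i' j' * u i' j'.

(** The part of the linear system that comes from the moves raising i only. *)
Definition i_moves i j : K := \sum_(i.+1 <= i' < d.+1 | (phi d i' <= j)%N) qbinom q i' i * u i' j.
(** The part of the linear system that comes from the moves raising j, whether or
    not i is raised as well. *)
Definition j_moves i j : K :=
  \sum_(j.+1 <= j' < D.+1) qbinom q (j' - phi d i) (j - phi d i) * (u i j' + i_moves i j').
Local Notation U i j := (Wnum i j / (1 - Wnum i j)).

Lemma inner_sum i j : (i <= d)%N ->
  \sum_(i' < d.+1 | (phi d i' <= j)%N) qbinom q i' i * u i' j =
  if (phi d i <= j)%N then u i j + i_moves i j else 0.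
Proof.
move=> hi; rewrite -(big_mkord (fun i' => phi d i' <= j)%N (fun i' => qbinom q i' i * u i' j)).
rewrite (big_cat_nat (leq0n i) (leqW hi)) /= big_nat_cond big1 ?add0r; last first.
  by move=> i' /andP [/andP [_ h] _]; rewrite qbinom_small ?mul0r.
rewrite big_ltn_cond ?ltnS // -/(i_moves i j).
case: ifP => h; first by rewrite (qbinom_nn (q_neq0 K p_gt1) (q_exp_neq1 K p_gt1)) mul1r.
rewrite /i_moves big_nat_cond big1 // => i' /andP [/andP [h1 h2] h3].
have : (phi d i <= phi d i')%N by apply: phi_mono; rewrite ?(ltnW h1).
by move=> h4; rewrite (leq_trans h4 h3) in h.
Qed.

Lemma double_sum i j : (i <= d)%N -> (phi d i <= j)%N -> (j <= D)%N ->
  \sum_(i' < d.+1) \sum_(j' < D.+1 | (phi d i' <= j')%N) Bcoef p d K i j i' j' * u i' j' =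
  u i j + i_moves i j + j_moves i j.
Proof.
move=> hi hp hj.
rewrite (exchange_big_dep xpredT) //=.
transitivity (\sum_(j' < D.+1) qbinom q (j' - phi d i) (j - phi d i) *
   (if (phi d i <= j')%N then u i j' + i_moves i j' else 0)).
  apply: eq_bigr => j' _; rewrite -inner_sum // mulr_sumr; apply: eq_bigr => i' _.
  by rewrite /Bcoef mulrA [qbinom _ i' i * _]mulrC.
rewrite -(big_mkord xpredT (fun j' => qbinom q (j' - phi d i) (j - phi d i) *
   (if (phi d i <= j')%N then u i j' + i_moves i j' else 0))).
rewrite (big_cat_nat (leq0n j) (leqW hj)) /= big_nat_cond big1 ?add0r; last first.
  move=> j' /andP [/andP [_ h] _]; case: ifP => h'; last by rewrite mulr0.
  by rewrite qbinom_small ?mul0r //; apply: ltn_sub2r => //; apply: leq_ltn_trans h.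
rewrite big_ltn ?ltnS // hp (qbinom_nn (q_neq0 K p_gt1) (q_exp_neq1 K p_gt1)) mul1r; congr (_ + _).
apply: eq_big_nat => j' /andP [h _].
by rewrite (leq_trans hp (ltnW h)).
Qed.

Lemma u_split i j : (i <= d)%N -> (phi d i <= j)%N -> (j <= D)%N -> (0 < wt d i j)%N ->
  u i j = U i j * (i_moves i j + j_moves i j).
Proof.
move=> hi hp hj h0; have w1 := Wneq1 hi hp hj h0.
have e := u_rec hi hp hj h0; rewrite double_sum // -addrA in e.
apply: (mulfI w1); rewrite mulrA mulrCA mulfV // mulr1 mulrBl mul1r.
by rewrite {1}e mulrDr addrAC subrr add0r.
Qed.

Lemma wt_gt0l i j : (i < d)%N -> (0 < wt d i j)%N.
Proof. by move=> h; rewrite /wt addn_gt0 subn_gt0 h. Qed.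

Lemma wt_gt0r i j : (j < D)%N -> (0 < wt d i j)%N.
Proof. by move=> h; rewrite /wt addn_gt0 !subn_gt0 h orbT. Qed.

(** A run of moves in j along the row i; the factor (1 - W)^-1 = 1 + W / (1 - W)
    accounts for stopping at j' before the next move in i. *)
Lemma j_moves_chain i j : (i < d)%N -> (phi d i <= j <= D)%N ->
  j_moves i j = \sum_(j.+1 <= j' < D.+1) qbinom q (j' - phi d i) (j - phi d i) *
     Fab p j j' (Wrow i) * ((1 - Wnum i j')^-1 * i_moves i j').
Proof.
move=> hi; have hid := ltnW hi.
apply: (@chain_solve K predT (fun y x => qbinom q (y - phi d i) (x - phi d i))
   (fun x y => qbinom q (y - phi d i) (x - phi d i) * Fab p x y (Wrow i))
   (fun y => U i y) (fun y => (1 - Wnum i y)^-1 * i_moves i y) (j_moves i) D (phi d i)) => //.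
  move=> x /andP [hx hxD]; apply: eq_big_nat => y /andP [xy yD].
  have hy : (phi d i <= y)%N by apply: leq_trans hx (ltnW xy).
  have yD' : (y <= D)%N by rewrite -ltnS.
  have w0 := wt_gt0l y hi; have w1 := Wneq1 hid hy yD' w0.
  rewrite u_split //; congr (_ * _).
  by field.
move=> x y hx /andP [xy yD] _; rewrite {1}Fab_rec // mulrDr mulr1; congr (_ + _).
rewrite mulr_sumr; apply: eq_big_nat => c /andP [xc cy].
have := qbinom_trinom (q_neq0 K p_gt1) (q_exp_neq1 K p_gt1)
  (leq_sub2r (phi d i) (ltnW xc)) (leq_sub2r (phi d i) (ltnW cy)).
have -> : (y - phi d i - (x - phi d i) = y - x)%N by lia.
have -> : (c - phi d i - (x - phi d i) = c - x)%N by lia.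
rewrite /geom_ratio /Wrow => e.
transitivity (qbinom q (y - phi d i) (x - phi d i) * qbinom q (y - x) (c - x) * U i c * Fab p c y (Wnum i)).
  by ring.
by rewrite -e; ring.
Qed.

(** A run of moves in i along the column j. *)
Lemma i_moves_chain i j : (i <= d)%N -> (j < D)%N ->
  i_moves i j = \sum_(i.+1 <= i' < d.+1 | (phi d i' <= j)%N) qbinom q i' i *
     Fab p i i' (Wcol j) * (U i' j * j_moves i' j).
Proof.
move=> hi hj.
apply: (@chain_solve K (fun i' => phi d i' <= j)%N (fun y x => qbinom q y x)
   (fun x y => qbinom q y x * Fab p x y (Wcol j))
   (fun y => U y j) (fun y => U y j * j_moves y j) (i_moves ^~ j) d 0%N) => //.
- move=> x _; rewrite /i_moves big_nat_cond [RHS]big_nat_cond; apply: eq_bigr => y /andP [/andP [xy yd] hy].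
  have yd' : (y <= d)%N by rewrite -ltnS.
  by rewrite (u_split yd' hy (ltnW hj) (wt_gt0r y hj)) mulrDr.
- move=> x y _ /andP [xy yD] _; rewrite {1}Fab_rec // mulrDr mulr1; congr (_ + _).
  rewrite mulr_sumr; apply: eq_big_nat => c /andP [xc cy].
  have e := qbinom_trinom (q_neq0 K p_gt1) (q_exp_neq1 K p_gt1) (ltnW xc) (ltnW cy).
  rewrite /geom_ratio /Wcol.
  transitivity (qbinom q y x * qbinom q (y - x) (c - x) * U c j * Fab p c y (Wcol j)); first by ring.
  by rewrite -e; ring.
- move=> c y /andP [cy yd]; apply: leq_trans; apply: phi_mono => //; exact: ltnW.
Qed.

(** The quotient of the zeta functions of the free abelian groups of ranks d
    and i. *)
Definition zpart i : K := \prod_(i <= k < d) (1 - p%:R ^+ k * t)^-1.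

Lemma Wnum_last_column i : (i <= d)%N -> Wnum i D = p%:R ^+ (i * (d - i)) * t ^+ (d - i).
Proof. by move=> hi; rewrite /Wnum /wcoef /wt subnn mul0n !addn0 natrX. Qed.

Lemma zfactor_neq0 k : (k < d)%N -> 1 - p%:R ^+ k * t != 0.
Proof.
move=> hk; have := Wneq1 (ltnW hk) (phi_leD (ltnW hk)) (leqnn D) (wt_gt0l _ hk).
rewrite Wnum_last_column ?(ltnW hk) // exprM -exprMn !subr_eq0; apply: contra => /eqP <-.
by rewrite expr1n.
Qed.

(** On the column j = D the system is that of the sublattices of L alone, and
    [qbinom_sum1] shows that the zeta quotients solve it. *)
Lemma last_column i : (i < d)%N ->
  (1 - Wnum i D)^-1 * i_moves i D = qbinom q d i * zpart i.
Proof.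
have gV0 k : j_moves k D = 0 by rewrite /j_moves big_geq.
have q0 := q_neq0 K p_gt1; have q1 := q_exp_neq1 K p_gt1.
have pn0 : (p%:R : K) != 0 by rewrite pnatr_eq0 -lt0n ltnW.
have zrec i' : (i' <= d)%N -> qbinom q d i' * zpart i' =
    \sum_(i' <= k < d.+1) qbinom q k i' * Wnum k D * (qbinom q d k * zpart k).
  move=> hi; have [n en] : exists n, d = (n + i')%N by exists (d - i')%N; rewrite subnK.
  have eS : d.+1 = (n.+1 + i')%N by rewrite en.
  rewrite eS -{3}[i']add0n big_addn addnK big_mkord.
  have zd m : (m <= n)%N -> zpart (m + i') = zpart i' * \prod_(k < m) (1 - p%:R ^+ k * (p%:R ^+ i' * t)).
    move=> hm; have hmi : (m + i' <= d)%N by rewrite en leq_add2r.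
    rewrite /zpart (big_cat_nat (leq_addl m i') hmi) /= mulrAC.
    have -> : \prod_(i' <= k < m + i') (1 - p%:R ^+ k * t)^-1 = \prod_(k < m) (1 - p%:R ^+ (k + i') * t)^-1.
      by rewrite -{1}[i']add0n big_addn addnK big_mkord.
    rewrite -big_split /= [X in _ = X * _]big1 ?mul1r // => k _.
    rewrite mulrA -exprD mulVf // zfactor_neq0 //.
    by apply: leq_trans hmi; rewrite ltn_add2r.
  transitivity (qbinom q d i' * zpart i' * \sum_(m < n.+1) qbinom p%:R n m * (p%:R ^+ i' * t) ^+ (n - m) *
     \prod_(k < m) (1 - p%:R ^+ k * (p%:R ^+ i' * t))).
    by rewrite (qbinom_sum1 pn0 (p_exp_neq1 K p_gt1)) mulr1.
  rewrite mulr_sumr; apply: eq_bigr => m _.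
  have hm : (m <= n)%N by rewrite -ltnS.
  have hmi : (m + i' <= d)%N by rewrite en leq_add2r.
  rewrite zd // Wnum_last_column // (qbinom_inv pn0 hm).
  have := qbinom_trinom q0 q1 (leq_addl m i') hmi.
  have -> : (d - i' = n)%N by rewrite en addnK.
  rewrite addnK => e.
  have -> : (d - (m + i') = n - m)%N by rewrite en; lia.
  rewrite [in RHS]mulnDl exprD exprMn -exprM.
  transitivity (qbinom q d i' * qbinom q n m * (zpart i' * p%:R ^+ (m * (n - m)) * p%:R ^+ (i' * (n - m)) * t ^+ (n - m)
     * \prod_(k < m) (1 - p%:R ^+ k * (p%:R ^+ i' * t)))); first by ring.
  by rewrite -e; ring.
have [n] := ubnP (d - i); elim: n i => // n IH i hn hi.
have w1 := Wneq1 (ltnW hi) (phi_leD (ltnW hi)) (leqnn D) (wt_gt0l _ hi).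
have gE : i_moves i D = \sum_(i.+1 <= k < d.+1) qbinom q k i * Wnum k D * (qbinom q d k * zpart k).
  rewrite /i_moves big_nat_cond [RHS]big_nat_cond; apply: eq_big => k.
    by case: (ltnP i k) => //= ik; case: (ltnP k d.+1) => //= kd; rewrite phi_leD.
  move=> /andP [/andP [ik kd] _]; rewrite -mulrA; congr (_ * _).
  move: kd; rewrite ltnS leq_eqVlt => /orP [/eqP ->|kd].
    rewrite u_bot Wnum_last_column // subnn muln0 !expr0 !mul1r.
    by rewrite (qbinom_nn q0 q1) mul1r /zpart big_geq.
  rewrite u_split ?phi_leD ?(ltnW kd) ?wt_gt0l // gV0 addr0 -IH //; last by lia.
  by rewrite mulrA.
apply: (mulfI w1); rewrite mulVKf // mulrBl mul1r {1}zrec ?(ltnW hi) //.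
rewrite big_ltn ?ltnS ?(ltnW hi) // (qbinom_nn q0 q1) mul1r -gE.
by rewrite addrAC subrr add0r.
Qed.

End Paths.

Lemma sumsubZ (K : nzRingType) (T : Type) (l : seq T) (a : K) (f : seq T -> K) :
  a * sumsub l f = sumsub l (fun s => a * f s).
Proof. by elim: l f => [|x l IH] f //=; rewrite mulrDr !IH. Qed.

Section PathSum.

Variables (K : numFieldType) (p d : nat) (t : K) (u : nat -> nat -> K).
Hypotheses (p_gt1 : (1 < p)%N) (d_gt1 : (1 < d)%N).
Local Notation D := 'C(d, 2).
Local Notation q := (p%:R^-1 : K).
Local Notation W := (Wnum p d t).

(** The factor of the lattice path that starts at (i, j) and turns at the corners
    given by I and J. Only lists of the same length occur, by [phi_le]. *)
Fixpoint path_factor i j (I J : seq nat) : K :=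
  match I, J with
  | i' :: I', j' :: J' =>
      qbinom q (head D J' - phi d i') (j' - phi d i') * qbinom q (d - i) (d - i') *
      (W i' j' / ((1 - W i' j') * (1 - W i j'))) *
      Fab p j j' (W i) * Fab p i i' (W ^~ j') * path_factor i' j' I' J'
  | _, _ => Fab p j D (W i) * zpart p d t i
  end.

Hypothesis u_bot : u d D = 1.
Hypothesis Wneq1 : forall i j, (i <= d)%N -> (phi d i <= j)%N -> (j <= D)%N ->
  (0 < wt d i j)%N -> 1 - W i j != 0.
Hypothesis u_rec : forall i j, (i <= d)%N -> (phi d i <= j)%N -> (j <= D)%N ->
  (0 < wt d i j)%N ->
  u i j = W i j * \sum_(i' < d.+1) \sum_(j' < D.+1 | (phi d i' <= j')%N)
     Bcoef p d K i j i' j' * u i' j'.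

Local Notation j_movesu := (j_moves p d u).
Local Notation i_movesu := (i_moves p d u).

(** The binomials that depend on the starting state make these terms the summands
    of [j_moves]; they are 1 at (0, 0). *)
Definition path_term i j (I J : seq nat) : K :=
  if phi_le d I J then
    qbinom q d i * qbinom q (head D J - phi d i) (j - phi d i) * path_factor i j I J
  else 0.

Lemma path_term_cons i j i' j' I J : (i <= i')%N -> (i' <= d)%N ->
  path_term i j (i' :: I) (j' :: J) =
  if (phi d i' <= j')%N then
    qbinom q (j' - phi d i) (j - phi d i) * Fab p j j' (W i) *
    ((1 - W i j')^-1 * (qbinom q i' i * Fab p i i' (W ^~ j') *
       (W i' j' / (1 - W i' j')))) * path_term i' j' I J
  else 0.
Proof.
move=> ii' i'd; rewrite {1}/path_term /=; case: (phi d i' <= j')%N => //=.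
rewrite /path_term; case: (phi_le d I J); last by rewrite mulr0.
have e := qbinom_trinom (q_neq0 K p_gt1) (q_exp_neq1 K p_gt1) ii' i'd.
have s : qbinom q (d - i) (d - i') = qbinom q (d - i) (i' - i).
  have -> : (d - i' = (d - i) - (i' - i))%N by lia.
  have le : (i' - i <= d - i)%N by rewrite leq_sub2r.
  by rewrite -(qbinom_sym (q_neq0 K p_gt1) (q_exp_neq1 K p_gt1) le).
rewrite s invfM.
transitivity (qbinom q d i * qbinom q (d - i) (i' - i) *
  (qbinom q (head D J - phi d i') (j' - phi d i') * qbinom q (j' - phi d i) (j - phi d i) *
   (W i' j' * ((1 - W i' j')^-1 * (1 - W i j')^-1)) * Fab p j j' (W i) *
   Fab p i i' (W ^~ j') * path_factor i' j' I J)); first by ring.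
by rewrite -e; ring.
Qed.

(** From (i, j) a run in j stops at some j'. If j' = D then [last_column] ends the path;
    otherwise a run in i leads to a corner (i', j'), and the path goes on from
    there. As phi i' <= j' < D, this i' is at most d - 2. *)
Lemma j_moves_paths i j : (i < d)%N -> (phi d i <= j < D)%N ->
  j_movesu i j = sumsub (open_itv i d.-1) (fun I => sumsub (open_itv j D) (path_term i j I)).
Proof.
have [n] := ubnP (D - j); elim: n i j => // n IH i j hn hi /andP [hp hj].
have hpD : (phi d i <= j <= D)%N by rewrite hp ltnW.
rewrite (j_moves_chain p_gt1 d_gt1 Wneq1 u_rec hi hpD) big_nat_recr //= addrC.
rewrite sumsub_open_itv; congr (_ + _).
  rewrite (last_column p_gt1 d_gt1 u_bot Wneq1 u_rec hi) sumsub_open_itv /=.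
  rewrite [X in _ = _ + X]big1 ?addr0 => [|c _]; last by rewrite /path_term /= sumsub0.
  by rewrite /path_term /=; ring.
transitivity (\sum_(j.+1 <= j' < D) \sum_(i.+1 <= i' < d.-1 | (phi d i' <= j')%N)
    (qbinom q (j' - phi d i) (j - phi d i) * Fab p j j' (W i) *
    ((1 - W i j')^-1 * (qbinom q i' i * Fab p i i' (W ^~ j') *
       (W i' j' / (1 - W i' j')))) *
     sumsub (open_itv i' d.-1) (fun I => sumsub (open_itv j' D) (path_term i' j' I)))).
  apply: eq_big_nat => j' /andP [jj' j'D].
  rewrite (i_moves_chain p_gt1 Wneq1 u_rec (ltnW hi) j'D).
  have sumA r (P : pred nat) (a b : K) (f : nat -> K) :
      a * (b * \sum_(k <- r | P k) f k) = \sum_(k <- r | P k) a * (b * f k).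
    by rewrite !mulr_sumr.
  rewrite sumA.
  have dd : (d.-1 <= d.+1)%N by lia.
  rewrite [RHS](big_nat_widen _ _ d.+1) // [LHS]big_nat_cond [RHS]big_nat_cond.
  apply: eq_big => i'.
    case: (ltnP i i') => //= ii'; case: (ltnP i' d.+1) => //= i'd.
    case hp' : (phi d i' <= j')%N => //=; symmetry; apply: (@phi_ltD d) => //.
    exact: leq_ltn_trans hp' j'D.
  move=> /andP [/andP [ii' i'd] h].
  have i'd1 : (i' < d.-1)%N by apply: phi_ltD => //; apply: leq_ltn_trans h j'D.
  rewrite (IH i' j'); last 3 first.
  - by lia.
  - by lia.
  - by rewrite h j'D.
  by rewrite -!mulrA.
rewrite (exchange_big_dep_nat xpredT) //=; apply: eq_big_nat => i' /andP [ii' i'd].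
transitivity (sumsub (open_itv i' d.-1) (fun I => \sum_(j.+1 <= j' < D)
    sumsub (open_itv j' D) (fun J => path_term i j (i' :: I) (j' :: J)))); last first.
  by apply: eq_sumsub => I _; rewrite sumsub_open_itv {1}/path_term /= add0r.
rewrite sumsub_sum big_mkcond /=; apply: eq_big_nat => j' _.
case: ifP => h; last first.
  rewrite -[LHS](sumsub0 K (open_itv i' d.-1)); apply: eq_sumsub => I _.
  rewrite -[LHS](sumsub0 K (open_itv j' D)); apply: eq_sumsub => J _.
  by rewrite /path_term /= h.
have i'd' : (i' <= d)%N by apply: leq_trans (ltnW i'd) (leq_pred _).
rewrite sumsubZ; apply: eq_sumsub => I _; rewrite sumsubZ; apply: eq_sumsub => J _.
by rewrite (path_term_cons _ _ _ _ (ltnW ii') i'd') h.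
Qed.

(** At the state (0, 0) no move raises i alone, since phi i > 0 for i > 0. *)
Lemma path_total :
  (1 - W 0 0) * (\sum_(i < d.+1) \sum_(j < D.+1 | (phi d i <= j)%N) u i j) =
  sumsub (iota 1 (d - 2)) (fun I => sumsub (iota 1 (D - 1)) (fun J =>
    if phi_le d I J then path_factor 0 0 I J else 0)).
Proof.
have D0 : (0 < D)%N by rewrite bin_gt0.
have wt0 : (0 < wt d 0 0)%N by apply: wt_gt0r.
have p0 : (phi d 0 <= 0)%N by rewrite phi0.
have dbl := double_sum u p_gt1 (leq0n d) p0 (leq0n D).
have B1 i j : Bcoef p d K 0 0 i j = 1.
  by rewrite /Bcoef phi0 !subn0 /qbinom !big_ord0 mulr1.
have e : \sum_(i < d.+1) \sum_(j < D.+1 | (phi d i <= j)%N) u i j = u 0 0 + i_movesu 0 0 + j_movesu 0 0.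
  rewrite -dbl; apply: eq_bigr => i _; apply: eq_bigr => j _.
  by rewrite B1 mul1r.
have u0 := u_rec (leq0n d) p0 (leq0n D) wt0; rewrite dbl -e in u0.
have gH0 : i_movesu 0 0 = 0.
  rewrite /i_moves big_nat_cond big1 // => i /andP [/andP [i0 id]].
  by rewrite leqNgt phi_gt0.
have -> : (1 - W 0 0) * (\sum_(i < d.+1) \sum_(j < D.+1 | (phi d i <= j)%N) u i j) = j_movesu 0 0.
  by rewrite mulrBl mul1r -u0 e gH0; ring.
rewrite j_moves_paths ?phi0 ?D0 // ?(ltnW d_gt1) //.
have -> : open_itv 0 d.-1 = iota 1 (d - 2) by rewrite /open_itv subn0 -subn2.
have -> : open_itv 0 D = iota 1 (D - 1) by rewrite /open_itv subn0 -subn1.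
apply: eq_sumsub => I _; apply: eq_sumsub => J _.
by rewrite /path_term; case: ifP => // _; rewrite /qbinom !subnn !big_ord0 !mul1r.
Qed.

End PathSum.

(** * The numerical data along a path *)

Section Orders.

Variables (d : nat) (I J : seq nat).
Local Notation D := 'C(d, 2).
Hypothesis d_gt1 : (1 < d)%N.
Hypothesis I_path : path ltn 0 I.
Hypothesis I_lt : all (ltn^~ d.-1) I.
Hypothesis J_path : path ltn 0 (rcons J D).
Hypothesis IJ_size : size I = size J.

Local Notation a r := (nth 0%N (0%N :: I) r).
Local Notation b r := (nth 0%N (0%N :: rcons J D) r).

Lemma nth_path_lt (l : seq nat) x k m : path ltn x l -> (k < m)%N -> (m <= size l)%N ->
  (nth 0%N (x :: l) k < nth 0%N (x :: l) m)%N.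
Proof.
move=> pl km ml.
apply: (sorted_ltn_nth (fun _ _ _ => @ltn_trans _ _ _) 0%N (pl : sorted ltn (x :: l))) => //.
by rewrite inE /=; apply: leq_trans km (leqW ml).
Qed.

Lemma nth_path_le (l : seq nat) x k m : path ltn x l -> (k <= m)%N -> (m <= size l)%N ->
  (nth 0%N (x :: l) k <= nth 0%N (x :: l) m)%N.
Proof.
move=> pl; rewrite leq_eqVlt => /orP [/eqP ->|km ml]; first by rewrite leqnn.
exact/ltnW/nth_path_lt.
Qed.

(** In this range neither the smallest nor the largest element of the extended
    order is involved, and phi is strictly increasing. *)
Lemma prec_phiP i j : (0 < i < d)%N -> (0 < j < D)%N ->
  reflect (exists2 r, (r < size I)%N & (i <= a r.+1)%N && (b r.+1 <= j)%N)
    (prec_phi d I J i j).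
Proof.
move=> /andP [i0 id] /andP [j0 jD].
have pi0 : (0 < phi d i)%N by apply: phi_gt0 => //; apply: ltnW.
rewrite /prec_phi /prec_ext /=.
have -> : (inr j == inl 0%N :> nat + nat) || (inr j == inr 0%N :> nat + nat) || (inl (phi d i) == inr D :> nat + nat) = false.
  by rewrite orbF /=; apply/negP => /eqP [] e; rewrite e in j0.
have -> : (inl (phi d i) == inl 0%N :> nat + nat) || (inl (phi d i) == inr 0%N :> nat + nat) || (inr j == inr D :> nat + nat) = false.
  apply/negP => /orP [/orP [/eqP [] e|/eqP //]|/eqP [] e]; first by rewrite e in pi0.
  by rewrite e ltnn in jD.
have bE r : (r < size I)%N -> b r.+1 = nth 0%N J r by move=> hr; rewrite /= nth_rcons -IJ_size hr.
have phiI r : (r < size I)%N -> (phi d i <= nth 0%N [seq phi d k | k <- I] r)%N = (i <= a r.+1)%N.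
  move=> hr; rewrite (nth_map 0%N) //=.
  have /allP /(_ _ (mem_nth 0%N hr)) /= hd := I_lt.
  case: (leqP i (nth 0%N I r)) => h; first by apply: phi_mono => //; lia.
  by apply/negbTE; rewrite -ltnNge phi_lt.
apply: (iffP existsP) => [[r]|[r hr]].
  have hr : (r < size I)%N by have := ltn_ord r; rewrite {2}size_map.
  by rewrite phiI // -bE //; exists (r : nat).
rewrite -[nth 0%N I r]/(a r.+1) -[nth 0%N (rcons J D) r]/(b r.+1) -(phiI _ hr) bE // => h.
have hr' : (r < size [seq phi d k | k <- I])%N by rewrite size_map.
by exists (Ordinal hr').
Qed.

Lemma b_lt r : (r <= size I)%N -> (b r < D)%N.
Proof.
move=> hr; have e : b (size I).+1 = D by rewrite IJ_size /= nth_rcons ltnn eqxx.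
rewrite -[X in (_ < X)%N]e.
by apply: nth_path_lt => //; rewrite size_rcons -IJ_size.
Qed.

Lemma b_gt0 r : (r < size I)%N -> (0 < b r.+1)%N.
Proof. by move=> hr; rewrite (@nth_path_lt _ 0 0 r.+1 J_path) // size_rcons -IJ_size; apply: ltnW. Qed.

Lemma a_lt r : (r <= size I)%N -> (a r < d.-1)%N.
Proof.
case: r => [|r] hr /=; first by rewrite -ltnS prednK // ltnW.
by have /allP /(_ _ (mem_nth 0%N hr)) := I_lt.
Qed.

Lemma bigmin_eq (s : seq nat) (P : pred nat) n m : m \in rcons s n -> P m ->
  (m <= n)%N -> (forall k, k \in rcons s n -> P k -> (m <= k)%N) ->
  \big[minn/n]_(k <- rcons s n | P k) k = m.
Proof.
move=> ms Pm mn h; apply/eqP; rewrite eqn_leq; apply/andP; split.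
  elim: (rcons s n) ms => // x l IH; rewrite inE big_cons => /orP [/eqP <-|/IH le].
    by rewrite Pm geq_minl.
  by case: ifP => // _; apply: leq_trans le; apply: geq_minr.
rewrite big_seq_cond; elim/big_rec: _ => // k x /andP [ks Pk] mx.
by rewrite leq_min mx h.
Qed.

(** The elements of J above phi i are those from the r-th on. *)
Lemma j_of_eq r i : (r < size I)%N -> (a r < i <= a r.+1)%N ->
  j_of d I J i = b r.+1.
Proof.
move=> hr /andP [h1 h2].
have id1 : (i < d.-1)%N by apply: leq_ltn_trans h2 (a_lt hr).
have id : (0 < i < d)%N by apply/andP; split; lia.
have bD := b_lt hr; have b0 := b_gt0 hr.
apply: bigmin_eq => //.
- by rewrite /= mem_nth // size_rcons -IJ_size ltnW.
- apply/prec_phiP => //; first by rewrite b0 bD.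
  by exists r; rewrite // h2 leqnn.
- exact: ltnW.
move=> k; rewrite mem_rcons inE => /orP [/eqP -> _|kJ]; first exact: ltnW.
have kD : (0 < k < D)%N.
  have := allP (order_path_min (fun _ _ _ => @ltn_trans _ _ _) J_path) k.
  rewrite mem_rcons inE kJ orbT => /(_ isT) /= k0; rewrite k0 /=.
  have e := nth_index 0%N kJ; have hk : (index k J < size I)%N by rewrite IJ_size index_mem.
  have := b_lt hk.
  by rewrite /= nth_rcons -IJ_size hk e.
move=> /(prec_phiP id kD) [l hl /andP [h3 h4]]; apply: leq_trans h4.
apply: nth_path_le => //; last by rewrite size_rcons -IJ_size; apply: ltnW.
rewrite ltnS leqNgt; apply/negP => lr.
have := leq_ltn_trans h3 (leq_ltn_trans (nth_path_le I_path lr (ltnW hr)) h1).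
by rewrite ltnn.
Qed.

(** The elements of 0 :: I whose phi lies below j are those up to the r-th. *)
Lemma i_of_eq r j : (r <= size I)%N -> (0 < j)%N -> (b r <= j < b r.+1)%N ->
  i_of d I J j = a r.
Proof.
move=> hr j0 /andP [h1 h2].
have jD : (j < D)%N.
  apply: leq_trans h2 _; case: (ltnP r (size I)) => hr'; first exact/ltnW/b_lt.
  have -> : r = size I by apply/eqP; rewrite eqn_leq hr hr'.
  by rewrite IJ_size /= nth_rcons ltnn eqxx.
have jj : (0 < j < D)%N by rewrite j0 jD.
have prec0 : prec_phi d I J 0 j.
  rewrite /prec_phi /prec_ext phi0 /=.
  case: ifP => // /orP [/eqP [] e|//]; by rewrite e in j0.
apply/eqP; rewrite eqn_leq; apply/andP; split.
  apply/bigmax_leqP_seq => i; rewrite inE => /orP [/eqP -> //|iI].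
  have [i0|i0] := posnP i; first by rewrite i0.
  have idx : (index i I < size I)%N by rewrite index_mem.
  have id : (0 < i < d)%N.
    have := a_lt idx; rewrite /= nth_index // i0 /= => h; lia.
  move=> /(prec_phiP id jj) [k hk /andP [h3 h4]]; apply: leq_trans h3 _.
  apply: nth_path_le => //; rewrite leqNgt; apply/negP => rk.
  have hk' : (k.+1 <= size (rcons J D))%N by rewrite size_rcons -IJ_size; apply: ltnW.
  have := leq_ltn_trans (leq_trans (nth_path_le J_path rk hk') h4) h2.
  by rewrite ltnn.
apply: (@leq_bigmax_seq _ (0%N :: I) (fun i => prec_phi d I J i j) id (a r)) => //.
  by apply: mem_nth; rewrite /= ltnS.
case: r hr h1 h2 => [|r] hr h1 h2; first exact: prec0.
have id : (0 < a r.+1 < d)%N.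
  have := a_lt hr; have := @nth_path_lt _ 0 0 r.+1 I_path isT hr; rewrite /= => -> /= h; lia.
by apply/prec_phiP => //; exists r; rewrite // h1 leqnn.
Qed.

End Orders.

Lemma path_factor_prod (K : numFieldType) (p d : nat) (t : K) i j (I J : seq nat) :
  size I = size J ->
  let a r := nth 0%N (i :: I) r in
  let b r := nth 0%N (j :: rcons J 'C(d, 2)) r in
  let q := p%:R^-1 in
  let W := Wnum p d t in
  path_factor p d t i j I J =
  Fab p (last j J) 'C(d, 2) (W (last i I)) * zpart p d t (last i I) *
  \prod_(r < size I)
    (qbinom q (b r.+2 - phi d (a r.+1)) (b r.+1 - phi d (a r.+1)) *
     qbinom q (d - a r) (d - a r.+1) *
     (W (a r.+1) (b r.+1) / ((1 - W (a r.+1) (b r.+1)) * (1 - W (a r) (b r.+1)))) *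
     Fab p (b r) (b r.+1) (W (a r)) * Fab p (a r) (a r.+1) (W ^~ (b r.+1))).
Proof.
elim: I J i j => [|i' I IH] [|j' J] i j //= => [_|[e]].
  by rewrite big_ord0 mulr1.
rewrite IH // big_ord_recl /=.
have -> : nth 0%N (rcons J 'C(d, 2)) 0 = head 'C(d, 2) J by case: (J).
by rewrite mulrCA mulrA.
Qed.

Section Numerical.

Variables (R : realType) (p : nat).
Hypothesis p_gt0 : (0 < p)%N.
Local Notation C := R[i].

Lemma cexpD (x y : C) : cexp (x + y) = cexp x * cexp y.
Proof.
case: x y => [x1 x2] [y1 y2]; rewrite /cexp /=.
rewrite expRD cosD sinD; apply/eqP; rewrite eq_complex /=; apply/andP; split; apply/eqP; ring.
Qed.

Lemma cexp0 : cexp (0 : C) = 1.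
Proof. by rewrite /cexp /= expR0 cos0 sin0 mul1r. Qed.

Lemma npowD (x y : C) : npow p (x + y) = npow p x * npow p y.
Proof. by rewrite /npow mulrDr cexpD. Qed.

Lemma npow0 : npow p (0 : C) = 1.
Proof. by rewrite /npow mulr0 cexp0. Qed.

Lemma npowMn (x : C) n : npow p (n%:R * x) = npow p x ^+ n.
Proof.
elim: n => [|n IH]; first by rewrite mul0r npow0.
by rewrite -natr1 mulrDl mul1r npowD IH exprSr.
Qed.

Lemma npow_nat n : npow p (n%:R : C) = p%:R ^+ n.
Proof.
rewrite -[n%:R]mulr1 npowMn; congr (_ ^+ n).
rewrite /npow mulr1 /cexp /= cos0 sin0 lnK ?posrE ?ltr0n //.
by rewrite -[(1 +i* 0)%C]/(1 : C) mulr1 rmorph_nat.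
Qed.

Lemma normC_npow (z : C) : `|npow p z| = (expR (ln p%:R * complex.Re z))%:C%C.
Proof.
case: z => x y; rewrite /npow /cexp normrM /=.
rewrite [X in X * _]ger0_norm ?lecR ?expR_ge0 // [X in _ * X]normc_def /=.
by rewrite cos2Dsin2 sqrtr1 mulr1 mul0r subr0.
Qed.

End Numerical.

Section NumericalData.

Variables (R : realType) (d p : nat) (s : R[i]).
Hypotheses (d_gt1 : (1 < d)%N) (p_gt1 : (1 < p)%N).
Local Notation D := 'C(d, 2).
Local Notation t := (npow p (- s)).
Local Notation W := (Wnum p d t).

Lemma numdataE i j : (i <= d)%N -> (phi d i <= j)%N -> (j <= D)%N ->
  numdata d p s i j = W i j.
Proof.
move=> hi hp hj; have p0 := ltnW p_gt1.
rewrite /numdata /Wnum natrX -(npow_nat R p0) -npowMn -npowD; congr (npow p _).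
rewrite /wt /wcoef; move: (phi d i) hp => f hp.
by rewrite !natrD !natrM !natrD !natrB //; ring.
Qed.

Lemma zeta_ZpE n : zeta_Zp p n s = \prod_(0 <= k < n) (1 - p%:R ^+ k * t)^-1.
Proof.
rewrite big_mkord; apply: eq_bigr => k _; rewrite /zeta_p opprB npowD npow_nat //.
exact: ltnW.
Qed.

Lemma zeta_ratio n : (n <= d)%N -> (forall k, (k < d)%N -> 1 - p%:R ^+ k * t != 0) ->
  zeta_Zp p d s * (zeta_Zp p n s)^-1 = zpart p d t n.
Proof.
move=> nd h; rewrite !zeta_ZpE (big_cat_nat (leq0n n) nd) /= mulrAC divff ?mul1r //.
rewrite big_seq_cond; elim/big_rec: _ => [|k x]; first by rewrite oner_eq0.
by rewrite mem_index_iota andbT => /andP [_ kn] x0; rewrite mulf_neq0 // invr_eq0 h // (leq_trans kn).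
Qed.

(** The path with corners (i_r, j_r) runs along the row i_r for j between j_r and
    j_{r+1}, and along the column j_r for i between i_{r-1} and i_r. There [i_of]
    and [j_of] return i_r and j_r, so that the X, Y and Y' are values of W. *)
Lemma A_IJ_path_factor (I J : seq nat) :
  (forall k, (k < d)%N -> 1 - p%:R ^+ k * t != 0) ->
  subseq I (iota 1 (d - 2)) -> subseq J (iota 1 (D - 1)) -> phi_le d I J ->
  zeta_Zp p d s * A_IJ d p s I J = path_factor p d t 0 0 I J.
Proof.
move=> hz sI sJ IJ.
have hsz : size I = size J by apply/eqP; move: IJ; rewrite /phi_le all2E => /andP [].
have eI : iota 1 (d - 2) = open_itv 0 d.-1 by rewrite /open_itv subn0 -subn2.
have eJ : iota 1 (D - 1) = open_itv 0 D by rewrite /open_itv subn0 -subn1.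
have [pI aI] := subseq_open_itv (etrans (congr1 (subseq I) (esym eI)) sI).
have [pJ aJ] := subseq_open_itv (etrans (congr1 (subseq J) (esym eJ)) sJ).
have pJD : path ltn 0 (rcons J D).
  rewrite rcons_path pJ /=; case: (lastP J) aJ => [|J' x]; first by rewrite bin_gt0.
  by rewrite all_rcons last_rcons => /andP [].
set a := fun r => nth 0%N (0%N :: I) r; set b := fun r => nth 0%N (0%N :: rcons J D) r.
have lastI : last 0%N I = a (size I) by rewrite /a (last_nth 0%N).
have lastJ : last 0%N J = b (size I).
  by rewrite /b hsz -rcons_cons nth_rcons ltnSn (last_nth 0%N).
have aD r : (r <= size I)%N -> (a r < d.-1)%N by exact: (a_lt d_gt1 aI).
have aD' r : (r <= size I)%N -> (a r <= d)%N by move/aD; lia.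
have bD r : (r <= size I)%N -> (b r < D)%N by exact: (b_lt pJD hsz).
have ab r : (r <= size I)%N -> (phi d (a r) <= b r)%N.
  case: r => [|r] hr; first by rewrite /a /= phi0.
  rewrite /a /b /= nth_rcons -hsz hr.
  move: IJ; rewrite /phi_le all2E => /andP [_ /all_nthP h].
  have := h (0%N, 0%N) r; rewrite size_zip -hsz minnn => /(_ hr).
  by rewrite nth_zip.
have b_mono k m : (k <= m)%N -> (m <= (size I).+1)%N -> (b k <= b m)%N.
  by move=> km mI; apply: nth_path_le => //; rewrite size_rcons -hsz.
have b_smono k m : (k < m)%N -> (m <= (size I).+1)%N -> (b k < b m)%N.
  by move=> km mI; apply: nth_path_lt => //; rewrite size_rcons -hsz.
have bS r : (r <= size I)%N -> (b r.+1 <= D)%N.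
  rewrite leq_eqVlt => /orP [/eqP -> |/bD/ltnW //].
  by rewrite /b hsz /= nth_rcons ltnn eqxx.
have X_eq r : (r <= size I)%N -> Fab p (b r) (b r.+1) (dataX d p s I J) =
    Fab p (b r) (b r.+1) (W (a r)).
  move=> hr; apply: eq_Fab => // [|c /andP [h1 h2]]; first exact: b_smono.
  rewrite /dataX (@i_of_eq d I J d_gt1 pI aI pJD hsz r) //; last 2 first.
  - exact: leq_ltn_trans h1.
  - by rewrite ltnW.
  rewrite numdataE ?aD' //; first by apply: leq_trans (ab r hr) (ltnW h1).
  by apply: leq_trans (ltnW h2) (bS r hr).
have j_eq r i : (r < size I)%N -> (a r < i <= a r.+1)%N -> j_of d I J i = b r.+1.
  exact: (j_of_eq d_gt1 pI aI pJD hsz).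
have a_smono r : (r < size I)%N -> (a r < a r.+1)%N.
  by move=> hr; apply: nth_path_lt.
have bot1 r : (r < size I)%N -> (phi d (a r) <= b r.+1)%N.
  by move=> hr; apply: leq_trans (ab r (ltnW hr)) (b_mono _ _ (leqnSn r) (leqW hr)).
have Y_eq r : (r < size I)%N -> Fab p (a r) (a r.+1) (dataY d p s I J) =
    Fab p (a r) (a r.+1) (W ^~ (b r.+1)).
  move=> hr; apply: eq_Fab => // [|c /andP [h1 h2]]; first exact: a_smono.
  rewrite /dataY (j_eq r) ?h1 ?(ltnW h2) //.
  have cd : (c <= d)%N by apply: leq_trans (ltnW h2) (aD' _ hr).
  rewrite numdataE //; last exact/ltnW/bD.
  by apply: leq_trans (ab _ hr); apply: phi_mono; [apply: ltnW | apply: aD'].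
have Yr_eq r : (r < size I)%N -> dataY d p s I J (a r.+1) = W (a r.+1) (b r.+1).
  move=> hr; rewrite /dataY (j_eq r) ?leqnn ?a_smono //.
  by rewrite numdataE ?aD' ?ab //; apply/ltnW/bD.
have Y'_eq r : (r < size I)%N -> dataY' d p s I J (a r) (a r.+1) = W (a r) (b r.+1).
  move=> hr; rewrite /dataY' (j_eq r) ?leqnn ?a_smono //.
  rewrite numdataE ?aD' ?bot1 //; last exact/ltnW/bD.
  exact: ltnW.
rewrite path_factor_prod // lastI lastJ -(zeta_ratio (aD' _ (leqnn _)) hz).
have eD : b (size I).+1 = D by rewrite /b hsz /= nth_rcons ltnn eqxx.
rewrite /A_IJ -/(a (size I)) -/(b (size I)).
have -> : Fab p (b (size I)) D (dataX d p s I J) = Fab p (b (size I)) D (W (a (size I))).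
  by rewrite -[X in Fab p _ X _]eD X_eq // -{1}eD.
rewrite !mulrA [zeta_Zp p d s * _]mulrC; congr (_ * _).
rewrite big_add1 big_mkord; apply: eq_bigr => [[r hr]] _ /=.
rewrite -!/(a _) -!/(b _) -!/(a r.+1) -!/(b r.+2) -!/(b r.+1).
rewrite (X_eq r (ltnW hr)) (Y_eq r hr) (Yr_eq r hr) (Y'_eq r hr).
by [].
Qed.

End NumericalData.

(** * Convergence of the generating functions *)

Section Tends.

Variable K : numFieldType.
Implicit Types (f g : nat -> K) (l c z : K).

Lemma half_half (e : K) : e = e / 2 + e / 2.
Proof. by field. Qed.

(** Elementary convergence, available in any field with a norm; see
    [tends_cvg] for complex numbers. *)
Definition tends f l :=
  forall e : K, 0 < e -> exists N, forall n, (N <= n)%N -> `|f n - l| < e.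

Lemma tends_eventually f g l N : tends f l -> (forall n, (N <= n)%N -> g n = f n) -> tends g l.
Proof.
move=> h fg e e0; have [M hM] := h e e0; exists (maxn N M) => n.
by rewrite geq_max => /andP [Nn Mn]; rewrite fg // hM.
Qed.

Lemma tends_cst l : tends (fun=> l) l.
Proof. by move=> e e0; exists 0%N => n _; rewrite subrr normr0. Qed.

Lemma tendsD f g l l' : tends f l -> tends g l' -> tends (fun n => f n + g n) (l + l').
Proof.
move=> hf hg e e0; have e2 : 0 < e / 2 by rewrite divr_gt0.
have [N hN] := hf _ e2; have [M hM] := hg _ e2; exists (maxn N M) => n.
rewrite geq_max => /andP [Nn Mn]; rewrite opprD addrACA.
by apply: le_lt_trans (ler_normD _ _) _; rewrite (half_half e) ltrD // ?hN ?hM.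
Qed.

Lemma tendsZ c f l : tends f l -> tends (fun n => c * f n) (c * l).
Proof.
move=> hf; have [->|c0] := eqVneq c 0.
  by move=> e e0; exists 0%N => n _; rewrite !mul0r subrr normr0.
have nc : 0 < `|c| by rewrite normr_gt0.
move=> e e0; have [N hN] := hf (e / `|c|) (divr_gt0 e0 nc); exists N => n Nn.
by rewrite -mulrBr normrM mulrC -ltr_pdivlMr // hN.
Qed.

Lemma tends_sum (I : Type) (r : seq I) (P : pred I) (f : I -> nat -> K) (l : I -> K) :
  (forall i, P i -> tends (f i) (l i)) ->
  tends (fun n => \sum_(i <- r | P i) f i n) (\sum_(i <- r | P i) l i).
Proof.
move=> h; elim: r => [|x r IH].
  by apply: (@tends_eventually (fun=> 0) _ _ 0); [rewrite big_nil; apply: tends_cst | move=> n _; rewrite big_nil].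
rewrite big_cons; case Px : (P x).
  by apply: (@tends_eventually _ _ _ 0 (tendsD (h x Px) IH)) => n _; rewrite big_cons Px.
by apply: (@tends_eventually _ _ _ 0 IH) => n _; rewrite big_cons Px.
Qed.

Lemma tends_delay k f l : tends f l -> tends (fun n => f (n - k)%N) l.
Proof.
move=> h e e0; have [N hN] := h e e0; exists (N + k)%N => n hn.
by apply: hN; rewrite leq_subRL ?(leq_trans (leq_addl _ _) hn) // addnC.
Qed.

Lemma tends_unique f l l' : tends f l -> tends f l' -> l = l'.
Proof.
move=> h h'; apply/eqP; apply/negPn/negP; rewrite -subr_eq0 -normr_gt0 => p0.
have := tendsD h (tendsZ (-1) h') => /(_ _ p0) [N /(_ N (leqnn N))].
have -> : f N + -1 * f N - (l + -1 * l') = - (l - l') by ring.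
by rewrite normrN ltxx.
Qed.

(** The archimedean property of the field, see [complex_exp_small]. *)
Hypothesis exp_small : forall z M e : K, `|z| < 1 -> 0 <= M -> 0 < e ->
  exists N, forall n, (N <= n)%N -> `|z| ^+ n * M < e.

(** A geometric recursion of delay k with a convergent perturbation: the error at n
    is at most about |z| ^ (n / k) times the errors on a window of length k, plus
    the accumulated error of the perturbation. *)
Lemma tends_recursion k z (T r : nat -> K) l : (0 < k)%N -> `|z| < 1 ->
  (forall n, T n = z * T (n - k)%N + r n) -> tends r l -> tends T (l / (1 - z)).
Proof.
move=> k0 z1 hT hr; have z1' : 0 < 1 - `|z| by rewrite subr_gt0.
have z1n : 1 - z != 0.
  by apply/eqP => e; move: z1; rewrite -[z]opprK -[- z](addKr 1) e addr0 opprK normr1 ltxx.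
set L := l / (1 - z).
have hL : L = z * L + l.
  by rewrite /L; field.
move=> e e0; have e2 : 0 < e / 2 by rewrite divr_gt0.
have [N hN] := hr _ (mulr_gt0 e2 z1').
pose M := \sum_(i < k) `|T (N + i)%N - L|.
have M0 : 0 <= M by apply: sumr_ge0.
have main q i : (i < k)%N -> `|T (N + q * k + i)%N - L| <= `|z| ^+ q * M + e / 2.
  move=> ik; elim: q => [|q IH].
    rewrite mul0n addn0 expr0 mul1r; apply: ler_wpDr; first exact: ltW.
    rewrite /M (bigD1 (Ordinal ik)) //=; apply: ler_wpDr => //.
    exact: sumr_ge0.
  have shift x y : z * x + y - L = z * (x - L) + (y - l) by rewrite {1}hL; ring.
  rewrite hT shift.
  have -> : (N + q.+1 * k + i - k = N + q * k + i)%N by rewrite mulSn; lia.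
  apply: le_trans (ler_normD _ _) _; rewrite normrM.
  have hr' : `|r (N + q.+1 * k + i)%N - l| <= e / 2 * (1 - `|z|).
    by apply/ltW/hN; rewrite -addnA leq_addr.
  apply: le_trans (lerD (ler_wpM2l (normr_ge0 z) IH) hr') _.
  by rewrite exprS le_eqVlt; apply/orP; left; apply/eqP; ring.
have [q0 hq] := exp_small z1 M0 e2.
exists (N + q0 * k)%N => n hn.
have en : n = (N + (n - N) %/ k * k + (n - N) %% k)%N.
  by rewrite -addnA -divn_eq subnKC // (leq_trans (leq_addr _ _) hn).
rewrite en; apply: le_lt_trans (main _ _ (ltn_pmod _ k0)) _.
rewrite [ltRHS](half_half e) ltrD2r hq // leq_divRL //.
by rewrite leq_subRL // (leq_trans (leq_addr _ _) hn).
Qed.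

End Tends.

Section Counts.

Variables (p d : nat).
Hypothesis p_pr : prime p.
Local Notation D := 'C(d, 2).

Definition valid i j := [&& (i <= d)%N, (phi d i <= j)%N & (j <= D)%N].

Lemma wt_eq0 i j : (i <= d)%N -> (j <= D)%N -> wt d i j = 0%N -> i = d /\ j = D.
Proof. by move=> hi hj /eqP; rewrite /wt addn_eq0 !subn_eq0 => /andP [h1 h2]; split; apply/eqP; rewrite eqn_leq ?hi ?hj. Qed.

(** The recursion and its initial value do not mention N. *)
Lemma weighted_count_stable N N' n i j : (0 < N)%N -> (0 < N')%N -> (n <= N)%N -> (n <= N')%N -> valid i j ->
  weighted_count p N d n i j = weighted_count p N' d n i j.
Proof.
move=> N0 N0'; have [m] := ubnP n; elim: m n i j => // m IH n i j hm hN hN' /and3P [hi hp hj].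
have [w0|w0] := posnP (wt d i j).
  have [-> ->] := wt_eq0 hi hj w0; by rewrite !weighted_count_bot.
apply/eqP; rewrite -(eqr_nat rat); apply/eqP.
rewrite !(weighted_count_rec p_pr) //; case: ifP => // le; congr (_ * _).
apply: eq_bigr => i' _; apply: eq_bigr => j' hj'; congr (_ * _%:R).
apply: IH; [lia|lia|lia|].
by rewrite /valid leq_ord hj' leq_ord.
Qed.

(** Here N = 2 n + 1, the value for which [count_model] is proved. *)
Definition state_count n i j := weighted_count p (n + n).+1 d n i j.

Lemma state_count_rec (K : numFieldType) n i j : valid i j -> (0 < wt d i j)%N ->
  (state_count n i j)%:R = (if (wt d i j <= n)%N then (wcoef p d i j)%:R *
     \sum_(i' < d.+1) \sum_(j' < D.+1 | (phi d i' <= j')%N)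
       Bcoef p d K i j i' j' * (state_count (n - wt d i j) i' j')%:R else 0) :> K.
Proof.
move=> /and3P [hi hp hj] w0; rewrite /state_count (weighted_count_rec p_pr) //; last by lia.
case: ifP => // le; congr (_ * _).
apply: eq_bigr => i' _; apply: eq_bigr => j' hj'; congr (_ * _%:R).
apply: weighted_count_stable; [lia|lia|lia|lia|].
by rewrite /valid leq_ord hj' leq_ord.
Qed.

Lemma state_count_bot n : state_count n d D = (n == 0)%N.
Proof. by rewrite /state_count weighted_count_bot. Qed.

Lemma num_normal_state_count (K : numFieldType) (F : groupType) n : free_nilpotent2 d F ->
  (num_normal F (p ^ n))%:R =
  \sum_(i < d.+1) \sum_(j < D.+1 | (phi d i <= j)%N) (state_count n i j)%:R :> K.
Proof.
move=> hF; rewrite (@num_normal_model d F p (n + n).+1 n) //; last by lia.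
rewrite count_model // natr_sum sum_pairs //.
by apply: eq_bigr => i _; apply: eq_bigr => j _; rewrite /state_count /weighted_count natr_sum.
Qed.

End Counts.

Section Series.

Variables (K : numFieldType) (p d : nat) (t : K).
Hypothesis p_pr : prime p.
Hypothesis exp_small : forall z M e : K, `|z| < 1 -> 0 <= M -> 0 < e ->
  exists N, forall n, (N <= n)%N -> `|z| ^+ n * M < e.
Local Notation D := 'C(d, 2).
Local Notation q := (p%:R^-1 : K).
Local Notation W := (Wnum p d t).
Local Notation B := (Bcoef p d K).
Local Notation ok := (valid d).

Let p_gt1 : (1 < p)%N := prime_gt1 p_pr.

Lemma qbinom_gt0 a b : (b <= a)%N -> 0 < qbinom q a b.
Proof.
move=> ba; apply: prodr_gt0 => i _.
have q0 : 0 < q by rewrite invr_gt0 ltr0n ltnW.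
have q1 : q < 1 by rewrite invf_lt1 ?ltr1n // ltr0n ltnW.
have lt k : (i < k)%N -> q ^+ k - q ^+ i < 0.
  by move=> ik; rewrite subr_lt0 ltr_iXn2l.
by rewrite -mulrNN -invrN mulr_gt0 ?invr_gt0 ?oppr_gt0 ?lt // (leq_trans (ltn_ord i)).
Qed.

Lemma Bcoef_ge0 i j i' j' : 0 <= B i j i' j'.
Proof.
have q0 a b : 0 <= qbinom q a b.
  by case: (leqP b a) => h; [apply/ltW/qbinom_gt0 | rewrite qbinom_small].
exact: mulr_ge0.
Qed.

Lemma Bcoef_nn i j : B i j i j = 1.
Proof. by rewrite /Bcoef !(qbinom_nn (q_neq0 K p_gt1) (q_exp_neq1 K p_gt1)) mulr1. Qed.

Lemma Bcoef_bot i j : ok i j -> 0 < B i j d D.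
Proof. by move=> /and3P [hi hp hj]; rewrite mulr_gt0 // qbinom_gt0 // leq_sub2r. Qed.

Lemma Bcoef_neq0 i j i' j' : ok i' j' -> B i j i' j' != 0 -> (i <= i')%N && (j <= j')%N.
Proof.
move=> /and3P [hi' hp' _] b0; case: (leqP i i') => [ii'|h] /=; last first.
  by move: b0; rewrite /Bcoef qbinom_small ?mul0r ?eqxx.
case: leqP => // h; case/eqP: b0; rewrite /Bcoef [X in _ * X]qbinom_small ?mulr0 //.
apply: ltn_sub2r => //; apply: leq_ltn_trans h.
exact: leq_trans (phi_mono ii' hi') hp'.
Qed.

Definition sum_states (f : nat -> nat -> K) : K :=
  \sum_(i < d.+1) \sum_(j < D.+1 | (phi d i <= j)%N) f i j.

Lemma sum_states_ge (f : nat -> nat -> K) i j : ok i j -> (forall i j, 0 <= f i j) ->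
  f i j <= sum_states f.
Proof.
move=> /and3P [hi hp hj] f0; rewrite /sum_states (bigD1 (inord i : 'I_d.+1)) //= inordK ?ltnS //.
rewrite (bigD1 (inord j : 'I_D.+1)) ?inordK ?ltnS //= -addrA.
by apply: ler_wpDr => //; rewrite addr_ge0 ?sumr_ge0 // => k _; rewrite sumr_ge0.
Qed.

Lemma eq_sum_states (f g : nat -> nat -> K) : (forall i j, ok i j -> f i j = g i j) -> sum_states f = sum_states g.
Proof.
move=> h; apply: eq_bigr => i _; apply: eq_bigr => j hj; apply: h.
by rewrite /valid leq_ord hj leq_ord.
Qed.

Lemma sum_statesD (f g : nat -> nat -> K) : sum_states (fun i j => f i j + g i j) = sum_states f + sum_states g.
Proof. by rewrite /sum_states -big_split; apply: eq_bigr => i _; rewrite -big_split. Qed.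

Lemma sum_statesZ c (f : nat -> nat -> K) : sum_states (fun i j => c * f i j) = c * sum_states f.
Proof. by rewrite /sum_states mulr_sumr; apply: eq_bigr => i _; rewrite mulr_sumr. Qed.

Lemma tends_sum_states (f : nat -> nat -> nat -> K) (l : nat -> nat -> K) :
  (forall i j, ok i j -> tends (f i j) (l i j)) ->
  tends (fun n => sum_states (fun i j => f i j n)) (sum_states l).
Proof.
move=> h; apply: tends_sum => i _; apply: tends_sum => j hj; apply: h.
by rewrite /valid leq_ord hj leq_ord.
Qed.

Definition state_partial i j n : K := \sum_(m < n) (state_count p d m i j)%:R * t ^+ m.
Definition step_partial i j n : K := sum_states (fun i' j' => B i j i' j' * state_partial i' j' n).

Lemma step_partialS i j n :
  step_partial i j n.+1 = step_partial i j n + sum_states (fun i' j' => B i j i' j' * (state_count p d n i' j')%:R) * t ^+ n.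
Proof.
rewrite mulrC -sum_statesZ -sum_statesD; apply: eq_sum_states => i' j' _.
by rewrite /state_partial big_ord_recr /=; ring.
Qed.

Lemma step_partial0 i j : step_partial i j 0 = 0.
Proof.
rewrite -[RHS](mul0r (sum_states (fun=> fun=> 0))) -sum_statesZ; apply: eq_sum_states => i' j' _.
by rewrite /state_partial big_ord0 !mulr0.
Qed.

Lemma state_partial_rec i j n : ok i j -> (0 < wt d i j)%N -> state_partial i j n = W i j * step_partial i j (n - wt d i j).
Proof.
move=> x w0; elim: n => [|n IH].
  by rewrite /state_partial big_ord0 sub0n step_partial0 mulr0.
rewrite {1}/state_partial big_ord_recr /= -/(state_partial i j n) IH (state_count_rec p_pr) //.
case: leqP => h; last first.
  have -> : (n.+1 - wt d i j = n - wt d i j)%N by lia.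
  by rewrite mul0r addr0.
rewrite subSn // step_partialS mulrDr; congr (_ + _).
have -> : t ^+ n = t ^+ wt d i j * t ^+ (n - wt d i j) by rewrite -exprD subnKC.
by rewrite /Wnum /sum_states; ring.
Qed.

Definition rest_partial i j n : K :=
  sum_states (fun i' j' => if (i' == i) && (j' == j) then 0 else B i j i' j' * state_partial i' j' n).

Lemma step_partial_split i j n : ok i j -> step_partial i j n = state_partial i j n + rest_partial i j n.
Proof.
move=> x; have e : state_partial i j n = sum_states (fun i' j' => if (i' == i) && (j' == j) then state_partial i j n else 0).
  case/and3P: x => hi hp hj.
  rewrite /sum_states (bigD1 (inord i : 'I_d.+1)) //= (bigD1 (inord j : 'I_D.+1)) ?inordK ?ltnS //=.
  rewrite !eqxx /= [X in _ + X + _]big1 ?addr0 => [|j' /andP [_ nj]]; last first.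
    by case: eqP => // e; case/eqP: nj; apply/val_inj; rewrite /= inordK.
  rewrite big1 ?addr0 // => i' ni; apply: big1 => j' _.
  by case: eqP => // e; case/eqP: ni; apply/val_inj; rewrite /= inordK.
rewrite e -sum_statesD; apply: eq_sum_states => i' j' _.
case: ifP => [/andP [/eqP -> /eqP ->]|_]; last by rewrite add0r.
by rewrite Bcoef_nn mul1r addr0.
Qed.

Hypothesis W_lt1 : forall i j, ok i j -> (0 < wt d i j)%N -> `|W i j| < 1.

Lemma W_neq1 i j : ok i j -> (0 < wt d i j)%N -> 1 - W i j != 0.
Proof.
move=> x w0; rewrite subr_eq0; apply/eqP => e; have := W_lt1 x w0.
by rewrite -e normr1 ltxx.
Qed.

Lemma state_partial_bot : tends (state_partial d D) 1.
Proof.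
apply: (@tends_eventually _ (fun=> 1) _ _ 1); first exact: tends_cst.
case=> // n _; rewrite /state_partial big_ord_recl state_count_bot //= mulr1 big1 ?addr0 // => i _.
by rewrite state_count_bot // mul0r.
Qed.

(** Induction on the weight of the state: apart from W(i, j) times its own delayed
    sum, only states of smaller weight contribute. *)
Lemma state_partial_tends_below w : exists u : nat -> nat -> K,
  forall i j, ok i j -> (wt d i j < w)%N -> tends (state_partial i j) (u i j).
Proof.
elim: w => [|w [u hu]]; first by exists (fun _ _ => 0).
pose r i j := sum_states (fun i' j' =>
   if (i' == i) && (j' == j) || (B i j i' j' == 0) then 0 else B i j i' j' * u i' j').
exists (fun i j => if (wt d i j < w)%N then u i j else if wt d i j == 0%N then 1
                   else W i j * (r i j / (1 - W i j))) => i j x.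
rewrite ltnS leq_eqVlt => /orP [/eqP ew|lt]; last by rewrite lt; apply: hu.
rewrite ew ltnn; case: eqP => [w0|/eqP w0].
  rewrite w0 in ew; case/and3P: x => hi _ hj.
  by have [-> ->] := wt_eq0 hi hj ew; apply: state_partial_bot.
have w0' : (0 < wt d i j)%N by rewrite ew lt0n.
have Gt : tends (step_partial i j) (r i j / (1 - W i j)).
  apply: (tends_recursion exp_small w0' (W_lt1 x w0') (r := rest_partial i j)).
    by move=> n; rewrite {1}step_partial_split // state_partial_rec.
  apply: tends_sum_states => i' j' y; case hc: ((i' == i) && (j' == j)) => /=; first exact: tends_cst.
  case: eqP => [->|/eqP b0]; first by apply: (@tends_eventually _ (fun=> 0) _ _ 0); [apply: tends_cst | move=> n _; rewrite mul0r].
  apply/tendsZ/hu => //; move: (Bcoef_neq0 y b0) hc; rewrite -ew /wt.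
  case/and3P: y x => hi' _ hj' /and3P [hi _ hj] /andP [ii' jj'].
  move=> /negbT; rewrite negb_and => /orP [] /eqP ne; [have : (i < i')%N by lia | have : (j < j')%N by lia]; lia.
apply: (@tends_eventually _ _ _ _ 0 (tendsZ (W i j) (tends_delay (wt d i j) Gt))) => n _.
exact: state_partial_rec.
Qed.

Lemma state_partial_tends : exists u : nat -> nat -> K,
  forall i j, ok i j -> tends (state_partial i j) (u i j).
Proof.
have [u hu] := state_partial_tends_below (d + D).+1; exists u => i j x; apply: hu => //.
by rewrite ltnS leq_add // leq_subr.
Qed.

Definition normal_count n : K := sum_states (fun i j => (state_count p d n i j)%:R).

Lemma normal_count_sum n : \sum_(m < n) normal_count m * t ^+ m = sum_states (fun i j => state_partial i j n).
Proof.
elim: n => [|n IH].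
  rewrite big_ord0 -[LHS](mul0r (sum_states (fun=> fun=> 0))) -sum_statesZ; apply: eq_sum_states => i j _.
  by rewrite /state_partial big_ord0 mul0r.
rewrite big_ord_recr /= IH mulrC -sum_statesZ -sum_statesD; apply: eq_sum_states => i j _.
by rewrite /state_partial big_ord_recr /= [t ^+ n * _]mulrC.
Qed.

(** The limits of the partial sums solve the system of [path_total]. *)
Lemma normal_count_tends : (1 < d)%N ->
  tends (fun n => \sum_(m < n) normal_count m * t ^+ m)
    ((1 - W 0 0)^-1 * sumsub (iota 1 (d - 2)) (fun I => sumsub (iota 1 (D - 1)) (fun J =>
    if phi_le d I J then path_factor p d t 0 0 I J else 0))).
Proof.
move=> d_gt1; have [u hu] := state_partial_tends.
have u_bot : u d D = 1.
  apply: tends_unique (hu _ _ _) state_partial_bot.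
  by rewrite /valid !leqnn -(phi_compl (leqnn d)) leq_addr.
have u_rec i j : (i <= d)%N -> (phi d i <= j)%N -> (j <= D)%N -> (0 < wt d i j)%N ->
  u i j = W i j * sum_states (fun i' j' => B i j i' j' * u i' j').
  move=> hi hp hj w0; have x : ok i j by rewrite /valid hi hp.
  apply: tends_unique (hu _ _ x) _.
  apply: (@tends_eventually _ (fun n => W i j * step_partial i j (n - wt d i j)) _ _ 0); last first.
    by move=> n _; apply: state_partial_rec.
  apply/tendsZ/tends_delay/tends_sum_states => i' j' y; exact/tendsZ/hu.
have W1 i j : (i <= d)%N -> (phi d i <= j)%N -> (j <= D)%N -> (0 < wt d i j)%N -> 1 - W i j != 0.
  by move=> hi hp hj; apply: W_neq1; rewrite /valid hi hp.
have n0 : 1 - W 0 0 != 0 by apply: W1; rewrite ?phi0 // wt_gt0l // ltnW.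
rewrite -(path_total p_gt1 d_gt1 u_bot W1 u_rec) mulrA mulVf // mul1r.
apply: (@tends_eventually _ _ _ _ 0 (tends_sum_states hu)) => n _; exact: normal_count_sum.
Qed.

End Series.

Section Convergence.

Variables (K : numFieldType) (p d : nat) (t : K).
Hypothesis p_pr : prime p.
Local Notation D := 'C(d, 2).
Local Notation W := (Wnum p d t).

(** Follow the recursion along the constant chain at (i, j), and step to the bottom
    state at the end. *)
Lemma normal_count_lower i j k : valid d i j -> (0 < wt d i j)%N ->
  Bcoef p d K i j d D * (wcoef p d i j)%:R ^+ k.+1 <= normal_count K p d (k.+1 * wt d i j).
Proof.
move=> x w0; have B0 := Bcoef_ge0 K d p_pr.
have bot : valid d d D by rewrite /valid !leqnn -(phi_compl (leqnn d)) leq_addr.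
have c0 : (0 : K) <= (wcoef p d i j)%:R by [].
apply: (@le_trans _ _ (state_count p d (k.+1 * wt d i j) i j)%:R); last first.
  by apply: (sum_states_ge (f := fun i' j' => (state_count p d (k.+1 * wt d i j) i' j')%:R) x) => i' j'.
elim: k => [|k IH].
  rewrite mul1n (state_count_rec p_pr) // leqnn subnn mulrC expr1; apply: ler_wpM2l => //.
  apply: le_trans (sum_states_ge (f := fun i' j' => Bcoef p d K i j i' j' * (state_count p d 0 i' j')%:R) bot _).
    by rewrite state_count_bot // mulr1.
  by move=> i' j'; rewrite mulr_ge0.
rewrite (state_count_rec p_pr) // leq_pmull // mulSn addKn exprS mulrCA; apply: ler_wpM2l => //.
apply: le_trans IH _.
apply: le_trans (sum_states_ge (f := fun i' j' => Bcoef p d K i j i' j' * (state_count p d (k.+1 * wt d i j) i' j')%:R) x _).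
  by rewrite Bcoef_nn // mul1r.
by move=> i' j'; rewrite mulr_ge0.
Qed.

(** If |W| >= 1, the bound [normal_count_lower] keeps infinitely many terms of the
    series away from 0. *)
Lemma convergent_W_lt1 l i j : tends (fun n => \sum_(m < n) normal_count K p d m * t ^+ m) l ->
  valid d i j -> (0 < wt d i j)%N -> `|W i j| < 1.
Proof.
move=> hl x w0; rewrite real_ltNge ?normr_real ?real1 //; apply/negP => W1.
have b0 := Bcoef_bot K p_pr x; set b := Bcoef p d K i j d D in b0.
have [N hN] := hl _ (divr_gt0 b0 (ltr0Sn K 1)).
pose n := (N.+1 * wt d i j)%N.
have Nn : (N <= n)%N by rewrite /n (leq_trans (leqnSn N)) // leq_pmulr.
have small : `|normal_count K p d n * t ^+ n| < b.
  have -> : normal_count K p d n * t ^+ n = (\sum_(m < n.+1) normal_count K p d m * t ^+ m - l) - (\sum_(m < n) normal_count K p d m * t ^+ m - l).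
    by rewrite big_ord_recr /=; ring.
  apply: le_lt_trans (ler_normB _ _) _.
  by rewrite [ltRHS](half_half b) ltrD ?hN // leqW.
have big := normal_count_lower N x w0; rewrite -/n -/b in big.
have a0 : 0 <= normal_count K p d n by apply: le_trans big; rewrite mulr_ge0 ?exprn_ge0 // ltW.
suff le : b <= `|normal_count K p d n * t ^+ n| by have := lt_le_trans small le; rewrite ltxx.
rewrite normrM (ger0_norm a0).
apply: le_trans (ler_wpM2r (normr_ge0 _) big).
have -> : t ^+ n = (t ^+ wt d i j) ^+ N.+1 by rewrite -exprM mulnC.
rewrite normrX -mulrA -exprMn.
have -> : (wcoef p d i j)%:R * `|t ^+ wt d i j| = `|W i j| by rewrite /Wnum normrM normr_nat.
by apply: ler_peMr (ltW b0) _; apply: exprn_ege1.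
Qed.

End Convergence.

(** * The normal zeta function *)

Section ComplexLimits.

Variable R : realType.
Local Notation C := R[i].

Lemma complex_exp_small (z M e : C) : `|z| < 1 -> 0 <= M -> 0 < e ->
  exists N, forall n, (N <= n)%N -> `|z| ^+ n * M < e.
Proof.
rewrite normc_def; set a := Num.sqrt _; case: M => m m'; case: e => e e'.
rewrite ltcE lecE ltcE /= => /andP [_ a1] /andP [/eqP -> m0] /andP [/eqP -> e0].
have a0 : 0 <= a by apply: sqrtr_ge0.
have na : `|a| < 1 by rewrite ger0_norm.
have m1 : 0 < m + 1 by rewrite ltr_wpDl.
have /cvgrPdist_lt /(_ _ (divr_gt0 e0 m1)) [N _ hN] := cvg_expr na.
exists N => n Nn; have := hN n Nn.
rewrite /= sub0r normrN ger0_norm ?exprn_ge0 // ltr_pdivlMr // => h.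
have -> : (a%:C ^+ n * (m +i* 0) = (a ^+ n * m)%:C)%C.
  by rewrite -[(m +i* 0)%C]/(m%:C)%C -rmorphXn -rmorphM.
rewrite ltcE /= eqxx /=; apply: le_lt_trans h.
by rewrite ler_wpM2l ?exprn_ge0 // lerDl.
Qed.

Lemma tends_cvg (f : nat -> C) (l : C) :
  tends f l <-> ((f : nat -> C^o) @ \oo --> (l : C^o))%classic.
Proof.
split=> [h|/cvgrPdist_lt h e e0].
  apply/cvgrPdist_lt => e e0; have [N hN] := h e e0.
  by exists N => // n /= Nn; rewrite distrC; apply: hN.
have [N _ hN] := h e e0; exists N => n Nn; rewrite distrC; exact: hN.
Qed.

End ComplexLimits.

Section ZetaSeries.

Variables (R : realType) (d : nat) (F : groupType) (p : nat).
Hypotheses (d_gt1 : (1 < d)%N) (hF : free_nilpotent2 d F) (p_pr : prime p).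
Local Notation C := R[i].
Local Notation D := 'C(d, 2).
Let p_gt1 : (1 < p)%N := prime_gt1 p_pr.
Let p_gt0 : (0 < p)%N := prime_gt0 p_pr.

Lemma zeta_seriesE (s : C) n :
  zeta_series F p s n = \sum_(m < n) normal_count C p d m * npow p (- s) ^+ m.
Proof.
rewrite /zeta_series /series /= big_mkord; apply: eq_bigr => m _.
by rewrite (num_normal_state_count p_pr _ _ hF) -mulrN npowMn.
Qed.

(** The constant bounds the exponent of p in every [wcoef], and each state other
    than the bottom one has weight at least 1. *)
Lemma Wnum_lt1_right (s : C) : (d * d + D * (d + D))%:R < complex.Re s ->
  forall i j, valid d i j -> (0 < wt d i j)%N -> `|Wnum p d (npow p (- s)) i j| < 1.
Proof.
set M := (d * d + D * (d + D))%N => hs i j /and3P [hi hp hj] w0.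
set t := npow p (- s).
have t_lt : `|t| < (p%:R ^+ M)^-1.
  rewrite normC_npow //.
  have -> : ((p%:R ^+ M)^-1 = ((p%:R ^+ M)^-1 : R)%:C%C :> C)%R.
    by rewrite fmorphV rmorphXn rmorph_nat.
  have -> : (p%:R : R) ^+ M = expR (ln p%:R * M%:R) by rewrite expRM_natr lnK ?posrE ?ltr0n.
  rewrite ltcR -expRN ltr_expR raddfN /= mulrN ltrN2 ltr_pM2l //.
  by rewrite ln_gt0 // ltr1n.
have pM0 : (0 : C) < p%:R ^+ M by rewrite exprn_gt0 // ltr0n.
have t1 : `|t| <= 1.
  apply: le_trans (ltW t_lt) _; rewrite invf_le1 // exprn_ege1 // ler1n //.
rewrite /Wnum normrM normr_nat normrX.
apply: (@le_lt_trans _ _ (p%:R ^+ M * `|t|)); last by rewrite mulrC -ltr_pdivlMr // div1r.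
apply: ler_pM => //; last by apply: ler_iXnr.
rewrite -natrX ler_nat /wcoef leq_exp2l //; apply: leq_add; first by rewrite leq_mul // leq_subr.
by rewrite leq_mul ?leq_subr // leq_add2l (leq_trans (leq_subr _ _) hj).
Qed.

Lemma A_sum_sumsub (s : C) :
  (forall k, (k < d)%N -> 1 - p%:R ^+ k * npow p (- s) != 0) ->
  zeta_Zp p d s * A_sum d p s =
  sumsub (iota 1 (d - 2)) (fun I => sumsub (iota 1 (D - 1)) (fun J =>
    if phi_le d I J then path_factor p d (npow p (- s)) 0 0 I J else 0)).
Proof.
move=> hz; rewrite /A_sum.
transitivity (zeta_Zp p d s * sumsub (iota 1 (d - 2)) (fun I => sumsub (iota 1 (D - 1)) (fun J =>
    if phi_le d I J then A_IJ d p s I J else 0))).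
  congr (_ * _); rewrite -sum_sub_pos; apply: eq_bigr => I _.
  rewrite -sum_sub_pos -big_mkcondr /=; apply: eq_bigl => J; congr (_ && _).
  apply/andP/idP => [[]//|h]; split=> //.
  by move: h; rewrite /phi_le all2E !size_map -!cardE => /andP [].
rewrite sumsubZ; apply: eq_sumsub => I sI; rewrite sumsubZ; apply: eq_sumsub => J sJ.
case: ifP => h; last by rewrite mulr0.
exact: A_IJ_path_factor.
Qed.

Lemma Wnum_top (s : C) : Wnum p d (npow p (- s)) 0 0 =
  npow p (- ((D + d)%:R * s - (d * D)%:R)).
Proof.
rewrite opprB npowD npow_nat // -mulrN npowMn /Wnum /wcoef /wt phi0 !subn0 mul0n add0n addn0 natrX.
by rewrite mulnC addnC.
Qed.

Lemma zeta_tends (s : C) :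
  (forall i j, valid d i j -> (0 < wt d i j)%N -> `|Wnum p d (npow p (- s)) i j| < 1) ->
  tends (zeta_series F p s)
    (zeta_Zp p d s * zeta_p p ((D + d)%:R * s - (d * D)%:R) * A_sum d p s).
Proof.
move=> W1; have h := normal_count_tends p_pr (@complex_exp_small R) W1 d_gt1.
have hz k : (k < d)%N -> 1 - p%:R ^+ k * npow p (- s) != 0.
  apply: zfactor_neq0 => i j hi hp hj; apply: (W_neq1 W1).
  by rewrite /valid hi hp.
rewrite mulrAC A_sum_sumsub // mulrC /zeta_p -Wnum_top.
by apply: (tends_eventually (N := 0%N) h) => n _; apply: zeta_seriesE.
Qed.

End ZetaSeries.

Local Open Scope classical_set_scope.
Local Open Scope ring_scope.

Theorem theorem4 (R : realType) (d : nat) (hd : (2 <= d)%N)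
    (F : groupType) (hF : free_nilpotent2 d F) (p : nat) (hp : prime p) :
  let d' := 'C(d, 2) in
  (exists sigma : R, forall s : R[i], sigma < complex.Re s ->
     cvgn (zeta_series F p s)) /\
  (forall s : R[i], cvgn (zeta_series F p s) ->
     normal_zeta F p s =
       zeta_Zp p d s
       * zeta_p p ((d' + d)%:R * s - (d * d')%:R)
       * A_sum d p s).
Proof.
move=> d'; split.
  exists (d * d + d' * (d + d'))%:R => s hs; apply/cvg_ex.
  have /(zeta_tends hd hF hp) /tends_cvg h : forall i j, valid d i j -> (0 < wt d i j)%N ->
      `|Wnum p d (npow p (- s)) i j| < 1 by apply: Wnum_lt1_right.
  by exists (zeta_Zp p d s * zeta_p p ((d' + d)%:R * s - (d * d')%:R) * A_sum d p s).
move=> s /cvg_ex [l hl]; have tl : tends (zeta_series F p s) l by apply/tends_cvg.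
have W1 : forall i j, valid d i j -> (0 < wt d i j)%N -> `|Wnum p d (npow p (- s)) i j| < 1.
  move=> i j; apply: (@convergent_W_lt1 _ p d _ hp l).
  by apply: (tends_eventually (N := 0%N) tl) => n _; rewrite (zeta_seriesE hF hp).
have := tends_unique tl (zeta_tends hd hF hp W1) => <-.
apply: (cvg_lim _ hl); exact: (@norm_hausdorff _ (R[i]^o)).
Qed.
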